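(* Let $E$ be the Horrocks-Mumford bundle on $\mathbb{P}_4=\mathbb{P}(\mathbb{C}^5)$, let $g$ be the Fubini-Study metric on $\mathbb{P}_4$, and let $h_1$ be the natural Hermitian metric in $E$ induced by the standard Hermitian inner product of $\mathbb{C}^5$ (all as constructed in the context). Then $h_1$ is not $g$-Hermitian-Einstein; that is, there is no real constant $\lambda$ such that $K_{h_1}=\lambda\cdot\mathrm{id}_E$ on $\mathbb{P}_4$, where $K_{h_1}$ is the mean curvature of $h_1$ with respect to $g$.
   Context: **Projective space and $Q$.** $\mathbb{P}_4=\mathbb{P}(\mathbb{C}^5)$ is the space of lines in $\mathbb{C}^5$, with homogeneous coordinates $(x_0:\ldots:x_4)$ with respect to the standard basis $e_0,\ldots,e_4$ of $\mathbb{C}^5$. The tautological line bundle is $\mathcal{O}_{\mathbb{P}_4}(-1)\subset\mathbb{P}_4\times\mathbb{C}^5$. Let $Q=T_{\mathbb{P}_4}(-1)=(\mathbb{C}^5\otimes\mathcal{O}_{\mathbb{P}_4})/\mathcal{O}_{\mathbb{P}_4}(-1)$ (a holomorphic vector bundle of rank 4), and let $\pi:\mathbb{C}^5\otimes\mathcal{O}_{\mathbb{P}_4}\to Q$ be the natural projection of the Euler sequence. **The bundle $E$.** Define linear maps $a_\pm:\mathbb{C}^5\to\Lambda^2\mathbb{C}^5$ by $a_+(e_i)=e_{i+2}\wedge e_{i+3}$ and $a_-(e_i)=e_{i+1}\wedge e_{i+4}$, $0\le i\le 4$ (indices mod 5). Define bundle maps $$a:\mathbb{C}^5\otimes\mathcal{O}_{\mathbb{P}_4}\to(\Lambda^2Q)^{\oplus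 2},\qquad a(x)(v)=\big(\Lambda^2\pi(x)(a_+(v)),\ \Lambda^2\pi(x)(a_-(v))\big),$$ $$b:(\Lambda^2Q)^{\oplus 2}\to(\mathbb{C}^5)^*\otimes\Lambda^4Q=\mathrm{Hom}(\mathbb{C}^5\otimes\mathcal{O}_{\mathbb{P}_4},\Lambda^4Q),$$ $$b(x)(\xi,\eta)(v)=-\eta\wedge\Lambda^2\pi(x)(a_+(v))+\xi\wedge\Lambda^2\pi(x)(a_-(v)),$$ for $v\in\mathbb{C}^5$ and $\xi,\eta\in\Lambda^2Q(x)$. These maps form a monad: $a$ is injective as a bundle map, $b$ is surjective, and $\mathrm{im}(a)\subset\ker(b)$. Its cohomology is the holomorphic rank 2 bundle $E(-2):=\ker(b)/\mathrm{im}(a)$. The Horrocks-Mumford bundle is $E:=E(-2)\otimes\mathcal{O}_{\mathbb{P}_4}(2)$; it is a stable holomorphic bundle of rank 2 with Chern numbers $c_1(E)=5$, $c_2(E)=10$. **The metric $h_1$.** The standard Hermitian inner product in $\mathbb{C}^5$ defines the flat metric in $\mathbb{C}^5\otimes\mathcal{O}_{\mathbb{P}_4}$, and hence a quotient metric $h_Q$ in $Q$. (The quotient metric on $V/W$ is the one obtained by identifying $V/W$ with the orthogonal complement $W^\perp\subset V$.) Let $\Lambda^2h_Q$ be the induced metric in $\Lambda^2Q$, determined by $$\Lambda^2h_Q(u_1\wedge u_2,w_1\wedge w_2)=h_Q(u_1,w_1)h_Q(u_2,w_2)-h_Q(u_1,w_2)h_Q(u_2,w_1).$$ Let $h_3$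 be the metric in $(\Lambda^2Q)^{\oplus2}$ which equals $\Lambda^2h_Q$ on each summand and makes the two summands orthogonal. Let $h_b$ be the restriction of $h_3$ to $\ker(b)$, and let $h$ be the quotient metric induced by $h_b$ in $E(-2)=\ker(b)/\mathrm{im}(a)$. Let $h_2$ be the metric in $\mathcal{O}_{\mathbb{P}_4}(2)=\mathcal{O}_{\mathbb{P}_4}(1)^{\otimes 2}$ induced by the inclusion $\mathcal{O}_{\mathbb{P}_4}(1)^*=\mathcal{O}_{\mathbb{P}_4}(-1)\hookrightarrow\mathbb{P}_4\times\mathbb{C}^5$ and the standard inner product of $\mathbb{C}^5$. Then $h_1:=h\otimes h_2$ is the induced metric in $E=E(-2)\otimes\mathcal{O}_{\mathbb{P}_4}(2)$. **Fubini-Study metric and Hermitian-Einstein condition.** The Fubini-Study metric $g$ on $\mathbb{P}_4$ has Kähler form $\omega_g$ given, in the coordinates $(x_1,\ldots,x_4)\mapsto(1:x_1:\ldots:x_4)$ on $U_0=\{x_0\ne0\}$, by $$\omega_g=\frac{i}{2}\sum_{\alpha,\beta=1}^4g_{\alpha\beta}\,dx_\alpha\wedge d\bar x_\beta,\qquad g_{\alpha\beta}=\frac{\delta_{\alpha\beta}}{n}-\frac{\bar x_\alpha x_\beta}{n^2},\qquad n=1+\sum_{i=1}^4|x_i|^2.$$ For a Hermitian metric $k$ in a holomorphic vector bundle $F_0$ on $\mathbb{P}_4$, let $D$ be its Chern connection (the unique $k$-unitary connection compatible with the holomorphic structure) and $F=D\circ D$ its curvature. The mean curvature $K_k$ of $k$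 with respect to $g$ is the endomorphism of $F_0$ defined by $$F\wedge\omega_g^3=-\frac{i}{2}K_k\,\omega_g^4.$$ The metric $k$ is called $g$-Hermitian-Einstein if $K_k=\lambda\cdot\mathrm{id}_{F_0}$ for some real constant $\lambda$. *)

(* Defs.v *)
From HB Require Import structures.
From mathcomp Require Import all_boot all_order all_algebra.
From mathcomp Require Import complex ring.
From mathcomp Require Import all_classical all_reals all_analysis.
Import Order.TTheory GRing.Theory Num.Theory numFieldNormedType.Exports.

Set Implicit Arguments.
Unset Strict Implicit.
Unset Printing Implicit Defensive.

Local Open Scope classical_set_scope.
Local Open Scope ring_scope.

(* Named as a [numClosedFieldType] so that the topology of numeric fields
   is inferred on it. *)
Definition CC (R : realType) : numClosedFieldType := R[i]%C.

Definition toC (R : realType) (t : R) : CC R := (t%:C)%C.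

Section LinearAlgebra.
Variable R : realType.
Local Notation C := (CC R).
Implicit Types I J : finType.

Definition vec I : Type := {ffun I -> C}.
HB.instance Definition _ I := GRing.Lmodule.on (vec I).

Definition hdot I (u v : vec I) : C := \sum_i u i * (v i)^*.

Definition unitv I (i : I) : vec I := [ffun j => (j == i)%:R].

Definition orthc I (N : set (vec I)) : set (vec I) :=
  [set v | forall w, N w -> hdot v w = 0].

(* For a linear subspace [N], the projection onto [orthc N] along [N]. *)
Definition oproj I (N : set (vec I)) (v : vec I) : vec I :=
  xget 0 [set w | orthc N w /\ N (v - w)].

Definition pairv I J (u : vec I) (v : vec J) : vec (I + J)%type :=
  [ffun k => match k with inl i => u i | inr j => v j end].
Definition fstv I J (w : vec (I + J)%type) : vec I := [ffun i => w (inl i)].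
Definition sndv I J (w : vec (I + J)%type) : vec J := [ffun j => w (inr j)].

Definition tensv I J (u : vec I) (v : vec J) : vec (I * J)%type :=
  [ffun k => u k.1 * v k.2].

(* The exterior algebra of C^n.  The coordinate at S = {i_1 < ... < i_k} is
   the coefficient of e_{i_1} /\ ... /\ e_{i_k}. *)
Definition ext n : Type := vec {set 'I_n}.
HB.instance Definition _ n := GRing.Lmodule.on (ext n).

(* e_A /\ e_B = shuffle_sign A B *: e_{A :|: B} for disjoint A and B. *)
Definition shuffle_sign n (A B : {set 'I_n}) : C :=
  (-1) ^+ #|[pred p : 'I_n * 'I_n |
             [&& p.1 \in A, p.2 \in B & (p.2 < p.1)%N]]|.

Definition wedge n (u v : ext n) : ext n :=
  [ffun S : {set 'I_n} => \sum_(A : {set 'I_n} | A \subset S)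
     shuffle_sign A (S :\: A) * u A * v (S :\: A)].

Definition ext_one n : ext n := unitv (finset.set0 : {set 'I_n}).
Definition ext_vec n (v : vec 'I_n) : ext n :=
  \sum_i v i *: (unitv [set i]%SET : ext n).

(* The algebra morphism induced by the linear map e_i |-> f i; on Lambda^k it
   is the k-th exterior power of that map. *)
Definition ext_map n m (f : 'I_n -> vec 'I_m) (u : ext n) : ext m :=
  \sum_(S : {set 'I_n})
    u S *: \big[@wedge m/ext_one m]_(i in S) ext_vec (f i).

Definition wedge_pow n (u : ext n) (k : nat) : ext n :=
  iter k (wedge u) (ext_one n).

Lemma hdot_pairv (I J : finType) (u u' : vec I) (v v' : vec J) :
  hdot (pairv u v) (pairv u' v') = hdot u u' + hdot v v'.
Proof.
rewrite /hdot big_sumType; congr (_ + _);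
  by apply: eq_bigr => i _; rewrite !ffunE.
Qed.

Lemma hdot_tensv (I J : finType) (u u' : vec I) (v v' : vec J) :
  hdot (tensv u v) (tensv u' v') = hdot u u' * hdot v v'.
Proof.
rewrite /hdot big_distrlr pair_bigA; apply: eq_bigr => -[i j] _ /=.
by rewrite !ffunE /= rmorphM mulrACA.
Qed.

Lemma hdot_conj (I : finType) (u v : vec I) :
  hdot [ffun i => (u i)^*] [ffun i => (v i)^*] = hdot v u :> C.
Proof. by apply: eq_bigr => i _; rewrite !ffunE conjCK mulrC. Qed.

Lemma ext_vecE n (v : vec 'I_n) A :
  ext_vec v A = \sum_i v i * (A == [set i]%SET)%:R.
Proof. by rewrite sum_ffunE; apply: eq_bigr => i _; rewrite !ffunE. Qed.

Definition wsgn n (i j : 'I_n) : C := (i != j)%:R * (-1) ^+ (j < i)%N.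

Lemma wedge_vecE n (u v : vec 'I_n) S :
  wedge (ext_vec u) (ext_vec v) S =
  \sum_i \sum_j u i * v j * (wsgn i j * (S == [set i; j]%SET)%:R).
Proof.
rewrite ffunE.
transitivity (\sum_i \sum_j u i * v j * \sum_(A : {set 'I_n} | A \subset S)
   (shuffle_sign A (S :\: A) * (A == [set i]%SET)%:R *
    (S :\: A == [set j]%SET)%:R)).
  transitivity (\sum_(A : {set 'I_n} | A \subset S) \sum_i \sum_j
      u i * v j * (shuffle_sign A (S :\: A) * (A == [set i]%SET)%:R *
                   (S :\: A == [set j]%SET)%:R)).
    apply: eq_bigr => A _; rewrite !ext_vecE -mulrA big_distrlr mulr_sumr.
    apply: eq_bigr => i _; rewrite mulr_sumr; apply: eq_bigr => j _ /=; ring.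
  rewrite exchange_big; apply: eq_bigr => i _.
  by rewrite exchange_big; apply: eq_bigr => j _; rewrite mulr_sumr.
apply: eq_bigr => i _; apply: eq_bigr => j _; congr (_ * _).
rewrite big_mkcond (bigD1 [set i]%SET) //= big1 ?addr0; last first.
  by move=> A /negPf ->; rewrite mulr0 mul0r; case: ifP.
rewrite eqxx mulr1 finset.sub1set.
case: (eqVneq i j) => [->|nij].
  rewrite /wsgn eqxx !mul0r; case: ifP => // _.
  case: eqP => [/setP/(_ j)|_]; last by rewrite mulr0.
  by rewrite !inE eqxx.
rewrite /wsgn nij mul1r.
have -> : (S == [set i; j]%SET) = (i \in S) && (S :\ i == [set j])%SET.
  apply/eqP/andP => [->|[iS /eqP Sj]].
    rewrite !inE eqxx; split=> //; apply/eqP/setP => k; rewrite !inE.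
    by case: (eqVneq k i) => [->|] //=; rewrite (negPf nij).
  by rewrite -(finset.setD1K iS) Sj.
case: ifP => iS /=; last by rewrite mulr0.
case: (eqVneq (S :\ i)%SET [set j]%SET) => [->|_]; last by rewrite !mulr0.
rewrite !mulr1 /shuffle_sign; congr (_ ^+ _).
case: (ltnP j i) => ji /=.
  rewrite -[RHS](cards1 (i, j)); apply: eq_card => -[a b].
  rewrite !inE /= xpair_eqE.
  by case: (eqVneq a i) => [->|_] //=; case: (eqVneq b j) => [->|_] //=.
rewrite -[RHS](@eq_card0 _ (@pred0 ('I_n * 'I_n)%type)) //.
apply: eq_card => -[a b].
rewrite !inE /=; apply/negP => /and3P[/eqP -> /eqP ->].
by rewrite ltnNge ji.
Qed.

Lemma wsgn_mul n (i j k l : 'I_n) :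
  wsgn i j * wsgn k l * ([set i; j] == [set k; l])%SET%:R =
  (i == k)%:R * (j == l)%:R - (i == l)%:R * (j == k)%:R :> C.
Proof.
rewrite /wsgn.
case: (eqVneq i j) => [->|nij].
  by rewrite !mul0r mulrC subrr.
case: (eqVneq k l) => [->|nkl].
  by rewrite mul0r mulr0 mul0r subrr.
rewrite !mul1r.
have -> : ([set i; j] == [set k; l])%SET =
  (i == k) && (j == l) || (i == l) && (j == k).
  apply/eqP/idP => [/setP E|]; last first.
    by case/orP => /andP[/eqP-> /eqP->] //; rewrite finset.setUC.
  have := E i; have := E j; rewrite !inE !eqxx orbT /=.
  case: (eqVneq j k) => [jk|_]; case: (eqVneq j l) => [jl|_] //= _.
  - by rewrite -jk (negPf nij) /= andbT => <-.
  - by rewrite -jk (negPf nij) /= andbT => <-.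
  - by rewrite -jl (negPf nij) orbF /= andbT => <-.
case: (eqVneq i k) nij => [->|nik] nij; case: (eqVneq j l) nij => [->|njl] nij //=.
- rewrite (negPf nkl) /= !mul0r mul1r mulr1 subr0.
  by rewrite -signr_addb addbb.
- by rewrite (negPf nkl) /= !(mulr0, mul0r) subr0.
- by rewrite (eq_sym l k) (negPf nkl) /= andbF !(mulr0, mul0r) subr0.
case: (eqVneq i l) nij => [->|nil] nij; case: (eqVneq j k) nij => [->|njk] nij //=;
  rewrite ?(mulr0, mul0r, subr0) //.
rewrite mul1r mulr1 sub0r -signr_addb.
by case: ltngtP nkl => // /val_inj ->; rewrite eqxx.
Qed.

(* The standard product of Lambda^2 C^n is the one induced from C^n. *)
Lemma hdot_wedge n (u1 u2 w1 w2 : vec 'I_n) :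
  hdot (wedge (ext_vec u1) (ext_vec u2)) (wedge (ext_vec w1) (ext_vec w2)) =
  hdot u1 w1 * hdot u2 w2 - hdot u1 w2 * hdot u2 w1.
Proof.
rewrite {1}/hdot.
transitivity (\sum_i \sum_j \sum_k \sum_l u1 i * u2 j * (w1 k)^* * (w2 l)^* *
   (wsgn i j * wsgn k l * ([set i; j] == [set k; l])%SET%:R)).
  transitivity (\sum_S \sum_i \sum_j \sum_k \sum_l
     u1 i * u2 j * (w1 k)^* * (w2 l)^* *
     (wsgn i j * wsgn k l * (S == [set i; j]%SET)%:R * (S == [set k; l]%SET)%:R)).
    apply: eq_bigr => S _; rewrite !wedge_vecE rmorph_sum mulr_suml.
    apply: eq_bigr => i _; rewrite mulr_suml; apply: eq_bigr => j _.
    rewrite mulr_sumr; apply: eq_bigr => k _.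
    rewrite rmorph_sum mulr_sumr; apply: eq_bigr => l _ /=.
    by rewrite !rmorphM /= !rmorph_nat rmorphXn rmorphN1 /wsgn; ring.
  rewrite exchange_big; apply: eq_bigr => i _.
  rewrite exchange_big; apply: eq_bigr => j _.
  rewrite exchange_big; apply: eq_bigr => k _.
  rewrite exchange_big; apply: eq_bigr => l _ /=.
  rewrite -mulr_sumr; congr (_ * _).
  rewrite (bigD1 [set i; j]%SET) //= big1 ?addr0 => [|S /negPf ->]; last first.
    by rewrite mulr0 mul0r.
  by rewrite eqxx mulr1.
rewrite /hdot !big_distrlr -sumrB; apply: eq_bigr => i _.
rewrite /= -sumrB; apply: eq_bigr => j _.
under eq_bigr => k _ do under eq_bigr => l _ do rewrite wsgn_mul mulrBr.
under eq_bigr => k _ do rewrite sumrB.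
rewrite sumrB; congr (_ - _).
  rewrite (bigD1 i) //= [X in _ + X]big1 ?addr0 => [|k /negPf nk]; last first.
    by apply: big1 => l _; rewrite eq_sym nk !(mul0r, mulr0).
  rewrite (bigD1 j) //= [X in _ + X]big1 ?addr0 => [|l /negPf nl]; last first.
    by rewrite (eq_sym j) nl !(mul0r, mulr0).
  by rewrite !eqxx !mulr1 -!mulrA; congr (_ * _); rewrite mulrCA.
rewrite (bigD1 j) //= [X in _ + X]big1 ?addr0 => [|k /negPf nk]; last first.
  by apply: big1 => l _; rewrite (eq_sym j) nk !(mul0r, mulr0).
rewrite (bigD1 i) //= [X in _ + X]big1 ?addr0 => [|l /negPf nl]; last first.
  by rewrite (eq_sym i) nl !(mul0r, mulr0).
rewrite !eqxx !mulr1 -!mulrA; congr (_ * _).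
by rewrite mulrA mulrC.
Qed.

End LinearAlgebra.

Section Bundles.
Variable R : realType.
Local Notation C := (CC R).
Local Notation vec := (vec R).
Local Notation ext := (ext R).
Implicit Types I J : finType.

Record P4 := MkP4 {
  line :> set (vec 'I_5);
  line_spanned : exists2 x : vec 'I_5, x != 0 &
    line = [set c *: x | c in [set: C]] }.

Definition affine_lift (j : 'I_5) (z : 'rV[C]_4) : vec 'I_5 :=
  [ffun i => if unlift j i is Some k then z 0 k else 1].

Lemma affine_lift_neq0 (j : 'I_5) (z : 'rV[C]_4) : affine_lift j z != 0.
Proof.
apply/eqP => /ffunP /(_ j); rewrite !ffunE unlift_none.
by move/eqP; rewrite oner_eq0.
Qed.

(* The inverse of the standard affine chart on U_j = {x_j <> 0}. *)
Definition chart (j : 'I_5) (z : 'rV[C]_4) : P4 :=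
  MkP4 (ex_intro2 _ _ (affine_lift j z) (affine_lift_neq0 j z) erefl).

(* A holomorphic bundle presented as a smooth subbundle of the trivial bundle
   with fibre C^I.  The holomorphic structure is separate data, since a
   quotient bundle is embedded as an orthogonal complement, which is not a
   holomorphic subbundle: [holsec j U s] says that s is a holomorphic section
   over the open set U of the affine chart U_j. *)
Record bundle I := Bundle {
  fibre : P4 -> set (vec I);
  holsec : 'I_5 -> set 'rV[C]_4 -> ('rV[C]_4 -> vec I) -> Prop }.

Definition locally_on (U : set 'rV[C]_4) (P : set 'rV[C]_4 -> Prop) : Prop :=
  forall z, U z -> exists V : set 'rV[C]_4,
    [/\ open V, V z, V `<=` U & P V].

(* Differentiability is over the complex field, i.e. holomorphy. *)
Definition triv I : bundle I :=
  Bundle (fun _ => setT)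
    (fun _ U s => forall z, U z ->
       forall i, differentiable (fun y : 'rV[C]_4 => s y i : C) z).

Definition subb I (B : bundle I) (M : P4 -> set (vec I)) : bundle I :=
  Bundle (fun p => fibre B p `&` M p)
    (fun j U s => holsec B j U s /\ forall z, U z -> M (chart j z) (s z)).

(* The quotient B / N, with B_p / N_p identified with the orthogonal
   complement of N_p in B_p.  The holomorphic sections are locally the classes
   of holomorphic sections of B. *)
Definition quotb I (B : bundle I) (N : P4 -> set (vec I)) : bundle I :=
  Bundle (fun p => fibre B p `&` orthc (N p))
    (fun j U s =>
       (forall z, U z -> (fibre B (chart j z) `&` orthc (N (chart j z))) (s z))
       /\ locally_on U (fun V => exists t, holsec B j V t /\
            forall y, V y -> N (chart j y) (t y - s y))).

Definition dsumb I J (B : bundle I) (B' : bundle J) : bundle (I + J)%type :=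
  Bundle (fun p => [set w | fibre B p (fstv w) /\ fibre B' p (sndv w)])
    (fun j U s => holsec B j U (fun z => fstv (s z)) /\
                  holsec B' j U (fun z => sndv (s z))).

Definition tensb I J (B : bundle I) (B' : bundle J) : bundle (I * J)%type :=
  Bundle
    (fun p => [set w | exists m (u : 'I_m -> vec I) (v : 'I_m -> vec J),
       (forall a, fibre B p (u a) /\ fibre B' p (v a)) /\
       w = \sum_a tensv (u a) (v a)])
    (fun j U s => locally_on U (fun V =>
       exists m (u : 'I_m -> 'rV[C]_4 -> vec I) (v : 'I_m -> 'rV[C]_4 -> vec J),
       (forall a, holsec B j V (u a) /\ holsec B' j V (v a)) /\
       forall y, V y -> s y = \sum_a tensv (u a y) (v a y))).

Definition ext2b n (B : bundle 'I_n) : bundle {set 'I_n} :=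
  Bundle
    (fun p => [set w | exists m (u v : 'I_m -> vec 'I_n),
       (forall a, fibre B p (u a) /\ fibre B p (v a)) /\
       w = \sum_a wedge (ext_vec (u a)) (ext_vec (v a))])
    (fun j U s => locally_on U (fun V =>
       exists m (u v : 'I_m -> 'rV[C]_4 -> vec 'I_n),
       (forall a, holsec B j V (u a) /\ holsec B j V (v a)) /\
       forall y, V y ->
         s y = \sum_a wedge (ext_vec (u a y)) (ext_vec (v a y)))).

(* A linear form on B_p is <-, v> for a unique v in B_p; it is stored by its
   coefficients conj v, so that the form phi sends t to \sum_i phi i * t i. *)
Definition dualb I (B : bundle I) : bundle I :=
  Bundle
    (fun p => [set phi | exists2 v, fibre B p v & phi = [ffun i => (v i)^*]])
    (fun j U phi =>
       (forall z, U z -> exists2 v, fibre B (chart j z) v &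
          phi z = [ffun i => (v i)^*]) /\
       forall (V : set 'rV[C]_4) t, open V -> V `<=` U -> holsec B j V t ->
         forall z, V z ->
           differentiable
             (fun y : 'rV[C]_4 => \sum_i phi y i * t y i : C) z).

Definition fibre_metric I : Type := P4 -> vec I -> vec I -> C.

Definition hol_frame I (B : bundle I) r (j : 'I_5) (U : set 'rV[C]_4)
    (s : 'I_r -> 'rV[C]_4 -> vec I) : Prop :=
  (forall i, holsec B j U (s i)) /\
  forall z, U z ->
    (forall i, fibre B (chart j z) (s i z)) /\
    forall v, fibre B (chart j z) v ->
      exists! c : {ffun 'I_r -> C}, v = \sum_i c i *: s i z.

End Bundles.

Section ChernConnection.
Variable R : realType.
Local Notation C := (CC R).
Local Notation vec := (vec R).
Implicit Types I : finType.

(* Complex-valued exterior forms at a point of C^4, in the basis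
   dz_1, ..., dz_4, conj dz_1, ..., conj dz_4. *)
Definition cform : Type := ext R (4 + 4).
HB.instance Definition _ := GRing.Lmodule.on cform.

Definition dz (a : 'I_4) : cform := ext_vec (unitv R (lshift 4 a)).
Definition dzbar (a : 'I_4) : cform := ext_vec (unitv R (rshift 4 a)).

Definition conj_index (k : 'I_(4 + 4)) : 'I_(4 + 4) :=
  match fintype.split k with inl a => rshift 4 a | inr a => lshift 4 a end.
Definition conj_form (w : cform) : cform :=
  ext_map (fun k => unitv R (conj_index k)) [ffun S => (w S)^*].

(* The derivative of f at z along the real line z + t v, t real. *)
Definition real_deriv (f : 'rV[C]_4 -> C) (z v : 'rV[C]_4) : C :=
  (derive1 (fun t : R => complex.Re (f (z + toC t *: v))) 0 +i*
   derive1 (fun t : R => complex.Im (f (z + toC t *: v))) 0)%C.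

Definition pderiv (f : 'rV[C]_4 -> C) (z : 'rV[C]_4) (a : 'I_4) : C :=
  (real_deriv f z (delta_mx 0 a) -
   'i * real_deriv f z ('i *: delta_mx 0 a)) / 2.
Definition pderivbar (f : 'rV[C]_4 -> C) (z : 'rV[C]_4) (a : 'I_4) : C :=
  (real_deriv f z (delta_mx 0 a) +
   'i * real_deriv f z ('i *: delta_mx 0 a)) / 2.

Definition dfun (f : 'rV[C]_4 -> C) (z : 'rV[C]_4) : cform :=
  \sum_a (pderiv f z a *: dz a + pderivbar f z a *: dzbar a).

Definition dform (w : 'rV[C]_4 -> cform) (z : 'rV[C]_4) : cform :=
  \sum_(S : {set 'I_(4 + 4)}) wedge (dfun (fun y => w y S) z) (unitv R S).

(* The form theta of the Chern connection D of k in the holomorphic frame s: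
   D s_l = \sum_i theta i l (x) s_i.  Compatibility with the holomorphic
   structure means that D s_l has type (1,0); compatibility with the metric is
   d k(s_l, s_m) = k(D s_l, s_m) + k(s_l, D s_m). *)
Definition chern_form I (k : fibre_metric R I) r (j : 'I_5) (U : set 'rV[C]_4)
    (s : 'I_r -> 'rV[C]_4 -> vec I)
    (theta : 'I_r -> 'I_r -> 'rV[C]_4 -> cform) : Prop :=
  let gram l m z := k (chart j z) (s l z) (s m z) in
  forall z, U z -> forall l m,
    (exists c : 'I_4 -> C, theta l m z = \sum_a c a *: dz a) /\
    dfun (gram l m) z =
      \sum_i (gram i m z *: theta i l z + gram l i z *: conj_form (theta i m z)).

(* D (D s_l) = \sum_i curvature theta i l (x) s_i. *)
Definition curvature r (theta : 'I_r -> 'I_r -> 'rV[C]_4 -> cform)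
    (i l : 'I_r) (z : 'rV[C]_4) : cform :=
  dform (theta i l) z + \sum_m wedge (theta i m z) (theta m l z).

(* The Fubini-Study metric is invariant under permutation of the homogeneous
   coordinates, so it is given by the same formula in each chart U_j. *)
Definition FS_metric (z : 'rV[C]_4) (a b : 'I_4) : C :=
  let n := 1 + \sum_i `|z 0 i| ^+ 2 in
  (a == b)%:R / n - (z 0 a)^* * z 0 b / n ^+ 2.
Definition FS_form (z : 'rV[C]_4) : cform :=
  ('i / 2) *: \sum_a \sum_b FS_metric z a b *: wedge (dz a) (dzbar b).

(* F /\ omega^3 = - i/2 K omega^4, applied to each vector of each local
   holomorphic frame and read off coefficientwise in S. *)
Definition is_mean_curvature I (B : bundle R I) (k : fibre_metric R I)
    (K : P4 R -> vec I -> vec I) : Prop :=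
  forall r (j : 'I_5) (U : set 'rV[C]_4) (s : 'I_r -> 'rV[C]_4 -> vec I)
    (theta : 'I_r -> 'I_r -> 'rV[C]_4 -> cform),
  open U -> hol_frame B j U s -> chern_form k j U s theta ->
  forall z, U z -> forall (l : 'I_r) (S : {set 'I_(4 + 4)}),
    \sum_i wedge (curvature theta i l z) (wedge_pow (FS_form z) 3) S *: s i z
    = (- ('i / 2) * wedge_pow (FS_form z) 4 S) *: K (chart j z) (s l z).

Definition hermitian_einstein I (B : bundle R I) (k : fibre_metric R I) : Prop :=
  exists K : P4 R -> vec I -> vec I, is_mean_curvature B k K /\
  exists lambda : R, forall p v, fibre B p v -> K p v = toC lambda *: v.

End ChernConnection.

Section HorrocksMumford.
Variable R : realType.
Local Notation C := (CC R).
Local Notation vec := (vec R).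
Local Notation ext := (ext R).

Definition taut : P4 R -> set (vec 'I_5) := @line R.

Definition O_m1 : bundle R 'I_5 := subb (triv R 'I_5) taut.
Definition O_1 : bundle R 'I_5 := dualb O_m1.
Definition O_2 : bundle R ('I_5 * 'I_5)%type := tensb O_1 O_1.

Definition Q : bundle R 'I_5 := quotb (triv R 'I_5) taut.

Definition euler_proj (p : P4 R) : vec 'I_5 -> vec 'I_5 := oproj (taut p).

(* On Lambda^2 C^5 this is Lambda^2 of euler_proj p. *)
Definition ext2_proj (p : P4 R) : ext 5 -> ext 5 :=
  ext_map (fun i => euler_proj p (unitv R i)).

Definition basis_ext (i : 'I_5) : ext 5 := ext_vec (unitv R i).
Definition aplus (v : vec 'I_5) : ext 5 :=
  \sum_i v i *: wedge (basis_ext (i + 2)) (basis_ext (i + 3)).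
Definition aminus (v : vec 'I_5) : ext 5 :=
  \sum_i v i *: wedge (basis_ext (i + 1)) (basis_ext (i + 4)).

Definition ext2Q2 : bundle R ({set 'I_5} + {set 'I_5})%type :=
  dsumb (ext2b Q) (ext2b Q).

Definition amap (p : P4 R) (v : vec 'I_5) : vec ({set 'I_5} + {set 'I_5})%type :=
  pairv (ext2_proj p (aplus v)) (ext2_proj p (aminus v)).
Definition bmap (p : P4 R) (w : vec ({set 'I_5} + {set 'I_5})%type)
    (v : vec 'I_5) : ext 5 :=
  - wedge (sndv w) (ext2_proj p (aplus v)) + wedge (fstv w) (ext2_proj p (aminus v)).

Definition ker_b : bundle R ({set 'I_5} + {set 'I_5})%type :=
  subb ext2Q2 (fun p => [set w | forall v, bmap p w v = 0]).
Definition im_a (p : P4 R) : set (vec ({set 'I_5} + {set 'I_5})%type) :=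
  [set amap p v | v in [set: vec 'I_5]].

Definition E_m2 : bundle R ({set 'I_5} + {set 'I_5})%type := quotb ker_b im_a.

Definition horrocks_mumford :
    bundle R (({set 'I_5} + {set 'I_5}) * ('I_5 * 'I_5))%type :=
  tensb E_m2 O_2.

(* Each bundle in the construction carries the restriction of hdot: for
   subbundles and quotients by construction, for direct sums, tensor products,
   duals and exterior squares by hdot_pairv, hdot_tensv, hdot_conj and
   hdot_wedge. *)
Definition h1 :
    fibre_metric R (({set 'I_5} + {set 'I_5}) * ('I_5 * 'I_5))%type :=
  fun _ => @hdot R _.

End HorrocksMumford.

(* Main.v *)
Require Import Defs.
From HB Require Import structures.
From mathcomp Require Import all_boot all_order all_algebra.
From mathcomp Require Import complex ring.
From mathcomp Require Import all_classical all_reals all_analysis.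
Import Order.TTheory GRing.Theory Num.Theory numFieldNormedType.Exports.

Set Implicit Arguments.
Unset Strict Implicit.
Unset Printing Implicit Defensive.

Local Open Scope ring_scope.

(** If h_1 were Hermitian-Einstein, the matrix of the mean curvature in a local
    holomorphic frame would be scalar at every point.  It is not scalar at the
    point (1:2:0:0:0): in an orthogonal frame there, its two diagonal entries
    differ.

    Over the chart U_0 the images of e_1, ..., e_4 frame Q holomorphically, so
    (Lambda^2 Q)^2 becomes the trivial bundle of rows of length 12.  In these
    coordinates the map a is a 5 x 12 matrix A(z) with polynomial entries
    ([amapE]) and b is the pairing with the rows of A under a symplectic form
    ([bmapE]).  Where d = 1 - z_1 z_2 z_3 z_4 does not vanish, ker b is spanned by
    the rows of A together with the two rows of a polynomial matrix T
    ([kernel_span], [kernel_indep]).  The rows of T are holomorphic sections of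
    ker b, so their projections S = T - W G^-1 A to the orthogonal complement of
    im a frame E(-2) holomorphically; here G = A P A^h, W = T P A^h and P is the
    Gram matrix of the coordinates of (Lambda^2 Q)^2.  Tensoring with the square
    of the section of O(1) dual to the tautological one gives a holomorphic frame
    of E ([hm_hol_frame]) whose Gram matrix is
      H = n^-2 (T P T^h - W G^-1 W^h) = n^-3 N,    n = 1 + |z|^2,
    where N involves only polynomials in z and conj z, and the inverse of n G.

    The Chern connection has the matrix (d' H) H^-1.  At a point where the
    Fubini-Study metric is diagonal, the coefficient of the top form in
    F /\ omega^3 is a weighted trace of the (1,1)-part of F
    ([curvature_contraction]), so a scalar mean curvature forces a relation
    between second derivatives of H ([scalar_curvature_matrix]).  Where H is also
    diagonal, the relation involves only the entries of H and their first and
    mixed second derivatives ([curvature_diag]).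

    The first row of T is chosen such that, at (1:2:0:0:0), W vanishes and H is
    diagonal.  Then W G^-1 W^h contributes only products of first derivatives of
    W with the value of G^-1, and everything else is the jet of a polynomial with
    integer coefficients at an integer point.  The factor n^-3 adds the same
    number to both diagonal entries ([curvature_split]); the remaining parts are
    2770/1323 and 2522/1323 ([ncurv_gap]). *)

(** * The exterior algebra as a ring *)

(** Reduces the associativity of the wedge product to basis vectors, where it is
    an identity between shuffle signs. *)
Lemma bilinear_assoc (K : pzRingType) (V : lmodType K) (I : finType) (e : I -> V)
    (op : V -> V -> V) :
  (forall x y z, op (x + y) z = op x z + op y z) ->
  (forall x y z, op x (y + z) = op x y + op x z) ->
  (forall c x y, op (c *: x) y = c *: op x y) ->
  (forall c x y, op x (c *: y) = c *: op x y) ->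
  (forall x, exists c : I -> K, x = \sum_i c i *: e i) ->
  (forall i j k, op (e i) (op (e j) (e k)) = op (op (e i) (e j)) (e k)) ->
  forall x y z, op x (op y z) = op (op x y) z.
Proof.
move=> Dl Dr Zl Zr gen ass.
have op0l y : op 0 y = 0 by rewrite -(scale0r 0) Zl !scale0r.
have op0r y : op y 0 = 0 by rewrite -(scale0r 0) Zr !scale0r.
have Sl (F : I -> V) y : op (\sum_i F i) y = \sum_i op (F i) y.
  by elim/big_rec2 : _ => [|i u v _ <-].
have Sr (F : I -> V) y : op y (\sum_i F i) = \sum_i op y (F i).
  by elim/big_rec2 : _ => [|i u v _ <-].
move=> x y z; have [a ->] := gen x.
rewrite !Sl; apply: eq_bigr => i _; rewrite !Zl; congr (_ *: _).
have [b ->] := gen y.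
rewrite Sl !Sr Sl; apply: eq_bigr => j _; rewrite Zl !Zr Zl; congr (_ *: _).
have [c ->] := gen z.
by rewrite !Sr; apply: eq_bigr => k _; rewrite !Zr ass.
Qed.

Section ExteriorAlgebra.
Variables (R : realType) (n : nat).
Local Notation C := (CC R).
Local Notation ext := (ext R n).
Implicit Types (A B D S : {set 'I_n}) (u v w : ext).

Lemma wedgeE u v S : wedge u v S =
  \sum_(A : {set 'I_n} | A \subset S) shuffle_sign R A (S :\: A) * u A * v (S :\: A).
Proof. by rewrite ffunE. Qed.

Lemma vec_scaleE (I : finType) (c : C) (u : vec R I) i : (c *: u) i = c * u i.
Proof. by rewrite ffunE. Qed.

Lemma unitvE (I : finType) (i j : I) : unitv R i j = (j == i)%:R.
Proof. by rewrite ffunE. Qed.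

Lemma wedge_addl u v w : wedge (u + v) w = wedge u w + wedge v w.
Proof.
apply/ffunP => S; rewrite [RHS]ffunE !wedgeE -big_split; apply: eq_bigr => A _ /=.
by rewrite ffunE mulrDr mulrDl.
Qed.

Lemma wedge_addr u v w : wedge u (v + w) = wedge u v + wedge u w.
Proof.
apply/ffunP => S; rewrite [RHS]ffunE !wedgeE -big_split; apply: eq_bigr => A _ /=.
by rewrite ffunE mulrDr.
Qed.

Lemma wedge_scalel (c : C) u v : wedge (c *: u) v = c *: wedge u v.
Proof.
apply/ffunP => S; rewrite vec_scaleE !wedgeE mulr_sumr; apply: eq_bigr => A _ /=.
by rewrite vec_scaleE -!mulrA mulrCA.
Qed.

Lemma wedge_scaler (c : C) u v : wedge u (c *: v) = c *: wedge u v.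
Proof.
apply/ffunP => S; rewrite vec_scaleE !wedgeE mulr_sumr; apply: eq_bigr => A _ /=.
by rewrite vec_scaleE mulrCA.
Qed.

Lemma wedge_suml (I : Type) (r : seq I) (P : pred I) (F : I -> ext) v :
  wedge (\sum_(i <- r | P i) F i) v = \sum_(i <- r | P i) wedge (F i) v.
Proof.
elim/big_rec2 : _ => [|i x y _ <-]; last by rewrite wedge_addl.
by rewrite -(scale0r (0 : ext)) wedge_scalel !scale0r.
Qed.

Lemma wedge_sumr (I : Type) (r : seq I) (P : pred I) (F : I -> ext) v :
  wedge v (\sum_(i <- r | P i) F i) = \sum_(i <- r | P i) wedge v (F i).
Proof.
elim/big_rec2 : _ => [|i x y _ <-]; last by rewrite wedge_addr.
by rewrite -(scale0r (0 : ext)) wedge_scaler !scale0r.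
Qed.

Lemma ext_basis u : u = \sum_A u A *: (unitv R A : ext).
Proof.
apply/ffunP => S; rewrite sum_ffunE.
have E A : (u A *: (unitv R A : ext)) S = u A * (S == A)%:R.
  by rewrite vec_scaleE unitvE.
rewrite (eq_bigr _ (fun A _ => E A)) (bigD1 S) //= eqxx mulr1 big1 ?addr0 //.
by move=> A nA; rewrite eq_sym (negPf nA) mulr0.
Qed.

Lemma wedge_unitv A B : wedge (unitv R A : ext) (unitv R B : ext) =
  if [disjoint A & B] then shuffle_sign R A B *: unitv R (A :|: B) else 0.
Proof.
apply/ffunP => S; rewrite wedgeE.
have -> : (if [disjoint A & B] then shuffle_sign R A B *: unitv R (A :|: B) else 0 : ext) S
   = ([disjoint A & B] && (S == A :|: B))%:R * shuffle_sign R A B.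
  by case: ifP => _; rewrite ?vec_scaleE ?unitvE ?ffunE ?mul0r // mulrC.
rewrite big_mkcond (bigD1 A) //= big1 ?addr0; last first.
  by move=> D nD; rewrite unitvE (negPf nD) mulr0 mul0r; case: ifP.
rewrite !unitvE eqxx mulr1.
have -> : [disjoint A & B] && (S == A :|: B) = (A \subset S) && (S :\: A == B).
  apply/andP/andP => [[dAB /eqP ->]|[AS /eqP <-]].
    rewrite finset.subsetUl; split=> //; apply/eqP.
    by rewrite finset.setDUl finset.setDv finset.set0U; apply/finset.setDidPl;
       rewrite disjoint_sym.
  rewrite disjoint_sym finset.disjoints_subset finset.subsetDr; split=> //.
  apply/eqP/setP => k; rewrite !inE; case: (boolP (k \in A)) => //= kA.
  by rewrite (fintype.subsetP AS).
case: ifP => _ /=; last by rewrite mul0r.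
by case: eqP => [->|_]; rewrite ?mulr1 ?mul1r ?mulr0 ?mul0r.
Qed.

(** Inversions of A against a disjoint union are counted separately. *)
Lemma shuffle_signU A B D : [disjoint B & D] ->
  shuffle_sign R A (B :|: D) = shuffle_sign R A B * shuffle_sign R A D.
Proof.
move=> dBD; rewrite /shuffle_sign -exprD -cardUI; congr (_ ^+ _).
rewrite [X in (_ = _ + X)%N]eq_card0 ?addn0; last first.
  move=> p; rewrite !inE; apply/negP => /andP[/and3P[_ pB _] /and3P[_ pD _]].
  by have := disjointFr dBD pB; rewrite pD.
by apply: eq_card => p; rewrite !inE; case: (p.1 \in A); case: (p.2 \in B);
  case: (p.2 \in D); case: (p.2 < p.1)%N.
Qed.

Lemma shuffle_signUl A B D : [disjoint A & B] ->
  shuffle_sign R (A :|: B) D = shuffle_sign R A D * shuffle_sign R B D.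
Proof.
move=> dAB; rewrite /shuffle_sign -exprD -cardUI; congr (_ ^+ _).
rewrite [X in (_ = _ + X)%N]eq_card0 ?addn0; last first.
  move=> p; rewrite !inE; apply/negP => /andP[/andP[pA _] /andP[pB _]].
  by have := disjointFr dAB pA; rewrite pB.
by apply: eq_card => p; rewrite !inE; case: (p.1 \in A); case: (p.1 \in B);
  case: (p.2 \in D); case: (p.2 < p.1)%N.
Qed.

#[local] Opaque shuffle_sign unitv wedge.
Lemma wedge_unitvA A B D :
  wedge (unitv R A : ext) (wedge (unitv R B : ext) (unitv R D : ext)) =
  wedge (wedge (unitv R A : ext) (unitv R B : ext)) (unitv R D : ext).
Proof.
rewrite !wedge_unitv.
case: (boolP [disjoint A & B]) => dAB; case: (boolP [disjoint B & D]) => dBD;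
  rewrite ?wedge_scaler ?wedge_scalel ?wedge_unitv.
- have -> : [disjoint A & B :|: D] = [disjoint A & D].
    rewrite -!finset.setI_eq0 finset.setIUr finset.setU_eq0.
    by move: dAB; rewrite -finset.setI_eq0 => ->.
  have -> : [disjoint A :|: B & D] = [disjoint A & D].
    rewrite -!finset.setI_eq0 finset.setIUl finset.setU_eq0.
    by move: dBD; rewrite -finset.setI_eq0 => ->; rewrite andbT.
  case: [disjoint A & D].
    rewrite finset.setUA.
    rewrite scalerA.
    rewrite scalerA; congr (_ *: _).
    by rewrite (shuffle_signU _ dBD) (shuffle_signUl _ dAB) mulrC -mulrA.
  by rewrite (scaler0 _ (shuffle_sign R B D)) scaler0.
- rewrite ifN ?scaler0; last first.
    apply: contraNN dBD; rewrite -!finset.setI_eq0 finset.setIUl finset.setU_eq0.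
    by case/andP.
  by rewrite -(scale0r (0 : ext)) wedge_scaler !scale0r.
- rewrite ifN ?scaler0; last first.
    apply: contraNN dAB; rewrite -!finset.setI_eq0 finset.setIUr finset.setU_eq0.
    by case/andP.
  by rewrite -(scale0r (0 : ext)) wedge_scalel !scale0r.
- by rewrite -(scale0r (0 : ext)) wedge_scalel wedge_scaler !scale0r.
Qed.

Lemma wedgeA u v w : wedge u (wedge v w) = wedge (wedge u v) w.
Proof.
apply: (@bilinear_assoc _ _ _ (@unitv R _) _ wedge_addl wedge_addr wedge_scalel
  wedge_scaler _ wedge_unitvA) => x.
by exists x; apply: ext_basis.
Qed.

#[local] Transparent shuffle_sign.
Lemma wedge1l u : wedge (ext_one R n) u = u.
Proof.
rewrite [in RHS](ext_basis u) {1}(ext_basis u) wedge_sumr; apply: eq_bigr => A _.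
rewrite wedge_scaler wedge_unitv -finset.setI_eq0 finset.set0I eqxx finset.set0U.
rewrite /shuffle_sign eq_card0 ?scale1r // => p.
by rewrite !inE.
Qed.

Lemma wedge1r u : wedge u (ext_one R n) = u.
Proof.
rewrite [in RHS](ext_basis u) {1}(ext_basis u) wedge_suml; apply: eq_bigr => A _.
rewrite wedge_scalel wedge_unitv -finset.setI_eq0 finset.setI0 eqxx finset.setU0.
rewrite /shuffle_sign eq_card0 ?scale1r // => p.
by rewrite !inE andbF.
Qed.

End ExteriorAlgebra.

(* The wedge product as a ring multiplication gives access to the general
   theory of products and powers. *)
HB.instance Definition _ (R : realType) (n : nat) :=
  GRing.Zmodule_isPzRing.Build (ext R n)
    (@wedgeA R n) (@wedge1l R n) (@wedge1r R n) (@wedge_addl R n) (@wedge_addr R n).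

Lemma ext_one_neq0 (R : realType) (n : nat) : (1 : ext R n) != 0.
Proof.
apply/eqP => /ffunP /(_ finset.set0); rewrite -/(ext_one R n) unitvE eqxx ffunE.
by move/eqP; rewrite oner_eq0.
Qed.

HB.instance Definition _ (R : realType) (n : nat) :=
  GRing.PzSemiRing_isNonZero.Build (ext R n) (@ext_one_neq0 R n).

HB.instance Definition _ (R : realType) (n : nat) :=
  GRing.Lmodule_isLalgebra.Build (CC R) (ext R n)
    (fun c u v => esym (wedge_scalel c u v)).

HB.instance Definition _ (R : realType) (n : nat) :=
  GRing.Lalgebra_isAlgebra.Build (CC R) (ext R n)
    (fun c u v => esym (wedge_scaler c u v)).

Section ExteriorRing.
#[local] Opaque shuffle_sign unitv wedge.
Variables (R : realType) (n : nat).
Local Notation C := (CC R).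
Implicit Types (u v : vec R 'I_n) (x y : ext R n).

Lemma wedge_mul x y : wedge x y = x * y.
Proof. by []. Qed.

Lemma wsgn_anti (i j : 'I_n) : wsgn R i j = - wsgn R j i.
Proof.
rewrite /wsgn (eq_sym j); case: (eqVneq i j) => [->|nij]; first by rewrite !mul0r oppr0.
rewrite !mul1r; case: (ltngtP i j) nij => [||/val_inj ->] //; rewrite ?opprK //.
by rewrite eqxx.
Qed.

Lemma ext_vec_anti u v : ext_vec u * ext_vec v = - (ext_vec v * ext_vec u).
Proof.
apply/ffunP => S; rewrite -!wedge_mul wedge_vecE [RHS]ffunE wedge_vecE exchange_big -sumrN.
apply: eq_bigr => i _; rewrite -sumrN; apply: eq_bigr => j _.
by rewrite wsgn_anti finset.setUC; ring.
Qed.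

Lemma ext_vec_sqr u : ext_vec u * ext_vec u = 0.
Proof.
have /eqP := ext_vec_anti u u; rewrite -addr_eq0 -mulr2n -scaler_nat scaler_eq0.
by rewrite pnatr_eq0 => /eqP.
Qed.

Lemma ext_vecD u v : ext_vec (u + v) = ext_vec u + ext_vec v.
Proof. by rewrite /ext_vec -big_split; apply: eq_bigr => i _; rewrite ffunE scalerDl. Qed.

Lemma ext_vecZ (c : C) u : ext_vec (c *: u) = c *: ext_vec u.
Proof.
by rewrite /ext_vec scaler_sumr; apply: eq_bigr => i _; rewrite vec_scaleE scalerA.
Qed.

Lemma ext_vec0 : ext_vec (0 : vec R 'I_n) = 0.
Proof. by rewrite -(scale0r (0 : vec R 'I_n)) ext_vecZ scale0r. Qed.

Lemma ext_vec_sum (I : Type) (r : seq I) (P : pred I) (F : I -> vec R 'I_n) :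
  ext_vec (\sum_(i <- r | P i) F i) = \sum_(i <- r | P i) ext_vec (F i).
Proof. by elim/big_rec2 : _ => [|i x y _ <-]; rewrite ?ext_vec0 ?ext_vecD. Qed.

Lemma ext_vec_unit (i : 'I_n) : ext_vec (unitv R i) = unitv R [set i]%SET :> ext R n.
Proof.
rewrite /ext_vec (bigD1 i) //= unitvE eqxx scale1r big1 ?addr0 // => j nj.
by rewrite unitvE (negPf nj) scale0r.
Qed.

End ExteriorRing.

Section ExteriorMap.
Variables (R : realType) (n m : nat) (f : 'I_n -> vec R 'I_m).
Local Notation C := (CC R).
Implicit Types (x y : ext R n).

Lemma ext_map_lin (c : C) x y : ext_map f (c *: x + y) = c *: ext_map f x + ext_map f y.
Proof.
rewrite /ext_map scaler_sumr -big_split; apply: eq_bigr => S _ /=.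
by rewrite ffunE vec_scaleE scalerDl scalerA.
Qed.

HB.instance Definition _ := GRing.isLinear.Build C (ext R n) (ext R m) *:%R (ext_map f) ext_map_lin.

Lemma ext_map_unitv (S : {set 'I_n}) :
  ext_map f (unitv R S) = \prod_(i <- enum S) ext_vec (f i).
Proof.
rewrite /ext_map (bigD1 S) //= unitvE eqxx scale1r big1 ?addr0.
  by rewrite -big_filter.
by move=> A nA; rewrite unitvE (negPf nA) scale0r.
Qed.

Lemma enum_set2_lt (i j : 'I_n) : (i < j)%N -> enum [set i; j]%SET = [:: i; j].
Proof.
move=> ij; have srt : sorted ltn (map val (enum [set i; j]%SET)).
  have -> : enum [set i; j]%SET = [seq k <- enum 'I_n | k \in [set i; j]%SET].
    by rewrite enumT.
  apply: (subseq_sorted ltn_trans (map_subseq val (filter_subseq _ _))).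
  by rewrite val_enum_ord iota_ltn_sorted.
apply: (inj_map val_inj); apply: (irr_sorted_eq ltn_trans ltnn srt).
  by rewrite /= ij.
move=> k; apply/mapP/mapP => -[x xS ->]; exists x => //; move: xS;
  by rewrite mem_enum !inE.
Qed.

Lemma ext_map_vec (i : 'I_n) : ext_map f (ext_vec (unitv R i)) = ext_vec (f i).
Proof. by rewrite ext_vec_unit ext_map_unitv enum_set1 big_seq1. Qed.

Lemma ext_map_vec2 (i j : 'I_n) :
  ext_map f (ext_vec (unitv R i) * ext_vec (unitv R j)) = ext_vec (f i) * ext_vec (f j).
Proof.
wlog ij : i j / (i <= j)%N.
  move=> W; case: (leqP i j) => [|/ltnW] ij; first exact: W.
  by rewrite ext_vec_anti linearN /= (W _ _ ij) -ext_vec_anti.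
case: (ltngtP i j) ij => // [ij _|/val_inj -> _]; last first.
  by rewrite !ext_vec_sqr linear0.
rewrite !ext_vec_unit -wedge_mul wedge_unitv finset.disjoints1 inE -val_eqE /= ltn_eqF //=.
rewrite linearZ /= ext_map_unitv enum_set2_lt // big_cons big_seq1.
rewrite /shuffle_sign eq_card0 ?scale1r // => -[a b].
rewrite !inE /=; apply/negP => /and3P[/eqP -> /eqP ->].
by rewrite ltnNge ltnW.
Qed.

End ExteriorMap.

(** * Powers of a Kaehler form *)

(** A diagonal (1,1)-form is a sum of four commuting elements of square zero; in
    its powers only the square-free monomials survive. *)
Section SquareZero.
Variables (A : nzRingType) (x : 'I_4 -> A).
Hypotheses (xC : forall a b, x a * x b = x b * x a) (x0 : forall a, x a * x a = 0).

Lemma sqz_sum2 (a b : 'I_4) : (x a + x b) ^+ 2 = (x a * x b) *+ 2.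
Proof. by rewrite expr2 mulrDl !mulrDr !x0 add0r addr0 (xC b a). Qed.

Lemma sqz_sum2_cube (a b : 'I_4) : (x a + x b) ^+ 3 = 0.
Proof.
rewrite exprS sqz_sum2 mulrnAr mulrDl !mulrA x0 mul0r (xC b a) -mulrA x0.
by rewrite mulr0 addr0 mul0rn.
Qed.

Lemma sqz_sum3_cube (a b c : 'I_4) : (x a + (x b + x c)) ^+ 3 = (x a * x b * x c) *+ 6.
Proof.
have cr : x a * (x b + x c) = (x b + x c) * x a by rewrite mulrDl mulrDr !(xC a).
have [r2 r3] := (sqz_sum2 b c, sqz_sum2_cube b c).
rewrite -mulrA -[6%N]/(2 * 3)%N mulrnA -mulrnAr -r2.
move: (x b + x c) cr r3 => r cr r3 {r2}.
have E : (x a + r) ^+ 2 = (x a * r) *+ 2 + r ^+ 2.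
  by rewrite expr2 mulrDl !mulrDr x0 add0r -cr addrA -mulr2n -expr2.
rewrite exprSr E.
rewrite mulrDl !mulrDr -exprSr r3 addr0 mulrnAl -[x a * r * x a]mulrA -cr mulrA x0.
rewrite mul0r mul0rn add0r mulrnAl -mulrA -expr2.
have -> : r ^+ 2 * x a = x a * r ^+ 2 by rewrite expr2 -mulrA -cr mulrA -cr mulrA.
by rewrite -mulrSr.
Qed.

(** Multiplying by u annihilates v, so in u (v + w)^k the factor v can be dropped
    one power at a time. *)
Lemma kill_pow (u v w : A) k : u * v = 0 -> v * w = w * v -> u * (v + w) ^+ k = u * w ^+ k.
Proof.
elim: k u => [//|k IH] u uv vw.
by rewrite !exprS !mulrA mulrDr uv add0r IH // -mulrA -vw mulrA uv mul0r.
Qed.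

(** A form killed by two of the four terms kills the cube of their sum, because
    each square-free cubic monomial contains one of the two. *)
Lemma sqz_kill2 (u : A) (a b c d : 'I_4) : u * x a = 0 -> u * x b = 0 ->
  u * (x a + (x b + (x c + x d))) ^+ 3 = 0.
Proof.
move=> ua ub.
have ca : x a * (x b + (x c + x d)) = (x b + (x c + x d)) * x a.
  by rewrite !mulrDr !mulrDl !(xC a).
have cb : x b * (x c + x d) = (x c + x d) * x b by rewrite mulrDr mulrDl !(xC b).
by rewrite (kill_pow _ ua ca) (kill_pow _ ub cb) sqz_sum2_cube mulr0.
Qed.

Lemma sqz_top (a b c d : 'I_4) :
  x a * (x a + (x b + (x c + x d))) ^+ 3 = (x a * x b * x c * x d) *+ 6.
Proof.
have ca : x a * (x b + (x c + x d)) = (x b + (x c + x d)) * x a.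
  by rewrite !mulrDr !mulrDl !(xC a).
by rewrite (kill_pow _ (x0 a) ca) sqz_sum3_cube mulrnAr !mulrA.
Qed.

End SquareZero.

(** * Wirtinger derivatives *)

Section LineDerivative.
Variable R : realType.
Local Notation C := (CC R).
Local Notation Re := (@complex.Re R).
Local Notation Im := (@complex.Im R).
Implicit Types (g h : R -> C) (x y d e : C).

Lemma ReD x y : Re (x + y) = Re x + Re y. Proof. by case: x; case: y. Qed.
Lemma ImD x y : Im (x + y) = Im x + Im y. Proof. by case: x; case: y. Qed.
Lemma ReN x : Re (- x) = - Re x. Proof. by case: x. Qed.
Lemma ImN x : Im (- x) = - Im x. Proof. by case: x. Qed.
Lemma ReM x y : Re (x * y) = Re x * Re y - Im x * Im y.
Proof. by case: x; case: y. Qed.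
Lemma ImM x y : Im (x * y) = Re x * Im y + Im x * Re y.
Proof. by case: x; case: y. Qed.
Lemma ReJ x : Re (x^*) = Re x. Proof. by case: x. Qed.
Lemma ImJ x : Im (x^*) = - Im x. Proof. by case: x. Qed.
Lemma complex_ext x y : Re x = Re y -> Im x = Im y -> x = y.
Proof. by case: x => a b; case: y => c d /= -> ->. Qed.
Lemma normsq_neq0 x : x != 0 -> Re x * Re x + Im x * Im x != 0.
Proof.
apply: contraNneq; rewrite -!expr2 => /eqP; rewrite paddr_eq0 ?sqr_ge0 // !sqrf_eq0.
by case/andP => /eqP a /eqP b; apply/eqP/complex_ext.
Qed.
Lemma ReV x : Re (x^-1) = Re x / (Re x * Re x + Im x * Im x).
Proof. by case: x => a b /=; rewrite -!expr2. Qed.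
Lemma ImV x : Im (x^-1) = - Im x / (Re x * Re x + Im x * Im x).
Proof. by case: x => a b /=; rewrite -!expr2 mulNr. Qed.

Section Real.
Implicit Types (f : R -> R).
Lemma rderD f1 f2 (t a b : R) : is_derive t 1 f1 a -> is_derive t 1 f2 b ->
  is_derive t 1 (fun s => f1 s + f2 s) (a + b).
Proof. exact: is_deriveD. Qed.
Lemma rderN f1 (t a : R) : is_derive t 1 f1 a -> is_derive t 1 (fun s => - f1 s) (- a).
Proof. exact: is_deriveN. Qed.
Lemma rderM f1 f2 (t a b : R) : is_derive t 1 f1 a -> is_derive t 1 f2 b ->
  is_derive t 1 (fun s => f1 s * f2 s) (f1 t * b + f2 t * a).
Proof. exact: is_deriveM. Qed.
Lemma rderV f1 (t a : R) : f1 t != 0 -> is_derive t 1 f1 a ->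
  is_derive t 1 (fun s => (f1 s)^-1) (- (f1 t) ^- 2 * a).
Proof.
move=> n0 d1; have [D1 E1] := d1; apply: DeriveDef; first exact: derivableV.
by rewrite deriveV // E1.
Qed.
End Real.

(** Differentiability of the real and imaginary parts, which is what the partial
    derivatives of the Chern connection are computed from. *)
Definition cder g t d :=
  is_derive t (1 : R) (fun t => Re (g t)) (Re d) /\
  is_derive t (1 : R) (fun t => Im (g t)) (Im d).

Lemma cderP g (gr gi : R -> R) (t a b : R) d : (forall s, Re (g s) = gr s) ->
  (forall s, Im (g s) = gi s) ->
  is_derive t 1 gr a -> is_derive t 1 gi b -> a = Re d -> b = Im d -> cder g t d.
Proof.
move=> /funext Er /funext Ei dr di ea eb.
by split; rewrite ?Er ?Ei -?ea -?eb.
Qed.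

Lemma cder_cst x t : cder (fun=> x) t 0.
Proof. by split; apply: is_derive_cst. Qed.

Lemma cder_lin x y t : cder (fun t => x + toC t * y) t y.
Proof.
have E (a b : R) : is_derive t (1 : R) (fun t => a + t * b) b.
  have := rderD (is_derive_cst a t 1) (rderM (is_derive_id t 1) (is_derive_cst b t 1)).
  by rewrite mulr0 mulr1 !add0r.
apply: (cderP _ _ (E (Re x) (Re y)) (E (Im x) (Im y))) => // s.
  by rewrite ReD ReM /= mul0r subr0.
by rewrite ImD ImM /= mul0r addr0.
Qed.

Lemma cder_add g h t d e : cder g t d -> cder h t e ->
  cder (fun t => g t + h t) t (d + e).
Proof.
move=> [g1 g2] [h1 h2].
by apply: (cderP _ _ (rderD g1 h1) (rderD g2 h2)) => [s|s||];
  rewrite ?ReD ?ImD.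
Qed.

Lemma cder_mul g h t d e : cder g t d -> cder h t e ->
  cder (fun t => g t * h t) t (g t * e + h t * d).
Proof.
move=> [g1 g2] [h1 h2].
apply: (cderP _ _ (rderD (rderM g1 h1) (rderN (rderM g2 h2)))
  (rderD (rderM g1 h2) (rderM g2 h1))) => [s|s||]; rewrite ?ReD ?ImD ?ReM ?ImM //; ring.
Qed.

Lemma cder_conj g t d : cder g t d -> cder (fun t => (g t)^*) t (d^*).
Proof.
move=> [g1 g2]; apply: (cderP _ _ g1 (rderN g2)) => [s|s||]; by rewrite ?ReJ ?ImJ.
Qed.

Lemma cder_inv g t d : g t != 0 -> cder g t d ->
  cder (fun t => (g t)^-1) t (- (d / (g t * g t))).
Proof.
move=> g0 [g1 g2].
have n0 := normsq_neq0 g0.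
have dn := rderV (f1 := fun s => Re (g s) * Re (g s) + Im (g s) * Im (g s)) n0
  (rderD (rderM g1 g1) (rderM g2 g2)).
apply: (cderP _ _ (rderM g1 dn) (rderM (rderN g2) dn)) => [s|s||].
  exact: ReV.
  exact: ImV.
all: rewrite (invfM (g t) (g t)) ?(ReN, ImN, ReM, ImM, ReV, ImV).
all: move: n0; case: (g t) => a b /= n0; case: d {g1 g2 dn} => a' b' /=.
all: by field.
Qed.

Lemma cder_near g h t d : (\near t, g t = h t) -> cder g t d -> cder h t d.
Proof.
move=> E [g1 g2]; split; [apply: near_eq_is_derive g1|apply: near_eq_is_derive g2];
  by apply: filterS E => s ->.
Qed.

Lemma cder_val g t d : cder g t d ->
  (derive1 (fun t => Re (g t)) t +i* derive1 (fun t => Im (g t)) t)%C = d.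
Proof.
move=> [[_ g1] [_ g2]]; rewrite !derive1E g1 g2; by case: d {g1 g2}.
Qed.

End LineDerivative.

Section Wirtinger.
Variable R : realType.
Local Notation C := (CC R).
Local Notation pt := 'rV[C]_4.
Implicit Types (f g : pt -> C) (z v : pt) (a : 'I_4) (p q : C).

(** The real derivatives along the directions 1 and i of the coordinate a are
    p + q and i (p - q); this determines the Wirtinger derivatives p and q
    and, unlike their mere values, is stable under sums and products. *)
Definition wirt f z a p q :=
  cder (fun t => f (z + toC t *: delta_mx 0 a)) 0 (p + q) /\
  cder (fun t => f (z + toC t *: ('i *: delta_mx 0 a))) 0 ('i * (p - q)).

Lemma line0 z v : z + toC (0 : R) *: v = z.
Proof. by rewrite -[toC 0]/(0 : C) scale0r addr0. Qed.

Lemma mulii : 'i * 'i = -1 :> C.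
Proof. exact: mulCii. Qed.

Lemma two_neq0 : (2 : C) != 0. Proof. by rewrite pnatr_eq0. Qed.

Lemma wirt_val f z a p q : wirt f z a p q ->
  pderiv f z a = p /\ pderivbar f z a = q.
Proof.
move=> [d1 d2].
have E1 : real_deriv f z (delta_mx 0 a) = p + q := cder_val d1.
have E2 : real_deriv f z ('i *: delta_mx 0 a) = 'i * (p - q) := cder_val d2.
rewrite /pderiv /pderivbar E1 E2 mulrA mulii mulN1r; split; apply: (mulIf two_neq0); rewrite divfK ?two_neq0 //; ring.
Qed.

Lemma wirt_cst c z a : wirt (fun=> c) z a 0 0.
Proof. by split; rewrite ?addr0 ?subr0 ?mulr0; apply: cder_cst. Qed.

Lemma wirt_coord k z a : wirt (fun y => y 0 k) z a (k == a)%:R 0.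
Proof.
split; rewrite ?addr0 ?subr0.
  have -> : (fun t => (z + toC t *: delta_mx 0 a) 0 k) =
     (fun t => z 0 k + toC t * (k == a)%:R).
    by apply/funext => t; rewrite !mxE eqxx.
  exact: cder_lin.
have -> : (fun t => (z + toC t *: ('i *: delta_mx 0 a)) 0 k) =
   (fun t => z 0 k + toC t * ('i * (k == a)%:R)).
  by apply/funext => t; rewrite !mxE eqxx.
exact: cder_lin.
Qed.

Lemma wirt_conj f z a p q : wirt f z a p q -> wirt (fun y => (f y)^*) z a (q^*) (p^*).
Proof.
move=> [/cder_conj d1 /cder_conj d2]; split.
  by rewrite addrC -rmorphD.
suff -> : 'i * (q^* - p^*) = ('i * (p - q))^* :> C by [].
by rewrite rmorphM rmorphB /= conjCi; ring.
Qed.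

Lemma wirt_add f g z a p q p' q' : wirt f z a p q -> wirt g z a p' q' ->
  wirt (fun y => f y + g y) z a (p + p') (q + q').
Proof.
move=> [d1 d2] [e1 e2]; split.
  by rewrite addrACA; apply: cder_add.
by rewrite opprD addrACA mulrDr; apply: cder_add.
Qed.

Lemma wirt_mul f g z a p q p' q' : wirt f z a p q -> wirt g z a p' q' ->
  wirt (fun y => f y * g y) z a (f z * p' + g z * p) (f z * q' + g z * q).
Proof.
move=> [d1 d2] [e1 e2]; split.
  have := cder_mul d1 e1; rewrite !line0; congr cder; ring.
by have := cder_mul d2 e2; rewrite !line0; congr cder; ring.
Qed.

Lemma wirt_inv f z a p q : f z != 0 -> wirt f z a p q ->
  wirt (fun y => (f y)^-1) z a (- (p / (f z * f z))) (- (q / (f z * f z))).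
Proof.
move=> f0 [d1 d2]; split.
  have := cder_inv _ d1; rewrite !line0 => /(_ f0); congr cder; ring.
by have := cder_inv _ d2; rewrite !line0 => /(_ f0); congr cder; ring.
Qed.

Lemma near_real (c e : C) : 0 < e -> \forall t \near (0 : R), `|toC t * c| < e.
Proof.
move=> e0.
have eE : e = toC (complex.Re e) by apply/esym/(@RRe_real R); rewrite gtr0_real.
have cE : `|c| = toC (complex.Re `|c|) by apply/esym/(@RRe_real R); exact: normr_real.
set m := complex.Re `|c| in cE.
have m0 : 0 <= m by rewrite -(@ler0c R) -/(toC m) -cE.
have r0 : 0 < complex.Re e by have := e0; rewrite [X in _ < X]eE (@ltcR R 0).
have d0 : 0 < complex.Re e / (m + 1) by rewrite divr_gt0 // ltr_wpDl.
near=> t.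
have nt : `|toC t| = toC `|t| :> C.
  by rewrite /toC normc_def /= expr0n addr0 sqrtr_sqr.
rewrite normrM nt cE eE -(rmorphM (real_complex R)) /= ltcR.
have tm : `|t| < complex.Re e / (m + 1).
  by near: t; exact: (@nbhs0_lt R R _ d0).
rewrite ltr_pdivlMr ?ltr_wpDl // in tm.
by apply: le_lt_trans tm; rewrite ler_wpM2l // lerDl.
Unshelve. all: by end_near. Qed.

Lemma near_line (U : set pt) (z v : pt) : open U -> U z ->
  \forall t \near (0 : R), U (z + toC t *: v).
Proof.
move=> oU Uz; have /nbhs_ballP[e /= e0 eU] : nbhs z U by exact: open_nbhs_nbhs.
have N (j : 'I_4) : \forall t \near (0 : R), `|toC t * v 0 j| < e by apply: near_real.
have N' := filter_forall _ N.
near=> t; apply: eU; split=> // i j.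
rewrite (ord1 i) -ball_normE /ball_ /= !mxE opprD addrA subrr add0r normrN.
by move: j; near: t; exact: N'.
Unshelve. all: by end_near. Qed.

Lemma wirt_on (U : set pt) f g z a p q : open U -> U z -> (forall y, U y -> f y = g y) ->
  wirt f z a p q -> wirt g z a p q.
Proof.
move=> oU Uz fg [d1 d2]; split; [apply: cder_near d1|apply: cder_near d2].
  by apply: filterS (near_line (delta_mx 0 a) oU Uz) => t /fg.
by apply: filterS (near_line ('i *: delta_mx 0 a) oU Uz) => t /fg.
Qed.

End Wirtinger.

Section Smooth.
Variable R : realType.
Local Notation C := (CC R).
Local Notation pt := 'rV[C]_4.
Variable U : set pt.
Hypothesis oU : open U.
Implicit Types (f g : pt -> C) (z : pt) (a : 'I_4).

(** The functions generated by the coordinates under the operations that occur in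
    the Gram matrices.  The class is closed under Wirtinger derivatives
    ([sm_pderiv]), so that second derivatives exist. *)
Inductive sm : (pt -> C) -> Prop :=
| sm_cst c : sm (fun=> c)
| sm_coord k : sm (fun y => y 0 k)
| sm_conj f : sm f -> sm (fun y => (f y)^*)
| sm_add f g : sm f -> sm g -> sm (fun y => f y + g y)
| sm_mul f g : sm f -> sm g -> sm (fun y => f y * g y)
| sm_inv f : (forall z, U z -> f z != 0) -> sm f -> sm (fun y => (f y)^-1)
| sm_on f g : (forall z, U z -> f z = g z) -> sm f -> sm g.

Lemma sm_opp f : sm f -> sm (fun y => - f y).
Proof.
move=> sf; apply: (@sm_on (fun y => -1 * f y)); first by move=> z _; rewrite mulN1r.
exact: sm_mul (sm_cst _) sf.
Qed.

Lemma sm_sum (I : Type) (r : seq I) (P : pred I) (F : I -> pt -> C) :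
  (forall i, sm (F i)) -> sm (fun y => \sum_(i <- r | P i) F i y).
Proof.
move=> sF; elim: r => [|i r IH].
  by apply: sm_on (sm_cst 0) => z _; rewrite big_nil.
apply: (@sm_on (fun y => (if P i then F i y else 0) + \sum_(j <- r | P j) F j y)).
  by move=> z _; rewrite big_cons; case: ifP; rewrite ?add0r.
by apply: sm_add IH; case: (P i); [exact: sF|exact: sm_cst].
Qed.

Lemma sm_prod (I : Type) (r : seq I) (P : pred I) (F : I -> pt -> C) :
  (forall i, sm (F i)) -> sm (fun y => \prod_(i <- r | P i) F i y).
Proof.
move=> sF; elim: r => [|i r IH].
  by apply: sm_on (sm_cst 1) => z _; rewrite big_nil.
apply: (@sm_on (fun y => (if P i then F i y else 1) * \prod_(j <- r | P j) F j y)).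
  by move=> z _; rewrite big_cons; case: ifP; rewrite ?mul1r.
by apply: sm_mul IH; case: (P i); [exact: sF|exact: sm_cst].
Qed.

Lemma sm_det n (F : pt -> 'M[C]_n) : (forall i j, sm (fun y => F y i j)) ->
  sm (fun y => \det (F y)).
Proof.
move=> sF; apply: sm_sum => s; apply: sm_mul (sm_cst _) _.
by apply: sm_prod => i.
Qed.

Lemma sm_invmx n (F : pt -> 'M[C]_n) : (forall i j, sm (fun y => F y i j)) ->
  (forall z, U z -> F z \in unitmx) -> forall i j, sm (fun y => invmx (F y) i j).
Proof.
move=> sF uF i j.
apply: (@sm_on (fun y => (\det (F y))^-1 * \adj (F y) i j)).
  by move=> z /uF Fz; rewrite /invmx Fz [RHS]mxE.
apply: sm_mul.
  by apply: sm_inv; [move=> z /uF; rewrite unitmxE unitfE|exact: sm_det].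
apply: (@sm_on (fun y => cofactor (F y) j i)); first by move=> z _; rewrite mxE.
apply: sm_mul; first exact: sm_cst.
apply: sm_det => k l.
apply: sm_on (sF (lift j k) (lift i l)) => z _; by rewrite !mxE.
Qed.

Lemma sm_wirt f : sm f -> forall a, exists p q : pt -> C,
  [/\ sm p, sm q & forall z, U z -> wirt f z a (p z) (q z)].
Proof.
move=> sf a; elim: sf => {f} [c|k|f sf [p [q [sp sq W]]]
    |f g sf [p [q [sp sq W]]] sg [p' [q' [sp' sq' W']]]
    |f g sf [p [q [sp sq W]]] sg [p' [q' [sp' sq' W']]]
    |f f0 sf [p [q [sp sq W]]]|f g fg sf [p [q [sp sq W]]]].
- by exists (fun=> 0), (fun=> 0); split; [exact: sm_cst..|move=> z _; exact: wirt_cst].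
- exists (fun=> (k == a)%:R), (fun=> 0).
  by split; [exact: sm_cst..|move=> z _; exact: wirt_coord].
- exists (fun z => (q z)^*), (fun z => (p z)^*).
  by split; [exact: sm_conj..|move=> z Uz; exact/wirt_conj/W].
- exists (fun z => p z + p' z), (fun z => q z + q' z).
  by split; [exact: sm_add..|move=> z Uz; apply: wirt_add; [exact: W|exact: W']].
- exists (fun z => f z * p' z + g z * p z), (fun z => f z * q' z + g z * q z).
  split; [by apply: sm_add; exact: sm_mul..|move=> z Uz].
  by apply: wirt_mul; [exact: W|exact: W'].
- exists (fun z => - (p z / (f z * f z))), (fun z => - (q z / (f z * f z))).
  have sff : sm (fun z => (f z * f z)^-1).
    by apply: sm_inv; [move=> z Uz; rewrite mulf_neq0 ?f0|exact: sm_mul].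
  split; [by apply: sm_opp; exact: sm_mul..|move=> z Uz].
  by apply: wirt_inv; [exact: f0|exact: W].
- exists p, q; split=> // z Uz.
  exact: wirt_on oU Uz fg (W z Uz).
Qed.

Lemma sm_wirtE f z a : sm f -> U z -> wirt f z a (pderiv f z a) (pderivbar f z a).
Proof.
move=> sf Uz; have [p [q [_ _ W]]] := sm_wirt sf a.
by have [-> ->] := wirt_val (W z Uz); exact: W.
Qed.

Lemma sm_pderiv f a : sm f -> sm (fun z => pderiv f z a).
Proof.
move=> sf; have [p [q [sp _ W]]] := sm_wirt sf a.
by apply: sm_on sp => z Uz; have [-> _] := wirt_val (W z Uz).
Qed.

Lemma sm_pderivbar f a : sm f -> sm (fun z => pderivbar f z a).
Proof.
move=> sf; have [p [q [_ sq W]]] := sm_wirt sf a.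
by apply: sm_on sq => z Uz; have [_ ->] := wirt_val (W z Uz).
Qed.

End Smooth.

(** * Second-order jets in one complex direction *)

(** The value, the two first Wirtinger derivatives and the mixed second one, in a
    fixed direction.  The pure second derivatives never enter the curvature. *)
Record jet (K : Type) := Jet { jv : K; jd : K; je : K; jm : K }.

Section JetOps.
Variable K : pzRingType.
Implicit Types j k : jet K.
Definition jcst (c : K) := Jet c 0 0 0.
Definition jadd j k := Jet (jv j + jv k) (jd j + jd k) (je j + je k) (jm j + jm k).
Definition jopp j := Jet (- jv j) (- jd j) (- je j) (- jm j).
Definition jmul j k := Jet (jv j * jv k) (jv j * jd k + jd j * jv k)
  (jv j * je k + je j * jv k) (jv j * jm k + jd j * je k + je j * jd k + jm j * jv k).
Definition jswap j := Jet (jv j) (je j) (jd j) (jm j).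
Definition jsum n (F : nat -> jet K) := foldr jadd (jcst 0) (map F (iota 0 n)).
End JetOps.

Definition jmap (K L : Type) (f : K -> L) (j : jet K) :=
  Jet (f (jv j)) (f (jd j)) (f (je j)) (f (jm j)).

Section Jets.
Variable R : realType.
Local Notation C := (CC R).
Local Notation pt := 'rV[C]_4.
Variables (U : set pt) (z0 : pt) (a : 'I_4).
Hypotheses (oU : open U) (Uz0 : U z0).
Implicit Types (f g : pt -> C) (z : pt) (j k : jet C).

(** Both orders of mixed differentiation are recorded, since conjugation swaps
    them. *)
Definition hasjet f j := sm U f /\
  [/\ f z0 = jv j, pderiv f z0 a = jd j, pderivbar f z0 a = je j,
      pderivbar (fun y => pderiv f y a) z0 a = jm j &
      pderiv (fun y => pderivbar f y a) z0 a = jm j].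

Lemma hasjetP f j (p q : pt -> C) : sm U f ->
  (forall z, U z -> wirt f z a (p z) (q z)) -> f z0 = jv j -> p z0 = jd j ->
  q z0 = je j -> (exists c, wirt p z0 a c (jm j)) -> (exists c, wirt q z0 a (jm j) c) ->
  hasjet f j.
Proof.
move=> sf W fv pd qe [c Wp] [d Wq]; split=> //.
have [P Q] := wirt_val (W z0 Uz0).
split=> //; first by rewrite P.
- by rewrite Q.
- have Wp' : wirt (fun y => pderiv f y a) z0 a c (jm j).
    by apply: wirt_on oU Uz0 _ Wp => y Uy; have [-> _] := wirt_val (W y Uy).
  by have [_ ->] := wirt_val Wp'.
have Wq' : wirt (fun y => pderivbar f y a) z0 a (jm j) d.
  by apply: wirt_on oU Uz0 _ Wq => y Uy; have [_ ->] := wirt_val (W y Uy).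
by have [-> _] := wirt_val Wq'.
Qed.

Section OneJet.
Variables (f : pt -> C) (j : jet C).
Hypothesis fj : hasjet f j.
Let p y := pderiv f y a.
Let q y := pderivbar f y a.

Lemma jet_sm : sm U f. Proof. by case: fj. Qed.
Lemma jet_wirt z : U z -> wirt f z a (p z) (q z).
Proof. by apply: sm_wirtE => //; exact: jet_sm. Qed.
Lemma jet_v : f z0 = jv j. Proof. by case: fj => _ []. Qed.
Lemma jet_d : p z0 = jd j. Proof. by case: fj => _ []. Qed.
Lemma jet_e : q z0 = je j. Proof. by case: fj => _ []. Qed.
Lemma jet_p : exists c, wirt p z0 a c (jm j).
Proof.
exists (pderiv p z0 a); case: fj => _ [_ _ _ <- _].
by apply: (sm_wirtE oU) => //; apply/sm_pderiv/jet_sm.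
Qed.
Lemma jet_q : exists c, wirt q z0 a (jm j) c.
Proof.
exists (pderivbar q z0 a); case: fj => _ [_ _ _ _ <-].
by apply: (sm_wirtE oU) => //; apply/sm_pderivbar/jet_sm.
Qed.
End OneJet.

Lemma wirt_eq f z p q p' q' : wirt f z a p q -> p = p' -> q = q' -> wirt f z a p' q'.
Proof. by move=> W <- <-. Qed.

Lemma hasjet_cst c : hasjet (fun=> c) (jcst c).
Proof.
apply: (@hasjetP _ _ (fun=> 0) (fun=> 0)) => //=; first exact: sm_cst.
- by move=> z _; exact: wirt_cst.
- by exists 0; exact: wirt_cst.
- by exists 0; exact: wirt_cst.
Qed.

Lemma hasjet_coord (k : 'I_4) : hasjet (fun y => y 0 k) (Jet (z0 0 k) (k == a)%:R 0 0).
Proof.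
apply: (@hasjetP _ _ (fun=> (k == a)%:R) (fun=> 0)) => //=; first exact: sm_coord.
- by move=> z _; exact: wirt_coord.
- by exists 0; exact: wirt_cst.
- by exists 0; exact: wirt_cst.
Qed.

Lemma hasjet_conj f j : hasjet f j -> hasjet (fun y => (f y)^*) (jmap Num.conj (jswap j)).
Proof.
move=> fj; have [[c Wp] [d Wq]] := (jet_p fj, jet_q fj).
apply: (hasjetP (p := fun y => (pderivbar f y a)^*) (q := fun y => (pderiv f y a)^*)) => /=.
- exact/sm_conj/(jet_sm fj).
- by move=> z Uz; apply/wirt_conj/(jet_wirt fj).
- by rewrite (jet_v fj).
- by rewrite (jet_e fj).
- by rewrite (jet_d fj).
- by exists (d^*); apply: wirt_conj.
- by exists (c^*); apply: wirt_conj.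
Qed.

Lemma hasjet_add f g j k : hasjet f j -> hasjet g k -> hasjet (fun y => f y + g y) (jadd j k).
Proof.
move=> fj gk; have [[c Wp] [d Wq]] := (jet_p fj, jet_q fj).
have [[c' Wp'] [d' Wq']] := (jet_p gk, jet_q gk).
apply: (hasjetP (p := fun y => pderiv f y a + pderiv g y a)
  (q := fun y => pderivbar f y a + pderivbar g y a)) => /=.
- by apply: sm_add; [exact: jet_sm fj|exact: jet_sm gk].
- by move=> z Uz; apply: wirt_add; [exact: (jet_wirt fj Uz)|exact: (jet_wirt gk Uz)].
- by rewrite (jet_v fj) (jet_v gk).
- by rewrite (jet_d fj) (jet_d gk).
- by rewrite (jet_e fj) (jet_e gk).
- by exists (c + c'); apply: wirt_add.
- by exists (d + d'); apply: wirt_add.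
Qed.

Lemma hasjet_mul f g j k : hasjet f j -> hasjet g k -> hasjet (fun y => f y * g y) (jmul j k).
Proof.
move=> fj gk; have [[c Wp] [d Wq]] := (jet_p fj, jet_q fj).
have [[c' Wp'] [d' Wq']] := (jet_p gk, jet_q gk).
have [Wf Wg] := (jet_wirt fj Uz0, jet_wirt gk Uz0).
apply: (hasjetP (p := fun y => f y * pderiv g y a + g y * pderiv f y a)
  (q := fun y => f y * pderivbar g y a + g y * pderivbar f y a)) => /=.
- by apply: sm_mul; [exact: jet_sm fj|exact: jet_sm gk].
- by move=> z Uz; apply: wirt_mul; [exact: (jet_wirt fj Uz)|exact: (jet_wirt gk Uz)].
- by rewrite (jet_v fj) (jet_v gk).
- by rewrite (jet_v fj) (jet_v gk) (jet_d fj) (jet_d gk) [jv k * _]mulrC.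
- by rewrite (jet_v fj) (jet_v gk) (jet_e fj) (jet_e gk) [jv k * _]mulrC.
- eexists; apply: wirt_eq (wirt_add (wirt_mul Wf Wp') (wirt_mul Wg Wp)) erefl _.
  rewrite (jet_v fj) (jet_v gk) (jet_d fj) (jet_d gk) (jet_e fj) (jet_e gk); ring.
- eexists; apply: wirt_eq (wirt_add (wirt_mul Wf Wq') (wirt_mul Wg Wq)) _ erefl.
  rewrite (jet_v fj) (jet_v gk) (jet_d fj) (jet_d gk) (jet_e fj) (jet_e gk); ring.
Qed.

Lemma hasjet_eq f j k : hasjet f j -> j = k -> hasjet f k. Proof. by move=> ? <-. Qed.

Lemma hasjet_opp f j : hasjet f j -> hasjet (fun y => - f y) (jopp j).
Proof.
move=> fj; have E : (fun y => - f y) = (fun y => -1 * f y).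
  by apply/funext => y; rewrite mulN1r.
rewrite E; apply: (hasjet_eq (hasjet_mul (hasjet_cst (-1)) fj)).
by rewrite /jmul /jopp /= !mul0r !addr0 !mulN1r.
Qed.

Lemma hasjet_on f g j : (forall z, U z -> f z = g z) -> hasjet f j -> hasjet g j.
Proof.
move=> fg fj; have [[c Wp] [d Wq]] := (jet_p fj, jet_q fj).
apply: (hasjetP (p := fun y => pderiv f y a) (q := fun y => pderivbar f y a)) => /=.
- exact: sm_on fg (jet_sm fj).
- by move=> z Uz; exact: (wirt_on oU Uz fg (jet_wirt fj Uz)).
- by rewrite -fg // (jet_v fj).
- exact: jet_d fj.
- exact: jet_e fj.
- by exists c.
- by exists d.
Qed.

(** The explicit jet of an inverse is never used: only its existence is, because
    the inverse Gram matrix occurs multiplied by functions that vanish at the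
    point. *)
Lemma hasjet_inv f j : (forall z, U z -> f z != 0) -> hasjet f j -> exists k,
  hasjet (fun y => (f y)^-1) k.
Proof.
move=> f0 fj; have [[c Wp] [d Wq]] := (jet_p fj, jet_q fj).
have Wf := jet_wirt fj Uz0.
have v0 : jv j != 0 by rewrite -(jet_v fj) f0.
have ff0 : f z0 * f z0 != 0 by rewrite mulf_neq0 ?f0.
have Wi : forall p p' q', wirt p z0 a p' q' ->
   wirt (fun y => -1 * (p y * (f y * f y)^-1)) z0 a _ _ :=
  fun p p' q' W => wirt_mul (wirt_cst (-1) z0 a) (wirt_mul W (wirt_inv ff0 (wirt_mul Wf Wf))).
exists (Jet (jv j)^-1 (- jd j / (jv j * jv j)) (- je j / (jv j * jv j))
  (2 * jd j * je j / (jv j * jv j * jv j) - jm j / (jv j * jv j))).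
apply: (hasjetP (p := fun y => -1 * (pderiv f y a / (f y * f y)))
  (q := fun y => -1 * (pderivbar f y a / (f y * f y)))) => /=.
- by apply: sm_inv f0 _; exact: jet_sm fj.
- move=> z Uz; rewrite !mulN1r; apply: wirt_inv; first exact: f0.
  exact: (jet_wirt fj Uz).
- by rewrite (jet_v fj).
- by rewrite (jet_v fj) (jet_d fj) mulN1r mulNr.
- by rewrite (jet_v fj) (jet_e fj) mulN1r mulNr.
- eexists; apply: wirt_eq (Wi _ _ _ Wp) erefl _.
  rewrite (jet_v fj) (jet_d fj) (jet_e fj); field; exact: v0.
- eexists; apply: wirt_eq (Wi _ _ _ Wq) _ erefl.
  rewrite (jet_v fj) (jet_d fj) (jet_e fj); field; exact: v0.
Qed.

Lemma sm_hasjet f : sm U f -> exists j, hasjet f j.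
Proof.
elim=> {f} [c|k|f sf [j fj]|f g sf [j fj] sg [k gk]|f g sf [j fj] sg [k gk]|f f0 sf [j fj]
  |f g fg sf [j fj]].
- by eexists; exact: hasjet_cst.
- by eexists; exact: hasjet_coord.
- by eexists; exact: hasjet_conj fj.
- by eexists; exact: hasjet_add fj gk.
- by eexists; exact: hasjet_mul fj gk.
- exact: hasjet_inv f0 fj.
- by exists j; exact: hasjet_on fg fj.
Qed.

Lemma hasjet_sum n (F : 'I_n -> pt -> C) (J : nat -> jet C) :
  (forall i : 'I_n, hasjet (F i) (J i)) -> hasjet (fun y => \sum_(i < n) F i y) (jsum n J).
Proof.
elim: n F J => [|n IH] F J FJ.
  by apply: hasjet_on (hasjet_cst 0) => z _; rewrite big_ord0.
apply: (@hasjet_on (fun y => F ord0 y + \sum_(i < n) F (lift ord0 i) y)).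
  by move=> z _; rewrite big_ord_recl.
rewrite /jsum /=; apply: hasjet_add (FJ ord0) _.
rewrite (iotaDl 1 0 n) -map_comp.
by apply: (IH (fun i => F (lift ord0 i)) (J \o (addn 1))) => i; exact: FJ (lift ord0 i).
Qed.

End Jets.

(** * Contraction of the curvature with the Kaehler form *)

Section TopForm.
Variables (A : nzRingType) (x : 'I_4 -> A).
Hypotheses (xC : forall a b, x a * x b = x b * x a) (x0 : forall a, x a * x a = 0).

Lemma ord4_split (a b : 'I_4) : a != b -> exists c d : 'I_4,
  forall (V : nmodType) (y : 'I_4 -> V), \sum_i y i = y a + (y b + (y c + y d)).
Proof.
move=> ab; have : #|~: [set a; b]%SET| = 2%N.
  by have := cardsC [set a; b]%SET; rewrite cards2 ab card_ord => /eqP; rewrite eqn_add2l => /eqP.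
move/eqP/cards2P => [c [d [cd E]]]; exists c, d => V y.
rewrite (bigD1 a) //= (bigD1 b) ?(eq_sym b) //= (eq_bigl (mem [set c; d]%SET)).
  by rewrite big_setU1 ?inE //= big_set1.
by move=> i; rewrite -E !inE negb_or.
Qed.

Lemma top_indep (a b : 'I_4) : x a * (\sum_i x i) ^+ 3 = x b * (\sum_i x i) ^+ 3.
Proof.
case: (eqVneq a b) => [->//|ab]; have [c [d E]] := ord4_split ab.
rewrite E sqz_top // (xC a b) -(sqz_top xC x0 b a c d); congr (_ * _ ^+ 3).
by rewrite addrCA.
Qed.

Lemma top_kill (u : A) (a b : 'I_4) : a != b -> u * x a = 0 -> u * x b = 0 ->
  u * (\sum_i x i) ^+ 3 = 0.
Proof.
by move=> /ord4_split [c [d E]] ua ub; rewrite E sqz_kill2.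
Qed.

Lemma top_pow4 (a : 'I_4) : (\sum_i x i) ^+ 4 = (x a * (\sum_i x i) ^+ 3) *+ 4.
Proof.
rewrite exprS mulr_suml (eq_bigr (fun=> x a * (\sum_i x i) ^+ 3)).
  by rewrite sumr_const card_ord.
by move=> b _; apply: top_indep.
Qed.

End TopForm.

(** The elements D_a and E_a stand for dz_a and conj dz_a: working with abstract
    anticommuting elements avoids the coordinates of forms. *)
Section Contraction.
Variables (K : fieldType) (A : algType K) (D E : 'I_4 -> A) (k : 'I_4 -> K).
Hypotheses (DD : forall a b, D a * D b = - (D b * D a))
  (EE : forall a b, E a * E b = - (E b * E a))
  (DE : forall a b, D a * E b = - (E b * D a))
  (DD0 : forall a, D a * D a = 0) (EE0 : forall a, E a * E a = 0)
  (k0 : forall a, k a != 0).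
Let x a := k a *: (D a * E a).
Let w := \sum_a x a.

Lemma pairC (a b : 'I_4) : (D a * E a) * (D b * E b) = (D b * E b) * (D a * E a).
Proof.
rewrite !mulrA -[D a * E a * D b]mulrA -[E a * D b]opprK -DE mulrN mulrA DD !mulNr opprK.
rewrite -[LHS]mulrA EE mulrN mulrA -[D b * D a * E b]mulrA DE mulrN mulNr opprK !mulrA.
by [].
Qed.

Lemma pair0 (a : 'I_4) : (D a * E a) * (D a * E a) = 0.
Proof.
rewrite mulrA -[D a * E a * D a]mulrA -[E a * D a]opprK -DE mulrN mulrA DD0.
by rewrite mul0r oppr0 mul0r.
Qed.

Lemma wC a b : x a * x b = x b * x a.
Proof. by rewrite -!scalerAl -!scalerAr !scalerA pairC mulrC. Qed.

Lemma w0 a : x a * x a = 0.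
Proof. by rewrite -scalerAl -scalerAr pair0 !scaler0. Qed.

Lemma pair_volume : let o1 := lift ord0 ord0 in let o2 := lift ord0 (lift ord0 ord0) in
  let o3 := lift ord0 (lift ord0 (lift ord0 ord0)) in
  x ord0 * w ^+ 3 = (6 * (k ord0 * k o1 * k o2 * k o3)) *:
    (D ord0 * E ord0 * (D o1 * E o1) * (D o2 * E o2) * (D o3 * E o3)).
Proof.
rewrite /w !big_ord_recl big_ord0 addr0 (sqz_top wC w0) /x.
rewrite -!(scalerAl, scalerAr) !scalerA -scaler_nat scalerA; congr (_ *: _); ring.
Qed.

Lemma pair_kill a b : D b * D a * w ^+ 3 = 0.
Proof.
case: (eqVneq a b) => [->|ab]; first by rewrite DD0 mul0r.
apply: (top_kill wC w0 ab); rewrite -scalerAr mulrA.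
  by rewrite -[D b * D a * D a]mulrA DD0 mulr0 mul0r scaler0.
by rewrite DD mulNr -[D a * D b * D b]mulrA DD0 mulr0 oppr0 mul0r scaler0.
Qed.

Lemma pair_kill' a b : a != b -> E b * D a * w ^+ 3 = 0.
Proof.
move=> ab; apply: (top_kill wC w0 ab); rewrite -scalerAr.
  by rewrite mulrA -[E b * D a * D a]mulrA DD0 mulr0 mul0r scaler0.
rewrite [D b * E b]DE mulrN mulrA -[E b * D a * E b]mulrA DE mulrN mulrA EE0.
by rewrite mul0r oppr0 mul0r oppr0 scaler0.
Qed.

Lemma pair_top a : E a * D a * w ^+ 3 = - (k a)^-1 *: (x ord0 * w ^+ 3).
Proof.
rewrite (top_indep wC w0 ord0 a) -scalerAl scalerA mulNr mulVf // scaleN1r DE mulNr opprK.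
by [].
Qed.

(** Wedging a form of type (2,0)+(1,1) with the cube of w retains only the
    trace of its (1,1) part. *)
Lemma contraction (p q : 'I_4 -> 'I_4 -> K) :
  (\sum_a (\sum_b (p a b *: D b + q a b *: E b)) * D a) * w ^+ 3 =
  - (\sum_a q a a / k a) *: (x ord0 * w ^+ 3).
Proof.
rewrite mulr_suml scaleNr scaler_suml -sumrN; apply: eq_bigr => a _.
rewrite !mulr_suml (bigD1 a) //= big1 ?addr0; last first.
  move=> b ba; rewrite mulrDl -!scalerAl mulrDl -!scalerAl pair_kill pair_kill' 1?eq_sym //.
  by rewrite !scaler0 addr0.
rewrite mulrDl -!scalerAl mulrDl -!scalerAl pair_kill scaler0 add0r pair_top scalerA.
by rewrite mulrN scaleNr (scalerAl (k ord0)).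
Qed.

End Contraction.

Lemma scale_comb (K : comPzRingType) (V : lmodType K) (p q d : K) (u v : V) :
  (p * d) *: u + (q * d) *: v = d *: (p *: u + q *: v).
Proof. by rewrite scalerDr !scalerA ![d * _]mulrC. Qed.

Section Forms.
Variable R : realType.
Local Notation C := (CC R).
Local Notation pt := 'rV[C]_4.

(** Shows that the volume form does not vanish without computing its sign. *)
Lemma ext_basis_prod n (s : seq 'I_n) : uniq s -> exists2 c : C, c != 0 &
  \prod_(i <- s) ext_vec (unitv R i) = c *: unitv R [set i in s]%SET :> ext R n.
Proof.
elim: s => [_|i s IH /= /andP[ni us]].
  exists 1; rewrite ?oner_neq0 // big_nil scale1r -/(ext_one R n) /ext_one.
  by congr unitv; apply/setP => k; rewrite !inE.
have [c c0 E] := IH us; rewrite big_cons E ext_vec_unit -scalerAr -wedge_mul wedge_unitv.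
rewrite finset.disjoints1 inE ni; exists (c * shuffle_sign R [set i]%SET [set i in s]%SET).
  by rewrite mulf_neq0 // /shuffle_sign signr_eq0.
by rewrite scalerA; congr (_ *: unitv R _); apply/setP => k; rewrite !inE.
Qed.

Lemma dz_anti a b : dz R a * dz R b = - (dz R b * dz R a).
Proof. exact: ext_vec_anti. Qed.
Lemma dzbar_anti a b : dzbar R a * dzbar R b = - (dzbar R b * dzbar R a).
Proof. exact: ext_vec_anti. Qed.
Lemma dz_dzbar a b : dz R a * dzbar R b = - (dzbar R b * dz R a).
Proof. exact: ext_vec_anti. Qed.
Lemma dz_sqr a : dz R a * dz R a = 0. Proof. exact: ext_vec_sqr. Qed.
Lemma dzbar_sqr a : dzbar R a * dzbar R a = 0. Proof. exact: ext_vec_sqr. Qed.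

Lemma volume_neq0 :
  (dz R ord0 * dzbar R ord0 * (dz R (lift ord0 ord0) * dzbar R (lift ord0 ord0)) *
   (dz R (lift ord0 (lift ord0 ord0)) * dzbar R (lift ord0 (lift ord0 ord0))) *
   (dz R (lift ord0 (lift ord0 (lift ord0 ord0))) *
    dzbar R (lift ord0 (lift ord0 (lift ord0 ord0))))) [set: 'I_(4 + 4)]%SET != 0 :> C.
Proof.
have [|c c0 E] := @ext_basis_prod 8 [:: lshift 4 ord0; rshift 4 ord0;
  lshift 4 (lift ord0 ord0); rshift 4 (lift ord0 ord0);
  lshift 4 (lift ord0 (lift ord0 ord0)); rshift 4 (lift ord0 (lift ord0 ord0));
  lshift 4 (lift ord0 (lift ord0 (lift ord0 ord0)));
  rshift 4 (lift ord0 (lift ord0 (lift ord0 ord0)))].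
  by [].
rewrite /dz /dzbar; move: E; rewrite !big_cons big_nil.
move: (ext_vec _) (ext_vec _) (ext_vec _) (ext_vec _) (ext_vec _) (ext_vec _) (ext_vec _)
  (ext_vec _) => x1 x2 x3 x4 x5 x6 x7 x8; rewrite mulr1 !mulrA => ->.
rewrite vec_scaleE unitvE mulf_neq0 // pnatr_eq0 eqb0 negbK; apply/eqP/setP => k.
by rewrite !inE; case: k => -[|[|[|[|[|[|[|[|]]]]]]]].
Qed.

Lemma wedge_powE (u : cform R) m : wedge_pow u m = u ^+ m.
Proof. by elim: m => [//|m IH]; rewrite exprS -IH. Qed.

Lemma conj_form_dz (c : 'I_4 -> C) :
  conj_form (\sum_a c a *: dz R a) = \sum_a (c a)^* *: dzbar R a.
Proof.
rewrite /conj_form.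
have -> : [ffun S : {set 'I_(4 + 4)} => ((\sum_a c a *: dz R a) S)^*] =
   \sum_a (c a)^* *: dz R a :> cform R.
  apply/ffunP => S; rewrite ffunE !sum_ffunE rmorph_sum; apply: eq_bigr => a _.
  by rewrite !vec_scaleE rmorphM /= /dz ext_vec_unit unitvE; congr (_ * _); rewrite rmorph_nat.
rewrite linear_sum; apply: eq_bigr => a _; rewrite linearZ /= ext_map_vec.
by congr (_ *: ext_vec (unitv R _)); rewrite /conj_index -[lshift 4 a]/(unsplit (inl a)) unsplitK.
Qed.

Lemma FS_form_diag (z : pt) (y : 'I_4 -> C) :
  (forall a b, FS_metric z a b = if a == b then y a else 0) ->
  FS_form z = \sum_a ('i / 2 * y a) *: (dz R a * dzbar R a).
Proof.
move=> g; rewrite /FS_form scaler_sumr; apply: eq_bigr => a _.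
rewrite (bigD1 a) //= big1 ?addr0 => [|b ba]; first by rewrite g eqxx scalerA.
by rewrite g eq_sym (negPf ba) scale0r.
Qed.

(** The form of the Chern connection has type (1,0), so the quadratic term of the
    curvature has type (2,0) and is killed by the cube of the Kaehler form, which
    is of type (3,3).  From the differential of the connection form only the
    diagonal conj dz_a /\ dz_a terms survive. *)
Lemma curvature_contraction (U : set pt) (z0 : pt) r
    (c : 'I_4 -> 'I_r -> 'I_r -> pt -> C) (y : 'I_4 -> C) :
  open U -> U z0 -> (forall a i l, sm U (c a i l)) ->
  (forall a b, FS_metric z0 a b = if a == b then y a else 0) -> (forall a, y a != 0) ->
  exists2 V : cform R, V [set: 'I_(4 + 4)]%SET != 0 :> C &
    wedge_pow (FS_form z0) 4 = 4%:R *: V /\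
    forall i l,
      wedge (curvature (fun i l z => \sum_a c a i l z *: dz R a) i l z0)
        (wedge_pow (FS_form z0) 3)
      = - (\sum_a pderivbar (c a i l) z0 a / ('i / 2 * y a)) *: V.
Proof.
move=> oU Uz0 sc g y0.
pose k a : C := 'i / 2 * y a.
have k0 a : k a != 0 by rewrite !mulf_neq0 ?invr_eq0 ?two_neq0 ?neq0Ci.
pose x a : cform R := k a *: (dz R a * dzbar R a).
have FE : FS_form z0 = \sum_a x a by rewrite (FS_form_diag g).
have [C1 C2] := (dz_anti, dzbar_anti).
have xC := wC (D := dz R) (E := dzbar R) k dz_anti dzbar_anti dz_dzbar.
have x0 := w0 (D := dz R) (E := dzbar R) k dz_dzbar dz_sqr.
pose V := x ord0 * (\sum_a x a) ^+ 3.
exists V; [|split; first by rewrite wedge_powE FE (top_pow4 xC x0 ord0) -scaler_nat].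
  rewrite /V (pair_volume (D := dz R) (E := dzbar R) k dz_anti dzbar_anti dz_dzbar dz_sqr).
  rewrite vec_scaleE; apply: mulf_neq0; last exact: volume_neq0.
  by apply: mulf_neq0; [rewrite pnatr_eq0|do 3![apply: mulf_neq0; last exact: k0]; exact: k0].
move=> i l.
rewrite wedge_powE FE -(contraction dz_anti dzbar_anti dz_dzbar dz_sqr dzbar_sqr k0
  (fun a b => pderiv (c a i l) z0 b) (fun a b => pderivbar (c a i l) z0 b)).
rewrite wedge_mul /curvature mulrDl [X in _ + X]mulr_suml [X in _ + X]big1 ?addr0; last first.
  move=> m _; rewrite wedge_mul !mulr_suml big1 // => a _.
  rewrite mulr_sumr mulr_suml big1 // => b _.
  rewrite -scalerAl -scalerAr -!scalerAl.
  by rewrite (pair_kill k dz_anti dzbar_anti dz_dzbar dz_sqr) !scaler0.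
congr (_ * _); rewrite /dform.
have dE (S : {set 'I_(4 + 4)}) : dfun (fun z => (\sum_a c a i l z *: dz R a) S) z0 =
   \sum_a dz R a S *: dfun (c a i l) z0.
  have sS a : sm U (fun z => c a i l z * dz R a S) by apply: sm_mul (sc a i l) (sm_cst _ _).
  have -> : (fun z => (\sum_a c a i l z *: dz R a) S) = (fun z => \sum_a c a i l z * dz R a S).
    by apply/funext => z; rewrite sum_ffunE; apply: eq_bigr => a _; rewrite vec_scaleE.
  have W b : wirt (fun z => \sum_a c a i l z * dz R a S) z0 b
     (\sum_a pderiv (c a i l) z0 b * dz R a S) (\sum_a pderivbar (c a i l) z0 b * dz R a S).
    rewrite !big_ord_recl !big_ord0; under eq_fun do rewrite !big_ord_recl big_ord0.
    have Wa a : wirt (fun z => c a i l z * dz R a S) z0 b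
        (pderiv (c a i l) z0 b * dz R a S) (pderivbar (c a i l) z0 b * dz R a S).
      have := wirt_mul (sm_wirtE oU b (sc a i l) Uz0) (wirt_cst (dz R a S) z0 b).
      by rewrite !mulr0 !add0r ![dz R a S * _]mulrC.
    by do !apply: wirt_add => //; exact: wirt_cst.
  transitivity (\sum_b \sum_a dz R a S *: (pderiv (c a i l) z0 b *: dz R b +
     pderivbar (c a i l) z0 b *: dzbar R b)).
    apply: eq_bigr => b _; have [-> ->] := wirt_val (W b).
    rewrite !scaler_suml -big_split; apply: eq_bigr => a _.
    exact: scale_comb.
  by rewrite exchange_big; apply: eq_bigr => a _; rewrite scaler_sumr.
under eq_bigr => S _ do rewrite dE wedge_mul mulr_suml.
rewrite exchange_big; apply: eq_bigr => a _.
rewrite [X in _ = _ * X](ext_basis (dz R a)) mulr_sumr; apply: eq_bigr => S _.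
by rewrite -scalerAl -scalerAr.
Qed.

End Forms.

(** * The mean curvature in a holomorphic frame *)

Section MeanCurvature.
Variable R : realType.
Local Notation C := (CC R).
Local Notation pt := 'rV[C]_4.
Variables (I : finType) (B : bundle R I) (k : fibre_metric R I) (j : 'I_5) (U : set pt).
Variables (r : nat) (s : 'I_r -> pt -> vec R I) (H : pt -> 'M[C]_r).
Hypotheses (oU : open U) (sU : hol_frame B j U s).
Hypotheses (kH : forall z l m, k (chart j z) (s l z) (s m z) = H z l m)
  (Hherm : forall z l m, H z l m = (H z m l)^*)
  (smH : forall l m, sm U (fun z => H z l m))
  (unitH : forall z, U z -> H z \in unitmx).

(** The entries of the connection matrix [dH H^-1] of the Chern connection. *)
Definition connection_coef a i l z : C :=
  \sum_m pderiv (fun y => H y l m) z a * invmx (H z) m i.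

Lemma sm_connection a i l : sm U (connection_coef a i l).
Proof.
apply: sm_sum => m; apply: sm_mul; first exact: sm_pderiv.
exact: sm_invmx.
Qed.

Lemma connection_mul a l m z : U z ->
  \sum_i H z i m * connection_coef a i l z = pderiv (fun y => H y l m) z a.
Proof.
move=> Uz; pose D : 'rV[C]_r := \row_m pderiv (fun y => H y l m) z a.
transitivity ((D *m invmx (H z) *m H z) 0 m).
  rewrite mxE; apply: eq_bigr => i _; rewrite mulrC mxE; congr (_ * _).
  by apply: eq_bigr => m' _; rewrite mxE.
by rewrite mulmxKV ?unitH // mxE.
Qed.

(** The (1,0)-part of the compatibility with the metric is [connection_mul]; the
    (0,1)-part is its conjugate because H is Hermitian. *)
Lemma chern_connection :
  chern_form k j U s (fun i l z => \sum_a connection_coef a i l z *: dz R a).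
Proof.
move=> z Uz l m; split; first by exists (fun a => connection_coef a l m z).
have -> : (fun z => k (chart j z) (s l z) (s m z)) = (fun y => H y l m).
  by apply/funext => y; rewrite kH.
rewrite big_split /=.
under [X in _ = X + _]eq_bigr => i _ do rewrite kH scaler_sumr.
under [X in _ = _ + X]eq_bigr => i _ do rewrite kH conj_form_dz scaler_sumr.
rewrite [X in _ = X + _]exchange_big [X in _ = _ + X]exchange_big -[RHS]big_split.
apply: eq_bigr => a _; congr (_ + _).
  under eq_bigr => i _ do rewrite scalerA.
  by rewrite -scaler_suml connection_mul.
under eq_bigr => i _ do rewrite scalerA Hherm -rmorphM.
rewrite -scaler_suml -rmorph_sum /= connection_mul //; congr (_ *: _).
have W := wirt_conj (sm_wirtE oU a (smH m l) Uz).
have [_ <-] := wirt_val W. congr (pderivbar _ z a).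
by apply/funext => y; exact: Hherm.
Qed.

Lemma wirt_sum n (F : 'I_n -> pt -> C) z a (p q : 'I_n -> C) :
  (forall i, wirt (F i) z a (p i) (q i)) ->
  wirt (fun y => \sum_i F i y) z a (\sum_i p i) (\sum_i q i).
Proof.
move=> W; elim: (index_enum _) => [|i e IH].
  rewrite !big_nil; have -> : (fun y => \sum_(i <- [::]) F i y) = (fun=> 0).
    by apply/funext => y; rewrite big_nil.
  exact: wirt_cst.
rewrite !big_cons; have -> : (fun y => \sum_(k <- i :: e) F k y) =
    (fun y => F i y + \sum_(k <- e) F k y).
  by apply/funext => y; rewrite big_cons.
exact: wirt_add (W i) IH.
Qed.

(** Differentiating [connection_mul] gives the curvature without ever
    differentiating an inverse matrix. *)
Lemma curvature_diag a l z : U z -> (forall i m, i != m -> H z i m = 0) ->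
  (forall i, H z i i != 0) ->
  pderivbar (connection_coef a l l) z a =
  (pderivbar (fun y => pderiv (fun x => H x l l) y a) z a -
   \sum_i pderiv (fun y => H y l i) z a * pderivbar (fun y => H y i l) z a / H z i i) / H z l l.
Proof.
move=> Uz off diag.
have coef i : connection_coef a i l z = pderiv (fun y => H y l i) z a / H z i i.
  apply: (mulIf (diag i)); rewrite divfK // -(connection_mul a l i Uz).
  rewrite (bigD1 i) //= big1 ?addr0 => [|m mi]; first exact: mulrC.
  by rewrite off // mul0r.
have W := wirt_sum (fun i => wirt_mul (sm_wirtE oU a (smH i l) Uz)
  (sm_wirtE oU a (sm_connection a i l) Uz)).
have [_ E] := wirt_val W.
have E2 : pderivbar (fun y => pderiv (fun x => H x l l) y a) z a =
    pderivbar (fun y => \sum_i H y i l * connection_coef a i l y) z a.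
  have [_ ->] := wirt_val (wirt_on oU Uz (fun y Uy => connection_mul a l l Uy) W).
  by rewrite E.
apply: (mulIf (diag l)); rewrite divfK // E2 E big_split /= addrC.
have -> : \sum_i pderiv (fun y => H y l i) z a * pderivbar (fun y => H y i l) z a / H z i i =
    \sum_i connection_coef a i l z * pderivbar (fun y => H y i l) z a.
  by apply: eq_bigr => i _; rewrite coef mulrAC.
rewrite addrC addrK (bigD1 l) //= big1 ?addr0 => [|m ml]; first exact: mulrC.
by rewrite off // mul0r.
Qed.

(** The equation that defines K expresses K s_l through the contracted curvature,
    so for K = lambda the coordinates of both sides in the frame agree. *)
Lemma scalar_curvature_matrix (K : P4 R -> vec R I -> vec R I) (lambda : C) z0 (y : 'I_4 -> C) :
  is_mean_curvature B k K ->
  (forall p v, fibre B p v -> K p v = lambda *: v) ->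
  U z0 -> (forall a b, FS_metric z0 a b = if a == b then y a else 0) ->
  (forall a, y a != 0) ->
  forall l, \sum_a pderivbar (connection_coef a l l) z0 a / y a = - lambda.
Proof.
move=> mc Kl Uz0 g y0 l.
have [V V0 [V4 V3]] := curvature_contraction oU Uz0 sm_connection g y0.
have := mc r j U s _ oU sU chern_connection z0 Uz0 l [set: 'I_(4 + 4)]%SET.
rewrite V4 vec_scaleE.
under eq_bigr => i _ do rewrite V3 vec_scaleE.
have [_ fr] := sU; have [fz uz] := fr z0 Uz0.
rewrite Kl // => E.
pose c i : C := \sum_a pderivbar (connection_coef a i l) z0 a / y a.
(* Contracting with omega^3 divides by the factor i/2 of one of the diagonal
   entries of omega; V' absorbs it. *)
pose V' := V [set: 'I_(4 + 4)]%SET / ('i / 2).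
have i0 : ('i : C) != 0 by exact: neq0Ci.
have V'0 : V' != 0 by rewrite mulf_neq0 // invr_eq0 mulf_neq0 ?invr_eq0 ?two_neq0.
have V'E : V' = - (2 * 'i) * V [set: 'I_(4 + 4)]%SET.
  apply: (mulIf (x := 'i / 2)); first by rewrite mulf_neq0 // invr_eq0 two_neq0.
  rewrite /V' divfK ?mulf_neq0 ?invr_eq0 ?two_neq0 //.
  transitivity (- ('i * 'i) * V [set: 'I_(4 + 4)]%SET); first by rewrite mulii opprK mul1r.
  by field.
have Ec : \sum_i c i *: s i z0 + lambda *: s l z0 = 0.
  apply: (scalerI V'0); rewrite scaler0 scalerDr scaler_sumr.
  apply/eqP; rewrite -[V' *: (lambda *: _)]opprK subr_eq0; apply/eqP.
  transitivity (- \sum_i (- (\sum_a pderivbar (connection_coef a i l) z0 a / ('i / 2 * y a)) *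
     V [set: 'I_(4 + 4)]%SET) *: s i z0).
    rewrite -sumrN; apply: eq_bigr => i _; rewrite -scaleNr mulNr opprK scalerA; congr (_ *: _).
    rewrite /c mulr_sumr mulr_suml; apply: eq_bigr => a _; rewrite /V'.
    by field; rewrite y0 i0.
  transitivity ((- (V' * lambda)) *: s l z0); last by rewrite scaleNr scalerA.
  by rewrite E scalerA -[LHS]scaleN1r scalerA V'E; congr (_ *: _); field.
have [d [_ du]] := uz _ (fz l).
have d1 : d = [ffun i => (i == l)%:R].
  apply: du; rewrite (bigD1 l) //= big1 ?addr0 => [|i /negPf il]; last by rewrite ffunE il scale0r.
  by rewrite ffunE eqxx scale1r.
have d2 : d = [ffun i => (i == l)%:R + (lambda * (i == l)%:R + c i)].
  apply: du; under eq_bigr => i _ do rewrite ffunE scalerDl scalerDl.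
  rewrite big_split big_split /= [X in X + _](bigD1 l) //= eqxx scale1r big1 ?addr0; last first.
    by move=> i /negPf ->; rewrite scale0r.
  rewrite [X in _ + (X + _)](bigD1 l) //= eqxx mulr1 [X in _ + (_ + X + _)]big1 ?addr0; last first.
    by move=> i /negPf ->; rewrite mulr0 scale0r.
  by rewrite [X in _ + X]addrC Ec addr0.
have := congr1 (fun f : {ffun 'I_r -> C} => f l) (etrans (esym d2) d1).
rewrite !ffunE eqxx mulr1 => /eqP; rewrite addrC -subr_eq0 addrK.
by rewrite addrC addr_eq0 => /eqP.
Qed.

End MeanCurvature.

(** * The Euler frame of Q *)

Section Hdot.
Variable R : realType.
Local Notation C := (CC R).
Variable I : finType.
Implicit Types u v w : vec R I.

Lemma hdotDl u v w : hdot (u + v) w = hdot u w + hdot v w.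
Proof. by rewrite -big_split; apply: eq_bigr => i _; rewrite ffunE mulrDl. Qed.

Lemma hdotZl (c : C) u w : hdot (c *: u) w = c * hdot u w.
Proof. by rewrite mulr_sumr; apply: eq_bigr => i _; rewrite vec_scaleE mulrA. Qed.

Lemma hdotC u v : hdot u v = (hdot v u)^*.
Proof. by rewrite rmorph_sum; apply: eq_bigr => i _; rewrite rmorphM /= conjCK mulrC. Qed.

Lemma hdot0l w : hdot 0 w = 0.
Proof. by rewrite -(scale0r (0 : vec R I)) hdotZl mul0r. Qed.

Lemma hdotDr u v w : hdot w (u + v) = hdot w u + hdot w v.
Proof. by rewrite hdotC hdotDl rmorphD /= -!hdotC. Qed.

Lemma hdotZr (c : C) u w : hdot w (c *: u) = c^* * hdot w u.
Proof. by rewrite hdotC hdotZl rmorphM /= -hdotC. Qed.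

Lemma hdot0r w : hdot w 0 = 0. Proof. by rewrite hdotC hdot0l rmorph0. Qed.

Lemma hdotBl u v w : hdot (u - v) w = hdot u w - hdot v w.
Proof. by rewrite -scaleN1r hdotDl hdotZl mulN1r. Qed.

Lemma hdot_suml (J : Type) (r : seq J) (F : J -> vec R I) w :
  hdot (\sum_(i <- r) F i) w = \sum_(i <- r) hdot (F i) w.
Proof. by elim/big_rec2 : _ => [|i x y _ <-]; rewrite ?hdot0l ?hdotDl. Qed.

Lemma hdot_sumr (J : Type) (r : seq J) (F : J -> vec R I) w :
  hdot w (\sum_(i <- r) F i) = \sum_(i <- r) hdot w (F i).
Proof. by elim/big_rec2 : _ => [|i x y _ <-]; rewrite ?hdot0r ?hdotDr. Qed.

Lemma hdot_eq0 v : hdot v v = 0 -> v = 0.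
Proof.
move/eqP; rewrite psumr_eq0; last by move=> i _; rewrite mul_conjC_ge0.
by move/allP => E; apply/ffunP => i; rewrite ffunE;
  have := E i (mem_index_enum _); rewrite mul_conjC_eq0 => /eqP.
Qed.

Lemma hdot_unitr v i : hdot v (unitv R i) = v i.
Proof.
rewrite /hdot (bigD1 i) //= unitvE eqxx rmorph1 mulr1 big1 ?addr0 // => j /negPf ji.
by rewrite unitvE ji rmorph0 mulr0.
Qed.

Lemma vec_unit_sum v : v = \sum_i v i *: unitv R i.
Proof.
apply/ffunP => j; rewrite sum_ffunE.
have E i : (v i *: unitv R i : vec R I) j = v i * (j == i)%:R.
  by rewrite vec_scaleE unitvE.
rewrite (eq_bigr _ (fun i _ => E i)) (bigD1 j) //= eqxx mulr1 big1 ?addr0 // => i ij.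
by rewrite eq_sym (negPf ij) mulr0.
Qed.

End Hdot.

Lemma sum_sub_comb (K : pzRingType) (V : lmodType K) n (c : K) (a b : 'I_n -> K)
    (f : 'I_n -> V) :
  c *: (- \sum_k b k *: f k) + \sum_k a k *: f k = \sum_k (a k - c * b k) *: f k.
Proof.
rewrite scalerN scaler_sumr -sumrN -big_split; apply: eq_bigr => k _ /=.
by rewrite scalerBl scalerA addrC.
Qed.

Section EulerFrame.
Variable R : realType.
Local Notation C := (CC R).
Local Notation pt := 'rV[C]_4.
Implicit Types (z : pt) (v w : vec R 'I_5).

Local Notation hx z := (affine_lift ord0 z).
Local Notation ln z := (taut (chart ord0 z)).

Lemma affine_lift0 z : hx z ord0 = 1. Proof. by rewrite ffunE unlift_none. Qed.
Lemma affine_liftS z k : hx z (lift ord0 k) = z 0 k. Proof. by rewrite ffunE liftK. Qed.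

Definition nrm z : C := 1 + \sum_k z 0 k * (z 0 k)^*.

Lemma nrmE z : hdot (hx z) (hx z) = nrm z.
Proof.
rewrite /hdot big_ord_recl affine_lift0 rmorph1 mulr1; congr (_ + _).
by apply: eq_bigr => k _; rewrite affine_liftS.
Qed.

Lemma nrm_neq0 z : nrm z != 0.
Proof. by rewrite gt_eqF // ltr_wpDr ?ltr01 ?sumr_ge0 // => k _; rewrite mul_conjC_ge0. Qed.

Lemma nrm_real z : (nrm z)^* = nrm z.
Proof. by rewrite -nrmE -hdotC. Qed.

Lemma lineP z w : ln z w <-> exists c : C, w = c *: hx z.
Proof. by split => [[c _ <-]|[c ->]]; exists c. Qed.

Lemma orth_lineP z w : orthc (ln z) w <-> hdot w (hx z) = 0.
Proof.
split=> [E|E u /lineP [c ->]]; last by rewrite hdotZr E mulr0.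
by apply: E; apply/lineP; exists 1; rewrite scale1r.
Qed.

Definition qproj z v : vec R 'I_5 := v - (hdot v (hx z) / nrm z) *: hx z.

Lemma qproj_orth z v : hdot (qproj z v) (hx z) = 0.
Proof. by rewrite hdotBl hdotZl nrmE divfK ?nrm_neq0 ?subrr. Qed.

Lemma euler_projE z v : euler_proj (chart ord0 z) v = qproj z v.
Proof.
apply: xget_unique; first split.
- exact/orth_lineP/qproj_orth.
- by apply/lineP; eexists; rewrite opprB addrC subrK.
move=> w [/orth_lineP ow /lineP [c E]].
have -> : w = v - c *: hx z by rewrite -E opprB addrC subrK.
congr (_ - _ *: _); apply: (mulIf (nrm_neq0 z)); rewrite divfK ?nrm_neq0 //.
by rewrite -nrmE -hdotZl -E hdotBl ow subr0.
Qed.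

Lemma qproj_lin z (c : C) u v : qproj z (c *: u + v) = c *: qproj z u + qproj z v.
Proof.
rewrite /qproj hdotDl hdotZl scalerBr scalerA mulrDl scalerDl -mulrA opprD.
by rewrite addrACA.
Qed.
HB.instance Definition _ z :=
  GRing.isLinear.Build C (vec R 'I_5) (vec R 'I_5) *:%R (qproj z) (qproj_lin z).

Lemma qproj_id z v : hdot v (hx z) = 0 -> qproj z v = v.
Proof. by rewrite /qproj => ->; rewrite mul0r scale0r subr0. Qed.

(** The images of the last four basis vectors frame the quotient bundle over
    the chart. *)
Definition qfr z (k : 'I_4) : vec R 'I_5 := qproj z (unitv R (lift ord0 k)).

Lemma hx_sum z : hx z = unitv R ord0 + \sum_k z 0 k *: unitv R (lift ord0 k).
Proof.
rewrite [LHS]vec_unit_sum big_ord_recl affine_lift0 scale1r; congr (_ + _).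
by apply: eq_bigr => k _; rewrite affine_liftS.
Qed.

Lemma qproj_e0 z : qproj z (unitv R ord0) = - \sum_k z 0 k *: qfr z k.
Proof.
apply/eqP; rewrite -addr_eq0; apply/eqP.
transitivity (qproj z (hx z)); last first.
  by rewrite /qproj nrmE divff ?nrm_neq0 // scale1r subrr.
rewrite hx_sum linearD linear_sum; congr (_ + _).
by apply: eq_bigr => k _; rewrite linearZ.
Qed.

Lemma qfr_dot z i j : hdot (qfr z i) (qfr z j) = (i == j)%:R - (z 0 i)^* * z 0 j / nrm z.
Proof.
rewrite {1}/qfr /qproj hdotBl hdotZl [hdot (hx z) _]hdotC qproj_orth rmorph0 mulr0 subr0.
rewrite hdotC hdot_unitr /qfr /qproj ffunE [in X in _ + X]ffunE vec_scaleE unitvE.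
rewrite affine_liftS hdotC hdot_unitr affine_liftS (inj_eq (@lift_inj _ ord0)).
rewrite rmorphB /= rmorph_nat rmorphM fmorph_div /= conjCK nrm_real.
by rewrite mulrAC [z 0 j * _]mulrC mulrAC [(z 0 i)^* * _]mulrC.
Qed.

Lemma orth_qfr z v : hdot v (hx z) = 0 ->
  v = \sum_k (v (lift ord0 k) - v ord0 * z 0 k) *: qfr z k.
Proof.
move=> /qproj_id E; rewrite -[LHS]E.
transitivity (qproj z (\sum_i v i *: unitv R i)); first by rewrite -vec_unit_sum.
transitivity (v ord0 *: qproj z (unitv R ord0) + \sum_k v (lift ord0 k) *: qfr z k).
  rewrite linear_sum big_ord_recl; congr (_ + _); first exact: linearZ.
  by apply: eq_bigr => k _; exact: linearZ.
by rewrite qproj_e0 sum_sub_comb.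
Qed.

End EulerFrame.

(** * Bivectors *)

(** The coefficients of a bivector are listed in the order 12, 13, 14, 23, 24, 34.
    The wedge product of two bivectors in four variables is a symmetric pairing
    times the volume element. *)
Section Pairing.
Variables (K : fieldType) (A : algType K) (f0 f1 f2 f3 : A).
Hypotheses (s0 : f0 * f0 = 0) (s1 : f1 * f1 = 0) (s2 : f2 * f2 = 0) (s3 : f3 * f3 = 0)
  (a10 : f1 * f0 = - (f0 * f1)) (a20 : f2 * f0 = - (f0 * f2)) (a30 : f3 * f0 = - (f0 * f3))
  (a21 : f2 * f1 = - (f1 * f2)) (a31 : f3 * f1 = - (f1 * f3)) (a32 : f3 * f2 = - (f2 * f3)).

Definition bivec (c : nat -> K) : A :=
  c 0%N *: (f0 * f1) + c 1%N *: (f0 * f2) + c 2%N *: (f0 * f3) +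
  c 3%N *: (f1 * f2) + c 4%N *: (f1 * f3) + c 5%N *: (f2 * f3).

Definition bipair (c d : nat -> K) : K :=
  c 0%N * d 5%N - c 1%N * d 4%N + c 2%N * d 3%N +
  c 3%N * d 2%N - c 4%N * d 1%N + c 5%N * d 0%N.

Let asso (x : A) u v w : u * v = w -> x * u * v = x * w.
Proof. by move=> <-; rewrite mulrA. Qed.

Lemma bivec_mul c d : bivec c * bivec d = bipair c d *: (f0 * f1 * f2 * f3).
Proof.
(* Products of two basis bivectors are normalised by moving equal factors next
   to each other; nine rounds suffice. *)
have R0 := (s0, s1, s2, s3, a10, a20, a30, a21, a31, a32).
have R1 x := (asso x s0, asso x s1, asso x s2, asso x s3).
have R2 x := (asso x a10, asso x a20, asso x a30, asso x a21, asso x a31, asso x a32).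
have R := (R0, R1, R2, (@mulrN A, @mulNr A, @opprK A, @oppr0 A), (@mulr0 A, @mul0r A)).
have e00 : (f0 * f1) * (f0 * f1) = 0 by do 9!rewrite ?mulrA ?R.
have e01 : (f0 * f1) * (f0 * f2) = 0 by do 9!rewrite ?mulrA ?R.
have e02 : (f0 * f1) * (f0 * f3) = 0 by do 9!rewrite ?mulrA ?R.
have e03 : (f0 * f1) * (f1 * f2) = 0 by do 9!rewrite ?mulrA ?R.
have e04 : (f0 * f1) * (f1 * f3) = 0 by do 9!rewrite ?mulrA ?R.
have e05 : (f0 * f1) * (f2 * f3) = f0 * f1 * f2 * f3 by do 9!rewrite ?mulrA ?R.
have e10 : (f0 * f2) * (f0 * f1) = 0 by do 9!rewrite ?mulrA ?R.
have e11 : (f0 * f2) * (f0 * f2) = 0 by do 9!rewrite ?mulrA ?R.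
have e12 : (f0 * f2) * (f0 * f3) = 0 by do 9!rewrite ?mulrA ?R.
have e13 : (f0 * f2) * (f1 * f2) = 0 by do 9!rewrite ?mulrA ?R.
have e14 : (f0 * f2) * (f1 * f3) = - (f0 * f1 * f2 * f3) by do 9!rewrite ?mulrA ?R.
have e15 : (f0 * f2) * (f2 * f3) = 0 by do 9!rewrite ?mulrA ?R.
have e20 : (f0 * f3) * (f0 * f1) = 0 by do 9!rewrite ?mulrA ?R.
have e21 : (f0 * f3) * (f0 * f2) = 0 by do 9!rewrite ?mulrA ?R.
have e22 : (f0 * f3) * (f0 * f3) = 0 by do 9!rewrite ?mulrA ?R.
have e23 : (f0 * f3) * (f1 * f2) = f0 * f1 * f2 * f3 by do 9!rewrite ?mulrA ?R.
have e24 : (f0 * f3) * (f1 * f3) = 0 by do 9!rewrite ?mulrA ?R.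
have e25 : (f0 * f3) * (f2 * f3) = 0 by do 9!rewrite ?mulrA ?R.
have e30 : (f1 * f2) * (f0 * f1) = 0 by do 9!rewrite ?mulrA ?R.
have e31 : (f1 * f2) * (f0 * f2) = 0 by do 9!rewrite ?mulrA ?R.
have e32 : (f1 * f2) * (f0 * f3) = f0 * f1 * f2 * f3 by do 9!rewrite ?mulrA ?R.
have e33 : (f1 * f2) * (f1 * f2) = 0 by do 9!rewrite ?mulrA ?R.
have e34 : (f1 * f2) * (f1 * f3) = 0 by do 9!rewrite ?mulrA ?R.
have e35 : (f1 * f2) * (f2 * f3) = 0 by do 9!rewrite ?mulrA ?R.
have e40 : (f1 * f3) * (f0 * f1) = 0 by do 9!rewrite ?mulrA ?R.
have e41 : (f1 * f3) * (f0 * f2) = - (f0 * f1 * f2 * f3) by do 9!rewrite ?mulrA ?R.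
have e42 : (f1 * f3) * (f0 * f3) = 0 by do 9!rewrite ?mulrA ?R.
have e43 : (f1 * f3) * (f1 * f2) = 0 by do 9!rewrite ?mulrA ?R.
have e44 : (f1 * f3) * (f1 * f3) = 0 by do 9!rewrite ?mulrA ?R.
have e45 : (f1 * f3) * (f2 * f3) = 0 by do 9!rewrite ?mulrA ?R.
have e50 : (f2 * f3) * (f0 * f1) = f0 * f1 * f2 * f3 by do 9!rewrite ?mulrA ?R.
have e51 : (f2 * f3) * (f0 * f2) = 0 by do 9!rewrite ?mulrA ?R.
have e52 : (f2 * f3) * (f0 * f3) = 0 by do 9!rewrite ?mulrA ?R.
have e53 : (f2 * f3) * (f1 * f2) = 0 by do 9!rewrite ?mulrA ?R.
have e54 : (f2 * f3) * (f1 * f3) = 0 by do 9!rewrite ?mulrA ?R.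
have e55 : (f2 * f3) * (f2 * f3) = 0 by do 9!rewrite ?mulrA ?R.
have T := ((e00, e01, e02, e03, e04, e05), (e10, e11, e12, e13, e14, e15), (e20, e21, e22, e23, e24, e25), (e30, e31, e32, e33, e34, e35), (e40, e41, e42, e43, e44, e45), (e50, e51, e52, e53, e54, e55)).
clear -T.
rewrite /bivec /bipair.
move: (f0 * f1 * f2 * f3) (f0 * f1) (f0 * f2) (f0 * f3) (f1 * f2) (f1 * f3) (f2 * f3) T.
move=> Om m01 m02 m03 m12 m13 m23 T.
rewrite !(mulrDl, mulrDr) -!(scalerAl, scalerAr) !T !scaler0 !(add0r, addr0).
by rewrite !scalerN !scalerA !scalerDl !scaleNr [_ - _ + _ + _ - _ + _]addrC !addrA;
  rewrite -?scalerDl.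
Qed.

End Pairing.

Notation "A ^h" := (map_mx Num.conj A^T) (at level 8, format "A ^h").

Lemma pairv_lin (R : realType) (I J : finType) (c : CC R) (a b : vec R I) (a' b' : vec R J) :
  pairv (c *: a + b) (c *: a' + b') = c *: pairv a a' + pairv b b'.
Proof.
by apply/ffunP => -[k|k]; rewrite ffunE [RHS]ffunE vec_scaleE !ffunE ?vec_scaleE.
Qed.

(** Modulo X the vectors e_k - c_k X and e_k agree, and multiplication by X
    kills the difference.  Used with X spanning the tautological line. *)
Lemma wedge_shift (K : fieldType) (A : algType K) (X e0 e1 e2 e3 : A) (c0 c1 c2 c3 : K) :
  X * X = 0 -> e0 * X = - (X * e0) -> e1 * X = - (X * e1) -> e2 * X = - (X * e2) ->
  e3 * X = - (X * e3) ->
  (e0 - c0 *: X) * (e1 - c1 *: X) * (e2 - c2 *: X) * (e3 - c3 *: X) * X =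
  e0 * e1 * e2 * e3 * X.
Proof.
move=> XX x0 x1 x2 x3.
have S (w e : A) (c : K) : w * (e - c *: X) * X = w * e * X.
  by rewrite mulrBr mulrBl -scalerAr -!scalerAl -[w * X * X]mulrA XX mulr0 scaler0 subr0.
have M (w e : A) : e * X = - (X * e) -> w * e * X = - (w * X * e).
  by move=> E; rewrite -mulrA E mulrN mulrA.
rewrite S !(M _ e3) // S !(M _ e2) // S !(M _ e1) //.
by rewrite -[e0 - _]mul1r S mul1r.
Qed.

Local Notation k1 := (@Ordinal 4 0 isT).
Local Notation k2 := (@Ordinal 4 1 isT).
Local Notation k3 := (@Ordinal 4 2 isT).
Local Notation k4 := (@Ordinal 4 3 isT).

Lemma ord4_cases (k : 'I_4) : [\/ k = k1, k = k2,
  k = k3 | k = k4].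
Proof.
by case: k => [[|[|[|[|k]]]] h] //; [apply: Or41|apply: Or42|apply: Or43|apply: Or44];
  apply: val_inj.
Qed.

Lemma wedge_kill (A : nzRingType) (e0 e1 e2 e3 : A) : e0 * e0 = 0 -> e1 * e1 = 0 ->
  e2 * e2 = 0 -> e3 * e3 = 0 -> e1 * e0 = - (e0 * e1) -> e2 * e0 = - (e0 * e2) -> e3 * e0 = - (e0 * e3) ->
  e2 * e1 = - (e1 * e2) -> e3 * e1 = - (e1 * e3) -> e3 * e2 = - (e2 * e3) ->
  [/\ e0 * e1 * e2 * e3 * e0 = 0, e0 * e1 * e2 * e3 * e1 = 0, e0 * e1 * e2 * e3 * e2 = 0 &
     e0 * e1 * e2 * e3 * e3 = 0].
Proof.
move=> s0 s1 s2 s3 a10 a20 a30 a21 a31 a32.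
have M (w x y : A) : x * y = - (y * x) -> w * x * y = - (w * y * x).
  by move=> E; rewrite -mulrA E mulrN mulrA.
split.
- by rewrite (M _ e3) // (M _ e2) // (M _ e1) // s0 !(mul0r, oppr0).
- by rewrite (M _ e3) // (M _ e2) // -[e0 * e1 * e1]mulrA s1 !(mulr0, mul0r, oppr0).
- by rewrite (M _ e3) // -[e0 * e1 * e2 * e2]mulrA s2 !(mulr0, mul0r, oppr0).
- by rewrite -mulrA s3 mulr0.
Qed.

Lemma kill_sum (K : fieldType) (A : algType K) n (P x : A) (a : 'I_n -> K) (e : 'I_n -> A) :
  (forall k, P * e k = 0) -> P * (x + \sum_k a k *: e k) = P * x.
Proof.
move=> Pe; rewrite mulrDr mulr_sumr big1 ?addr0 // => k _.
by rewrite -scalerAr Pe scaler0.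
Qed.

Lemma prod_seq5 (A : nzRingType) (I : Type) (F : I -> A) (a b c d e : I) :
  \prod_(i <- [:: a; b; c; d; e]) F i = F a * F b * F c * F d * F e.
Proof. by rewrite !big_cons big_nil mulr1 !mulrA. Qed.

Section Coordinates.
Variable R : realType.
Local Notation C := (CC R).
Local Notation pt := 'rV[C]_4.
Implicit Types (z : pt) (u v : 'rV[C]_(6 + 6)).

(** Entries of a row, extended by 0 outside the range, so that the two blocks of
    a row of length 12 can be addressed by k and 6 + k. *)
Definition rc n (u : 'rV[C]_n) (k : nat) : C := oapp (u 0) 0 (insub k).

Lemma rcE n (u : 'rV[C]_n) (i : 'I_n) : rc u i = u 0 i.
Proof. by rewrite /rc valK. Qed.

Lemma rcD n (c : C) (u v : 'rV[C]_n) k : rc (c *: u + v) k = c * rc u k + rc v k.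
Proof. by rewrite /rc; case: insubP => [i _ _|_] /=; rewrite ?mxE // mulr0 addr0. Qed.

Lemma rc_row n (s : nat -> C) k : (k < n)%N -> rc (\row_(i < n) s i) k = s k.
Proof. by move=> kn; rewrite -[k]/(val (Ordinal kn)) rcE mxE. Qed.

Definition p1 (m : nat) : 'I_4 :=
  nth ord0 [:: k1; k1; k1; k2;
               k2; k3] m.
Definition p2 (m : nat) : 'I_4 :=
  nth ord0 [:: k2; k3; k4; k3;
               k4; k4] m.

Definition fe z k : ext R 5 := ext_vec (qfr z k).
Definition qbivec z (c : nat -> C) : ext R 5 :=
  bivec (fe z k1) (fe z k2) (fe z k3)
    (fe z k4) c.

Lemma qbivecE z c : qbivec z c = \sum_(m < 6) c m *: (fe z (p1 m) * fe z (p2 m)).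
Proof. by rewrite !big_ord_recr big_ord0 /= add0r. Qed.

(** The Gram matrices of the frames of Q and of Lambda^2 Q. *)
Definition qdot z (i j : 'I_4) : C := (i == j)%:R - (z 0 i)^* * z 0 j / nrm z.
Definition bigram z (m m' : nat) : C :=
  qdot z (p1 m) (p1 m') * qdot z (p2 m) (p2 m') -
  qdot z (p1 m) (p2 m') * qdot z (p2 m) (p1 m').

Lemma hdot_fe z i j k l : hdot (fe z i * fe z j) (fe z k * fe z l) =
  qdot z i k * qdot z j l - qdot z i l * qdot z j k.
Proof.
by rewrite /qdot -!qfr_dot; exact: (hdot_wedge (qfr z i) (qfr z j) (qfr z k) (qfr z l)).
Qed.

Lemma hdot_qbivec z (c d : nat -> C) : hdot (qbivec z c) (qbivec z d) =
  \sum_(m < 6) \sum_(m' < 6) c m * bigram z m m' * (d m')^*.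
Proof.
rewrite !qbivecE hdot_suml; apply: eq_bigr => m _; rewrite hdotZl hdot_sumr mulr_sumr.
apply: eq_bigr => m' _; rewrite hdotZr hdot_fe.
by rewrite -mulrA [_ ^* * _]mulrC.
Qed.

(** A bivector pair is stored by the coordinates of both members. *)
Definition emb z u : vec R ({set 'I_5} + {set 'I_5})%type :=
  pairv (qbivec z (rc u)) (qbivec z (fun k => rc u (6 + k))).

Lemma emb_lin z (c : C) u v : emb z (c *: u + v) = c *: emb z u + emb z v.
Proof.
have E (x y w : nat -> C) : (forall k, x k = c * y k + w k) ->
  qbivec z x = c *: qbivec z y + qbivec z w.
  move=> xE; rewrite !qbivecE scaler_sumr -big_split; apply: eq_bigr => m _.
  by rewrite xE scalerDl scalerA.
rewrite /emb (E (rc (c *: u + v)) (rc u) (rc v)); last by move=> m; exact: rcD.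
rewrite (E (fun k => rc (c *: u + v) (6 + k)) (fun k => rc u (6 + k)) (fun k => rc v (6 + k))); last by move=> m; exact: rcD.
exact: pairv_lin.
Qed.
HB.instance Definition _ z := GRing.isLinear.Build C 'rV[C]_(6 + 6)
  (vec R ({set 'I_5} + {set 'I_5})%type) *:%R (emb z) (emb_lin z).

Definition Pmx z : 'M[C]_(6 + 6) :=
  block_mx (\matrix_(m, m') bigram z m m') 0 0 (\matrix_(m, m') bigram z m m').

Lemma hdot_emb z u v : hdot (emb z u) (emb z v) = (u *m Pmx z *m v ^h) 0 0.
Proof.
have E (a b : 'rV[C]_6) (P : 'M[C]_6) : (a *m P *m b ^h) 0 0 =
    \sum_(m < 6) \sum_(m' < 6) a 0 m * P m m' * (b 0 m')^*.
  rewrite mxE exchange_big; apply: eq_bigr => m' _.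
  by rewrite !mxE mulr_suml.
transitivity ((lsubmx u *m (\matrix_(m, m') bigram z m m') *m (lsubmx v) ^h +
  rsubmx u *m (\matrix_(m, m') bigram z m m') *m (rsubmx v) ^h) 0 0).
  rewrite /emb hdot_pairv.
  rewrite [RHS]mxE !E.
  apply: (f_equal2 +%R); rewrite hdot_qbivec.
    apply: eq_bigr => m _; apply: eq_bigr => m' _.
    by rewrite !mxE -(rcE u) -(rcE v).
  apply: eq_bigr => m _; apply: eq_bigr => m' _.
  by rewrite !mxE -(rcE u) -(rcE v).
rewrite -[u in RHS]hsubmxK -[v in RHS]hsubmxK /Pmx mul_row_block.
by rewrite !mulmx0 addr0 add0r tr_row_mx map_col_mx mul_row_col.
Qed.

Lemma fe_anti z i j : fe z i * fe z j = - (fe z j * fe z i).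
Proof. exact: ext_vec_anti. Qed.
Lemma fe_sqr z i : fe z i * fe z i = 0.
Proof. exact: ext_vec_sqr. Qed.

Definition qvol z : ext R 5 :=
  fe z k1 * fe z k2 * fe z k3
    * fe z k4.

Lemma qbivec_mul z c d : qbivec z c * qbivec z d = bipair c d *: qvol z.
Proof.
exact: (bivec_mul (fe_sqr z _) (fe_sqr z _) (fe_sqr z _) (fe_sqr z _) (fe_anti z _ _)
  (fe_anti z _ _) (fe_anti z _ _) (fe_anti z _ _) (fe_anti z _ _) (fe_anti z _ _)).
Qed.

(** The product of the projections of e_1, ..., e_4, wedged with a generator X of
    the tautological line, is e_1 /\ ... /\ e_4 /\ X, and X has coefficient 1 on
    e_0. *)
Lemma qvol_neq0 z : qvol z != 0.
Proof.
pose X : ext R 5 := ext_vec (affine_lift ord0 z).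
pose e k : ext R 5 := ext_vec (unitv R (lift ord0 k)).
have feE k : exists c : C, fe z k = e k - c *: X.
  exists (hdot (unitv R (lift ord0 k)) (affine_lift ord0 z) / nrm z).
  by rewrite /fe /qfr /qproj -scaleNr ext_vecD ext_vecZ scaleNr.
have [[c0 E0] [[c1 E1] [[c2 E2] [c3 E3]]]] := conj (feE k1)
  (conj (feE k2) (conj (feE k3) (feE k4))).
have XC k : e k * X = - (X * e k) by exact: ext_vec_anti.
have XX : X * X = 0 by exact: ext_vec_sqr.
pose P := e k1 * e k2 * e k3 * e k4.
have QX : qvol z * X = P * X.
  by rewrite /qvol E0 E1 E2 E3; exact: wedge_shift.
have [|c c_neq0 E] := @ext_basis_prod R 5 [:: lift ord0 k1;
  lift ord0 k2; lift ord0 k3; lift ord0 k4; ord0].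
  by [].
have ea i k : e i * e k = - (e k * e i) by exact: ext_vec_anti.
have es i : e i * e i = 0 by exact: ext_vec_sqr.
have [K0 K1 K2 K3] := @wedge_kill (ext R 5) (e k1) (e k2)
  (e k3) (e k4) (es _) (es _) (es _) (es _) (ea _ _) (ea _ _) (ea _ _)
  (ea _ _) (ea _ _) (ea _ _).
have Pe k : P * e k = 0.
  rewrite /P; have [->|->|->|->] := ord4_cases k.
  - exact: K0.
  - exact: K1.
  - exact: K2.
  - exact: K3.
have PX : P * X = P * ext_vec (unitv R ord0).
  have -> : X = ext_vec (unitv R ord0) + \sum_k z 0 k *: e k.
    rewrite /X hx_sum ext_vecD ext_vec_sum; congr (_ + _).
    by apply: eq_bigr => k _; exact: ext_vecZ.
  exact: kill_sum.
have E' : P * ext_vec (unitv R ord0) = c *: unitv R _ :=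
  etrans (esym (prod_seq5 (fun i => ext_vec (unitv R i) : ext R 5) _ _ _ _ _)) E.
apply: contraNneq c_neq0 => Q0; move: QX; rewrite Q0 mul0r PX E'.
move=> E0'; have := congr1 (fun f : ext R 5 => f [set i in [:: lift ord0 k1;
  lift ord0 k2; lift ord0 k3; lift ord0 k4;
  ord0]]%SET) E0'.
by rewrite /= vec_scaleE unitvE eqxx mulr1 ffunE => <-.
Qed.

End Coordinates.

(** * The monad in coordinates *)

Section Monad.
Variable R : realType.
Local Notation C := (CC R).
Local Notation pt := 'rV[C]_4.
Implicit Types (z : pt) (u v : 'rV[C]_(6 + 6)).

Definition rowl (s : seq C) : 'rV[C]_(6 + 6) := \row_(k < 6 + 6) nth 0 s k.

Lemma rc_rowl s k : (k < 12)%N -> rc (rowl s) k = nth 0 s k.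
Proof. exact: (@rc_row R 12 (nth 0 s)). Qed.

Lemma rowl_surj u : exists x0 x1 x2 x3 x4 x5 x6 x7 x8 x9 x10 x11 : C,
  u = rowl [:: x0; x1; x2; x3; x4; x5; x6; x7; x8; x9; x10; x11].
Proof.
exists (rc u 0), (rc u 1), (rc u 2), (rc u 3), (rc u 4), (rc u 5), (rc u 6), (rc u 7), (rc u 8), (rc u 9), (rc u 10), (rc u 11).
apply/rowP => k; rewrite mxE.
have := rcE u k; case: k => [[|[|[|[|[|[|[|[|[|[|[|[|k]]]]]]]]]]]] h] // <-.
Qed.

(** Row i holds the pair (a_+(e_i), a_-(e_i)); the entries come from
    e_0 = - (z_1 e_1 + ... + z_4 e_4) in Q. *)
Definition coordA z (i : nat) : seq C :=
  let z1 := z 0 k1 in let z2 := z 0 k2 in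
  let z3 := z 0 k3 in let z4 := z 0 k4 in
  nth [::]
  [:: [:: 0; 0; 0; 1; 0; 0;      0; 0; 1; 0; 0; 0];
      [:: 0; 0; 0; 0; 0; 1;      z1; 0; 0; - z3; - z4; 0];
      [:: 0; 0; z1; 0; z2; z3;   0; -1; 0; 0; 0; 0];
      [:: z2; z3; z4; 0; 0; 0;   0; 0; 0; 0; -1; 0];
      [:: 1; 0; 0; 0; 0; 0;      0; - z1; 0; - z2; 0; z4]] i.

(** The determinant of the cyclic system that remains after eliminating eight of
    the coordinates of an element of ker b. *)
Definition disc z : C := 1 - z 0 k1 * z 0 k2 *
  z 0 k3 * z 0 k4.

(** Two polynomial solutions of b = 0 that complete the rows of A to a basis of
    the kernel.  The first one is 21 T_1 - 10 A_2 + 4 A_4, where T_1 is a solution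
    with smaller entries: at (2, 0, 0, 0) this combination is orthogonal to the
    rows of A and to the second row. *)
Definition coordT z (i : nat) : seq C :=
  let z1 := z 0 k1 in let z2 := z 0 k2 in
  let z3 := z 0 k3 in let z4 := z 0 k4 in
  let d := disc z in
  nth [::]
  [:: [:: 4; - (21 * (z2 * z2 + z1 * z2 * z3 * z3)); 21 * d - 10 * z1; 0;
          - (21 * (z3 * z3 + z2 * z2 * z3 * z4)) - 10 * z2; - (10 * z3);
          - (21 * (z3 + z2 * z2 * z4)); 10 - 4 * z1; 0; - (4 * z2); 0;
          4 * z4 - 21 * (z2 + z1 * z3 * z3)];
      [:: 0; z4 + z1 * z1 * z2; 0; 0; z1 + z3 * z4 * z4; 0;
          z4 * z4 + z1 * z1 * z2 * z4; 0; 0; d; 0; z1 * z1 + z1 * z3 * z4 * z4]] i.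

Definition Amx z : 'M[C]_(5, 6 + 6) := \matrix_(i, k) nth 0 (coordA z i) k.
Definition Tmx z : 'M[C]_(2, 6 + 6) := \matrix_(i, k) nth 0 (coordT z i) k.

(** The monad map b, read off coordinatewise, is the symplectic pairing with
    the rows of A. *)
Definition bform (c d : nat -> C) : C :=
  bipair c (fun k => d (6 + k)) - bipair (fun k => c (6 + k)) d.

Lemma bform_A z (i j : 'I_5) : bform (nth 0 (coordA z i)) (nth 0 (coordA z j)) = 0.
Proof.
rewrite /bform /bipair /coordA.
case: i => [[|[|[|[|[|i]]]]] hi] //; case: j => [[|[|[|[|[|j]]]]] hj] //=; ring.
Qed.

Lemma bform_T z (i : 'I_2) (j : 'I_5) : bform (nth 0 (coordT z i)) (nth 0 (coordA z j)) = 0.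
Proof.
rewrite /bform /bipair /coordA /coordT /disc.
case: i => [[|[|i]] hi] //; case: j => [[|[|[|[|[|j]]]]] hj] //=; ring.
Qed.

Lemma combE z (al : 'rV[C]_5) (be : 'rV[C]_2) (a0 a1 a2 a3 a4 b0 b1 : C) k :
  al = \row_i nth 0 [:: a0; a1; a2; a3; a4] i -> be = \row_i nth 0 [:: b0; b1] i ->
  (al *m Amx z + be *m Tmx z) 0 k = a0 * nth 0 (coordA z 0) k + a1 * nth 0 (coordA z 1) k +
   a2 * nth 0 (coordA z 2) k + a3 * nth 0 (coordA z 3) k + a4 * nth 0 (coordA z 4) k +
   b0 * nth 0 (coordT z 0) k + b1 * nth 0 (coordT z 1) k.
Proof.
move=> -> ->; rewrite !mxE !big_ord_recl !big_ord0 !mxE; rewrite /=; ring.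
Qed.

(** Five of the twelve coordinates determine the multiples of the rows of A and
    two more those of the rows of T; the equations b = 0 express the others. *)
Lemma kernel_span z u : disc z != 0 ->
  (forall i : 'I_5, bform (rc u) (nth 0 (coordA z i)) = 0) ->
  exists al be, u = al *m Amx z + be *m Tmx z.
Proof.
have [x0 [x1 [x2 [x3 [x4 [x5 [x6 [x7 [x8 [x9 [x10 [x11 ->]]]]]]]]]]]] := rowl_surj u.
move=> d0 B.
have e0 := B ord0; have e1 := B (lift ord0 ord0); have e2 := B (lift ord0 (lift ord0 ord0)).
have e3 := B (lift ord0 (lift ord0 (lift ord0 ord0))).
have e4 := B (lift ord0 (lift ord0 (lift ord0 (lift ord0 ord0)))).
move: e0 e1 e2 e3 e4 {B}; rewrite /bform /bipair !rc_rowl // /coordA /=.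
rewrite !(mul0r, mulr0, mulr1, add0r, addr0, subr0, sub0r, oppr0, mulrN, mulNr, opprK).
have dE : disc z = 1 - z 0 k1 * z 0 k2 *
  z 0 k3 * z 0 k4 by [].
set d := disc z in d0 dE.
have CA : coordA z = _ := erefl; have CT : coordT z = _ := erefl.
move: CA CT; rewrite {2}/coordA {2}/coordT -/d.
move: (z 0 k1) (z 0 k2) (z 0 k3)
  (z 0 k4) dE => z1 z2 z3 z4 dE CA CT e0 e1 e2 e3 e4.
have E0 : x3 = x8 by apply/eqP; rewrite -subr_eq0; apply/eqP; move: e0 => <-; ring.
clearbody d; subst d; move: d0; set d := 1 - z1 * z2 * z3 * z4 => d0.
pose a1 := (x5 + z3 * x7 + z1 * z3 * x0 + z1 * z2 * z3 * x10) / d.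
pose a3 := - x10 - z4 * a1.
pose a4 := x0 - z2 * a3.
pose a2 := - x7 - z1 * a4.
pose b0 := (x2 - z1 * a2 - z4 * a3) / d.
pose b1 := (x9 + z3 * a1 + z2 * a4) / d.
(* The entries left over satisfy a cyclic system with determinant d. *)
have cyc y1 y4 y6 y11 : y4 = z3 * y6 -> y6 = z4 * y1 -> y1 = z2 * y11 -> y11 = z1 * y4 ->
    [/\ y1 = 0, y4 = 0, y6 = 0 & y11 = 0].
  move=> E4 E6 E1 E11.
  have y40 : y4 = 0.
    apply/eqP; rewrite -(mulrI_eq0 _ (mulfI d0)); apply/eqP.
    rewrite /d mulrBl mul1r {1}E4 E6 E1 E11; ring.
  by rewrite y40 mulr0 in E11; rewrite E11 mulr0 in E1; rewrite E1 mulr0 in E6.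
pose al : 'rV[C]_5 := \row_i nth 0 [:: x8; a1; a2 + 10 * (b0 / 21); a3; a4 - 4 * (b0 / 21)] i.
pose be : 'rV[C]_2 := \row_i nth 0 [:: b0 / 21; b1] i.
have n21 : (21 : C) != 0 by rewrite pnatr_eq0.
have F := @combE z al be _ _ _ _ _ _ _ _ erefl erefl.
have E1 : x6 = x1 * z4 - x2 * z3 + x5 * z1 by apply/esym/eqP; rewrite -subr_eq0 e1.
have E2 : x4 = x6 * z3 - x7 * z2 + x9 * z1 by apply/eqP; rewrite -subr_eq0 e2.
have E3 : x1 = x9 * z4 - x10 * z3 + x11 * z2 by apply/eqP; rewrite -subr_eq0 e3.
have E4 : x11 = x0 * z4 - x2 * z2 + x4 * z1 by apply/esym/eqP; rewrite -subr_eq0 e4.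
pose w k := (al *m Amx z + be *m Tmx z) 0 k.
have G (k : nat) (h : (k < 12)%N) : w (Ordinal h) = x8 * nth 0 (coordA z 0) k +
   a1 * nth 0 (coordA z 1) k + (a2 + 10 * (b0 / 21)) * nth 0 (coordA z 2) k +
   a3 * nth 0 (coordA z 3) k + (a4 - 4 * (b0 / 21)) * nth 0 (coordA z 4) k +
   b0 / 21 * nth 0 (coordT z 0) k + b1 * nth 0 (coordT z 1) k by exact: F.
rewrite CA CT in G.
have [c1 c4 c6 c11] : [/\ x1 - w (@Ordinal 12 1 isT) = 0, x4 - w (@Ordinal 12 4 isT) = 0,
    x6 - w (@Ordinal 12 6 isT) = 0 & x11 - w (@Ordinal 12 11 isT) = 0].
  apply: cyc; rewrite !G /=.
  - rewrite E2 /b1 /b0 /a2 /a4 /a3 /a1 /d; field; exact: d0.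
  - rewrite E1 /b1 /b0 /a2 /a4 /a3 /a1 /d; field; exact: d0.
  - rewrite E3 /b1 /b0 /a2 /a4 /a3 /a1 /d; field; exact: d0.
  - rewrite E4 /b1 /b0 /a2 /a4 /a3 /a1 /d; field; exact: d0.
exists al, be; apply/rowP => k; rewrite mxE.
rewrite -/(w k).
have last4 (m : nat) (h : (m < 12)%N) (h' : (m < 12)%N) (y : C) : y - w (@Ordinal 12 m h') = 0 ->
    y = w (@Ordinal 12 m h).
  by move/eqP; rewrite subr_eq0 => /eqP ->; congr w; apply: val_inj.
case: k => [[|[|[|[|[|[|[|[|[|[|[|[|k]]]]]]]]]]]] h] //=;
  first [exact: (last4 _ _ _ _ c1) | exact: (last4 _ _ _ _ c4) | exact: (last4 _ _ _ _ c6)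
    | exact: (last4 _ _ _ _ c11)
    | rewrite G /= ?E0 /b1 /b0 /a2 /a4 /a3 /a1 /d; field; exact: d0].
Qed.

Lemma kernel_indep z (al : 'rV[C]_5) (be : 'rV[C]_2) : disc z != 0 ->
  al *m Amx z + be *m Tmx z = 0 -> al = 0 /\ be = 0.
Proof.
move=> d0 E.
have alE : al = \row_i nth 0 [:: rc al 0; rc al 1; rc al 2; rc al 3; rc al 4] i.
  apply/rowP => k; rewrite mxE -rcE.
  by case: k => [[|[|[|[|[|k]]]]] h].
have beE : be = \row_i nth 0 [:: rc be 0; rc be 1] i.
  by apply/rowP => k; rewrite mxE -rcE; case: k => [[|[|k]] h].
have F := combE z _ alE beE; rewrite E in F.
have G (k : nat) (h : (k < 12)%N) := F (Ordinal h).
have [[e9 e2] [[e10 e7] [e0 [e5 e8]]]] := conj (conj (G 9%N isT) (G 2%N isT))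
  (conj (conj (G 10%N isT) (G 7%N isT)) (conj (G 0%N isT) (conj (G 5%N isT) (G 8%N isT)))).
rewrite [X in X = 0 /\ _]alE [X in _ /\ X = 0]beE; move: e9 e2 e10 e7 e0 e5 e8.
rewrite {alE beE F G E} !mxE /=.
move: (rc al 0) (rc al 1) (rc al 2) (rc al 3) (rc al 4) (rc be 0) (rc be 1).
move: d0; rewrite {1}/disc; set d := disc z; have dE : d = disc z by [].
rewrite /disc in dE; move: dE; clearbody d.
move: (z 0 k1) (z 0 k2) (z 0 k3)
  (z 0 k4) => z1 z2 z3 z4 dE; rewrite -dE => d0 a0 a1 a2 a3 a4 b0 b1.
move=> e9 e2 e10 e7 e0 e5 e8.
have n21 : (21 : C) != 0 by rewrite pnatr_eq0.
have A0 : a0 = 0 by rewrite [RHS]e8; ring.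
have sub0 (x y : C) : 0 = x - y -> x = y by move/esym/eqP; rewrite subr_eq0 => /eqP.
have h5 : a1 = - z3 * (a2 - 10 * b0) by apply: sub0; rewrite [LHS]e5; ring.
have h7 : a2 - 10 * b0 = - z1 * (a4 + 4 * b0) by apply/esym/sub0; rewrite [LHS]e7; ring.
have h0 : a4 + 4 * b0 = - z2 * a3 by apply: sub0; rewrite [LHS]e0; ring.
have h10 : a3 = - z4 * a1 by apply/esym/sub0; rewrite [LHS]e10; ring.
have A1 : a1 = 0.
  by apply: (mulfI d0); rewrite mulr0 dE mulrBl mul1r {1}h5 h7 h0 h10; ring.
have A3 : a3 = 0 by rewrite h10 A1 mulr0.
have A4 : a4 = - (4 * b0) by apply/eqP; rewrite -addr_eq0 h0 A3 mulr0.
have A2 : a2 = 10 * b0 by apply/eqP; rewrite -subr_eq0 h7 h0 A3 !mulr0.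
have B0 : b0 = 0.
  apply: (mulfI d0); apply: (mulfI n21); rewrite !mulr0 [RHS]e2 A0 A1 A2 A3 A4; ring.
have B1 : b1 = 0.
  apply: (mulfI d0); rewrite !mulr0 [RHS]e9 A0 A1 A2 A3 A4 B0; ring.
rewrite A4 A2 A0 A1 A3 B1 B0 !mulr0 oppr0; split; apply/rowP => k; rewrite !mxE.
  by case: k => [[|[|[|[|[|k]]]]] h].
by case: k => [[|[|k]] h].
Qed.

End Monad.

Section MonadBivectors.
Variables (K : fieldType) (A : algType K) (f0 f1 f2 f3 : A) (z1 z2 z3 z4 : K).
Hypotheses (s0 : f0 * f0 = 0) (s1 : f1 * f1 = 0) (s2 : f2 * f2 = 0) (s3 : f3 * f3 = 0)
  (a10 : f1 * f0 = - (f0 * f1)) (a20 : f2 * f0 = - (f0 * f2)) (a30 : f3 * f0 = - (f0 * f3))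
  (a21 : f2 * f1 = - (f1 * f2)) (a31 : f3 * f1 = - (f1 * f3)) (a32 : f3 * f2 = - (f2 * f3)).
Let e0 := - (z1 *: f0 + (z2 *: f1 + (z3 *: f2 + z4 *: f3))).
Let bv s := bivec f0 f1 f2 f3 (nth 0 s).

(** The products e_(i+2) e_(i+3) for i = 0, ..., 4, with e_0 rewritten in the
    frame; they are the first halves of the rows of A. *)
Lemma bv_pos : [/\ f1 * f2 = bv [:: 0; 0; 0; 1; 0; 0], f2 * f3 = bv [:: 0; 0; 0; 0; 0; 1],
  f3 * e0 = bv [:: 0; 0; z1; 0; z2; z3], e0 * f0 = bv [:: z2; z3; z4; 0; 0; 0] &
  f0 * f1 = bv [:: 1; 0; 0; 0; 0; 0]].
Proof.
rewrite /bv /bivec /e0 /= !(scale0r, scale1r, add0r, addr0); split=> //.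
  rewrite mulrN !mulrDr -!scalerAr s3 a30 a31 a32 !scalerN scaler0 addr0 !opprD !opprK.
  by rewrite !addrA.
rewrite mulNr !mulrDl -!scalerAl s0 a10 a20 a30 !scalerN scaler0 add0r !opprD !opprK.
by rewrite !addrA.
Qed.

(** Likewise the products e_(i+1) e_(i+4), the second halves of the rows of A. *)
Lemma bv_neg : [/\ f0 * f3 = bv [:: 0; 0; 1; 0; 0; 0], f1 * e0 = bv [:: z1; 0; 0; - z3; - z4; 0],
  f2 * f0 = bv [:: 0; -1; 0; 0; 0; 0], f3 * f1 = bv [:: 0; 0; 0; 0; -1; 0] &
  e0 * f2 = bv [:: 0; - z1; 0; - z2; 0; z4]].
Proof.
rewrite /bv /bivec /e0 /= !(scale0r, scale1r, scaleN1r, add0r, addr0); split=> //.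
  rewrite mulrN !mulrDr -!scalerAr s1 a10 !scalerN scaler0 add0r !opprD !opprK !scaleNr.
  by rewrite !addrA.
rewrite mulNr !mulrDl -!scalerAl s2 a32 !scalerN scaler0 add0r !opprD !opprK !scaleNr.
by rewrite !addrA.
Qed.

End MonadBivectors.

Lemma sum_ord4 (V : nmodType) (F : 'I_4 -> V) : \sum_k F k =
  F k1 + (F k2 + (F k3 + F k4)).
Proof.
rewrite !big_ord_recl big_ord0 addr0.
by do 3?[congr (_ + _)]; congr F; apply: val_inj.
Qed.

Section Pairs.
Variables (R : realType) (I J : finType).
Implicit Types (a : vec R I) (b : vec R J) (w : vec R (I + J)%type).
Lemma fstv_pair a b : fstv (pairv a b) = a.
Proof. by apply/ffunP => i; rewrite !ffunE. Qed.
Lemma sndv_pair a b : sndv (pairv a b) = b.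
Proof. by apply/ffunP => i; rewrite !ffunE. Qed.
Lemma pairv_eta w : w = pairv (fstv w) (sndv w).
Proof. by apply/ffunP => -[i|j]; rewrite !ffunE. Qed.
End Pairs.

Lemma pairv_sum (R : realType) (I J : finType) n (c : 'I_n -> CC R) (a : 'I_n -> vec R I)
    (b : 'I_n -> vec R J) :
  pairv (\sum_i c i *: a i) (\sum_i c i *: b i) = \sum_i c i *: pairv (a i) (b i).
Proof.
elim: n c a b => [|n IH] c a b.
  by rewrite !big_ord0; apply/ffunP => -[k|k]; rewrite !ffunE.
by rewrite !big_ord_recl -IH -pairv_lin.
Qed.

Lemma bform_comb_sum (K : fieldType) (A : algType K) n (x y : A) (c : 'I_n -> K)
    (a b : 'I_n -> A) :
  - (x * \sum_i c i *: a i) + y * \sum_i c i *: b i = \sum_i c i *: (- (x * a i) + y * b i).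
Proof.
rewrite !mulr_sumr -sumrN -big_split; apply: eq_bigr => i _ /=.
by rewrite scalerDr scalerN !scalerAr.
Qed.

Lemma bform_comb (K : pzRingType) (V : lmodType K) (c a b : K) (w : V) :
  c *: (- (a *: w) + b *: w) = (c * (b - a)) *: w.
Proof. by rewrite -scaleNr -scalerDl scalerA addrC. Qed.

Section MonadMaps.
Variable R : realType.
Local Notation C := (CC R).
Local Notation pt := 'rV[C]_4.
Implicit Types (z : pt) (u : 'rV[C]_(6 + 6)) (v : vec R 'I_5).

Definition egen z (j : 'I_5) : ext R 5 := ext_vec (euler_proj (chart ord0 z) (unitv R j)).

Lemma egenS z k : egen z (lift ord0 k) = fe z k.
Proof. by rewrite /egen euler_projE. Qed.

Lemma egen0 z : egen z ord0 = - (z 0 k1 *: fe z k1 +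
  (z 0 k2 *: fe z k2 +
  (z 0 k3 *: fe z k3 +
   z 0 k4 *: fe z k4))).
Proof.
rewrite /egen euler_projE qproj_e0 -scaleN1r ext_vecZ scaleN1r ext_vec_sum; congr (- _).
rewrite -(sum_ord4 (fun k => z 0 k *: fe z k)); apply: eq_bigr => k _; exact: ext_vecZ.
Qed.

Lemma ext2_proj_lin p (c : C) (x y : ext R 5) :
  ext2_proj p (c *: x + y) = c *: ext2_proj p x + ext2_proj p y.
Proof. exact: ext_map_lin. Qed.
HB.instance Definition _ p := GRing.isLinear.Build C (ext R 5) (ext R 5) *:%R
  (ext2_proj p) (ext2_proj_lin p).

Lemma ext2_proj_basis z i j :
  ext2_proj (chart ord0 z) (wedge (basis_ext R i) (basis_ext R j)) = egen z i * egen z j.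
Proof. exact: ext_map_vec2. Qed.

Lemma ext2_proj_sum z (v : vec R 'I_5) (b1 b2 : 'I_5 -> 'I_5) :
  ext2_proj (chart ord0 z) (\sum_i v i *: wedge (basis_ext R (b1 i)) (basis_ext R (b2 i))) =
  \sum_i v i *: (egen z (b1 i) * egen z (b2 i)).
Proof.
rewrite linear_sum; apply: eq_bigr => i _; rewrite linearZ; congr (_ *: _).
exact: ext2_proj_basis.
Qed.

Lemma qbivec_ext z (c d : nat -> C) : (forall k, (k < 6)%N -> c k = d k) ->
  qbivec z c = qbivec z d.
Proof. by move=> cd; rewrite !qbivecE; apply: eq_bigr => k _; rewrite cd. Qed.

Lemma egen_mulE z (i i' j j' : 'I_5) (x y : ext R 5) (c d : nat -> C) : i = i' -> j = j' ->
  egen z i' = x -> egen z j' = y -> x * y = qbivec z c -> (forall k, (k < 6)%N -> c k = d k) ->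
  egen z i * egen z j = qbivec z d.
Proof.
by move=> -> -> -> -> -> /qbivec_ext ->.
Qed.

Lemma egen_pos z (i : 'I_5) : egen z (i + 2) * egen z (i + 3) = qbivec z (nth 0 (coordA z i)).
Proof.
have [b0 b1 b2 b3 b4] := bv_pos (z 0 k1) (z 0 k2)
  (z 0 k3) (z 0 k4) (fe_sqr z k1)
  (fe_sqr z k4) (fe_anti z k2 k1)
  (fe_anti z k3 k1) (fe_anti z k4 k1)
  (fe_anti z k4 k2) (fe_anti z k4 k3).
move: b0 b1 b2 b3 b4; case: i => [[|[|[|[|[|i]]]]] hi] b0 b1 b2 b3 b4; last exact: False_ind (notF hi).
- apply: (egen_mulE _ _ (egenS z k2)
    (egenS z k3) b0); [exact: val_inj|exact: val_inj|by case=> [|[|[|[|[|[|]]]]]]].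
- apply: (egen_mulE _ _ (egenS z k3)
    (egenS z k4) b1); [exact: val_inj|exact: val_inj|by case=> [|[|[|[|[|[|]]]]]]].
- apply: (egen_mulE _ _ (egenS z k4)
    (egen0 z) b2); [exact: val_inj|exact: val_inj|by case=> [|[|[|[|[|[|]]]]]]].
- apply: (egen_mulE _ _ (egen0 z)
    (egenS z k1) b3); [exact: val_inj|exact: val_inj|by case=> [|[|[|[|[|[|]]]]]]].
- apply: (egen_mulE _ _ (egenS z k1)
    (egenS z k2) b4); [exact: val_inj|exact: val_inj|by case=> [|[|[|[|[|[|]]]]]]].
Qed.

Lemma egen_neg z (i : 'I_5) :
  egen z (i + 1) * egen z (i + 4) = qbivec z (fun k => nth 0 (coordA z i) (6 + k)).
Proof.
have [b0 b1 b2 b3 b4] := bv_neg (z 0 k1) (z 0 k2)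
  (z 0 k3) (z 0 k4) (fe_sqr z k2)
  (fe_sqr z k3) (fe_anti z k2 k1)
  (fe_anti z k3 k1) (fe_anti z k4 k2)
  (fe_anti z k4 k3).
move: b0 b1 b2 b3 b4; case: i => [[|[|[|[|[|i]]]]] hi] b0 b1 b2 b3 b4; last exact: False_ind (notF hi).
- apply: (egen_mulE _ _ (egenS z k1)
    (egenS z k4) b0); [exact: val_inj|exact: val_inj|by case=> [|[|[|[|[|[|]]]]]]].
- apply: (egen_mulE _ _ (egenS z k2)
    (egen0 z) b1); [exact: val_inj|exact: val_inj|by case=> [|[|[|[|[|[|]]]]]]].
- apply: (egen_mulE _ _ (egenS z k3)
    (egenS z k1) b2); [exact: val_inj|exact: val_inj|by case=> [|[|[|[|[|[|]]]]]]].
- apply: (egen_mulE _ _ (egenS z k4)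
    (egenS z k2) b3); [exact: val_inj|exact: val_inj|by case=> [|[|[|[|[|[|]]]]]]].
- apply: (egen_mulE _ _ (egen0 z)
    (egenS z k3) b4); [exact: val_inj|exact: val_inj|by case=> [|[|[|[|[|[|]]]]]]].
Qed.

Lemma ext2_proj_pos z v : ext2_proj (chart ord0 z) (aplus v) =
  \sum_i v i *: qbivec z (nth 0 (coordA z i)).
Proof.
by rewrite /aplus ext2_proj_sum; apply: eq_bigr => i _; rewrite egen_pos.
Qed.

Lemma ext2_proj_neg z v : ext2_proj (chart ord0 z) (aminus v) =
  \sum_i v i *: qbivec z (fun k => nth 0 (coordA z i) (6 + k)).
Proof.
by rewrite /aminus ext2_proj_sum; apply: eq_bigr => i _; rewrite egen_neg.
Qed.

Lemma rc_Amx z (i : 'I_5) k : (k < 12)%N -> rc (row i (Amx z)) k = nth 0 (coordA z i) k.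
Proof.
by move=> kn; rewrite -[k]/(val (@Ordinal 12 k kn)) (@rcE R 12) !mxE.
Qed.

Lemma emb_Amx z (i : 'I_5) : emb z (row i (Amx z)) =
  pairv (qbivec z (nth 0 (coordA z i))) (qbivec z (fun k => nth 0 (coordA z i) (6 + k))).
Proof.
have E1 : qbivec z (rc (row i (Amx z))) = qbivec z (nth 0 (coordA z i)).
  by apply: qbivec_ext => k k6; rewrite rc_Amx // (ltn_trans k6).
have E2 : qbivec z (fun k => rc (row i (Amx z)) (6 + k)) =
    qbivec z (fun k => nth 0 (coordA z i) (6 + k)).
  by apply: qbivec_ext => k k6; rewrite rc_Amx // -[12%N]/(6 + 6)%N ltn_add2l.
by rewrite /emb E1 E2.
Qed.

Lemma amapE z v : amap (chart ord0 z) v = emb z ((\row_i v i) *m Amx z).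
Proof.
transitivity (\sum_i v i *: emb z (row i (Amx z))); last first.
  rewrite mulmx_sum_row linear_sum; apply: eq_bigr => i _; rewrite mxE; exact/esym/linearZ.
transitivity (pairv (\sum_i v i *: qbivec z (nth 0 (coordA z i)))
   (\sum_i v i *: qbivec z (fun k => nth 0 (coordA z i) (6 + k)))).
  exact: (f_equal2 (@pairv R _ _) (ext2_proj_pos z v) (ext2_proj_neg z v)).
rewrite pairv_sum; apply: eq_bigr => i _; exact: (congr1 _ (esym (emb_Amx z i))).
Qed.

Lemma bmapE z u v : bmap (chart ord0 z) (emb z u) v =
  (\sum_i v i * bform (rc u) (nth 0 (coordA z i))) *: qvol z.
Proof.
have fstE : fstv (emb z u) = qbivec z (rc u) := fstv_pair _ _.
have sndE : sndv (emb z u) = qbivec z (fun k => rc u (6 + k)) := sndv_pair _ _.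
transitivity (- (qbivec z (fun k => rc u (6 + k)) * \sum_i v i *: qbivec z (nth 0 (coordA z i)))
    + qbivec z (rc u) * \sum_i v i *: qbivec z (fun k => nth 0 (coordA z i) (6 + k))).
  have := f_equal2 (fun x y : ext R 5 => - x + y)
    (f_equal2 (@wedge R 5) sndE (ext2_proj_pos z v)) (f_equal2 (@wedge R 5) fstE (ext2_proj_neg z v)).
  exact.
rewrite bform_comb_sum scaler_suml; apply: eq_bigr => i _.
rewrite -bform_comb; exact: (f_equal2 (fun x y : ext R 5 => v i *: (- x + y))
  (qbivec_mul z _ _) (qbivec_mul z _ _)).
Qed.

End MonadMaps.

(** * The fibres of E(-2) *)

Section VectorWedge.
Variables (K : fieldType) (A : algType K) (f0 f1 f2 f3 : A).
Hypotheses (s0 : f0 * f0 = 0) (s1 : f1 * f1 = 0) (s2 : f2 * f2 = 0) (s3 : f3 * f3 = 0)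
  (a10 : f1 * f0 = - (f0 * f1)) (a20 : f2 * f0 = - (f0 * f2)) (a30 : f3 * f0 = - (f0 * f3))
  (a21 : f2 * f1 = - (f1 * f2)) (a31 : f3 * f1 = - (f1 * f3)) (a32 : f3 * f2 = - (f2 * f3)).

Lemma wedge_vectors (c0 c1 c2 c3 d0 d1 d2 d3 : K) :
  (c0 *: f0 + (c1 *: f1 + (c2 *: f2 + c3 *: f3))) *
  (d0 *: f0 + (d1 *: f1 + (d2 *: f2 + d3 *: f3))) =
  bivec f0 f1 f2 f3 (nth 0 [:: c0 * d1 - c1 * d0; c0 * d2 - c2 * d0; c0 * d3 - c3 * d0;
    c1 * d2 - c2 * d1; c1 * d3 - c3 * d1; c2 * d3 - c3 * d2]).
Proof.
rewrite !mulrDl !mulrDr -!(scalerAl, scalerAr) s0 s1 s2 s3 a10 a20 a30 a21 a31 a32.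
rewrite !scaler0 !scalerN !scalerA /bivec /= !scalerBl !add0r addr0.
by rewrite !addrA [LHS](ACl (1*4*2*7*3*10*5*8*6*11*9*12)).
Qed.

End VectorWedge.

Section Fibres.
Variable R : realType.
Local Notation C := (CC R).
Local Notation pt := 'rV[C]_4.
Implicit Types (z : pt) (u : 'rV[C]_(6 + 6)).

(** The pairing of bivectors is nondegenerate, so a bivector with zero image has
    zero coefficients. *)
Lemma emb_inj z u : emb z u = 0 -> u = 0.
Proof.
move=> E.
have E1 : qbivec z (rc u) = 0 by rewrite -(fstv_pair (qbivec z (rc u)) (qbivec z (fun k => rc u (6 + k)))) -/(emb z u) E; apply/ffunP => S; rewrite !ffunE.
have E2 : qbivec z (fun k => rc u (6 + k)) = 0 by rewrite -(sndv_pair (qbivec z (rc u)) (qbivec z (fun k => rc u (6 + k)))) -/(emb z u) E; apply/ffunP => S; rewrite !ffunE.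
have Z (c : nat -> C) : qbivec z c = 0 -> forall k, (k < 6)%N -> c k = 0.
  move=> c0 k k6.
  have P (d : nat -> C) : bipair c d = 0.
    have := qbivec_mul z c d; rewrite c0 mul0r => /esym/eqP.
    by rewrite scaler_eq0 (negPf (qvol_neq0 z)) orbF => /eqP.
  pose e j : nat -> C := nth 0 (ncons j 0 [:: 1]).
  case: k k6 => [|[|[|[|[|[|k]]]]]] // _; [have := P (e 5%N)|have := P (e 4%N)
    |have := P (e 3%N)|have := P (e 2%N)|have := P (e 1%N)|have := P (e 0%N)];
    rewrite /bipair /e /= !(mulr0, mulr1, subr0, oppr0, addr0, add0r, sub0r) => // /eqP;
    by rewrite oppr_eq0 => /eqP.
apply/rowP => k; rewrite mxE -rcE.
case: (ltnP k 6) => k6; first exact: (Z _ E1).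
rewrite -(subnKC k6); apply: (Z _ E2).
by rewrite -(ltn_add2l 6) subnKC //; exact: (ltn_ord k).
Qed.

Lemma qdot_conj z i j : (qdot z i j)^* = qdot z j i.
Proof.
rewrite /qdot rmorphB rmorph_nat fmorph_div rmorphM /= conjCK nrm_real eq_sym.
by rewrite [z 0 i * _]mulrC.
Qed.

Lemma bigram_conj z m m' : (bigram z m m')^* = bigram z m' m.
Proof.
rewrite /bigram rmorphB !rmorphM /= !qdot_conj; congr (_ - _); exact: mulrC.
Qed.

Lemma conjT_mul m n p (X : 'M[C]_(m, n)) (Y : 'M[C]_(n, p)) : (X *m Y) ^h = Y ^h *m X ^h.
Proof. by rewrite trmx_mul map_mxM. Qed.

Lemma conjTK m n (X : 'M[C]_(m, n)) : X ^h ^h = X.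
Proof. by apply/matrixP => i j; rewrite !mxE conjCK. Qed.

Lemma Pmx_herm z : (Pmx z) ^h = Pmx z.
Proof.
rewrite /Pmx tr_block_mx map_block_mx !trmx0 !map_mx0; congr block_mx;
  by apply/matrixP => i j; rewrite !mxE bigram_conj.
Qed.

Definition herm m n z (X : 'M[C]_(m, 6 + 6)) (Y : 'M[C]_(n, 6 + 6)) := X *m Pmx z *m Y ^h.

Lemma herm_conj m n z (X : 'M[C]_(m, 6 + 6)) (Y : 'M[C]_(n, 6 + 6)) :
  (herm z X Y) ^h = herm z Y X.
Proof. by rewrite /herm !conjT_mul conjTK Pmx_herm mulmxA. Qed.

Lemma herm_mull k m n z (Z : 'M[C]_(k, m)) (X : 'M[C]_(m, 6 + 6)) (Y : 'M[C]_(n, 6 + 6)) :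
  herm z (Z *m X) Y = Z *m herm z X Y.
Proof. by rewrite /herm -!mulmxA. Qed.

Lemma herm_mulr k m n z (Z : 'M[C]_(k, n)) (X : 'M[C]_(m, 6 + 6)) (Y : 'M[C]_(n, 6 + 6)) :
  herm z X (Z *m Y) = herm z X Y *m Z ^h.
Proof. by rewrite /herm conjT_mul !mulmxA. Qed.

Lemma herm_addl m n z (X X' : 'M[C]_(m, 6 + 6)) (Y : 'M[C]_(n, 6 + 6)) :
  herm z (X + X') Y = herm z X Y + herm z X' Y.
Proof. by rewrite /herm !mulmxDl. Qed.

Lemma herm_row m n z (X : 'M[C]_(m, 6 + 6)) (Y : 'M[C]_(n, 6 + 6)) i j :
  herm z X Y i j = hdot (emb z (row i X)) (emb z (row j Y)).
Proof.
rewrite hdot_emb -!row_mul !mxE; apply: eq_bigr => k _; by rewrite !mxE.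
Qed.

Lemma herm_def z u : herm z u u = 0 -> u = 0.
Proof.
move=> E; apply/(@emb_inj z)/hdot_eq0; rewrite hdot_emb.
by move: E; rewrite /herm => ->; rewrite mxE.
Qed.

Lemma unit_of_inj n (G : 'M[C]_n) : (forall v : 'rV_n, v *m G = 0 -> v = 0) -> G \in unitmx.
Proof. by move=> inj; rewrite -row_free_unit; apply: inj_row_free. Qed.

Definition Gmx z := herm z (Amx z) (Amx z).
Definition Wmx z := herm z (Tmx z) (Amx z).
Definition TTmx z := herm z (Tmx z) (Tmx z).
Definition Cmx z : 'M[C]_(2, 5) := Wmx z *m invmx (Gmx z).
(** The component of T orthogonal to the image of a: the rows represent the
    classes of the rows of T in ker b / im a. *)
Definition Smx z : 'M[C]_(2, 6 + 6) := Tmx z - Cmx z *m Amx z.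

Lemma Gmx_unit z : disc z != 0 -> Gmx z \in unitmx.
Proof.
move=> d0; apply: unit_of_inj => v E.
have vA : v *m Amx z = 0.
  by apply: (@herm_def z); rewrite herm_mull herm_mulr -/(Gmx z) mulmxA E mul0mx.
by have [] := @kernel_indep _ z v 0 d0; rewrite ?mul0mx ?addr0.
Qed.

Lemma Smx_orth z : disc z != 0 -> herm z (Smx z) (Amx z) = 0.
Proof.
move=> d0; rewrite herm_addl -mulNmx herm_mull -/(Gmx z) -/(Wmx z) mulNmx.
by rewrite mulmxKV ?Gmx_unit // subrr.
Qed.

Lemma Smx_gram z : disc z != 0 ->
  herm z (Smx z) (Smx z) = TTmx z - Wmx z *m invmx (Gmx z) *m (Wmx z) ^h.
Proof.
move=> d0; rewrite -[LHS](herm_conj z) herm_addl -mulNmx herm_mull.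
rewrite -[herm z (Amx z) _]herm_conj Smx_orth // trmx0 map_mx0 mulmx0 addr0 herm_conj.
by rewrite herm_addl -mulNmx herm_mull -[herm z (Amx z) _]herm_conj -/(Wmx z) mulNmx.
Qed.

Lemma Smx_gram_unit z : disc z != 0 -> herm z (Smx z) (Smx z) \in unitmx.
Proof.
move=> d0; apply: unit_of_inj => v E.
have vS : v *m Smx z = 0.
  by apply: (@herm_def z); rewrite herm_mull herm_mulr mulmxA E mul0mx.
have [] := @kernel_indep _ z (- (v *m Cmx z)) v d0; last by [].
by rewrite addrC mulNmx -mulmxA -mulmxBr.
Qed.

End Fibres.

Section MonadFibres.
Variable R : realType.
Local Notation C := (CC R).
Local Notation pt := 'rV[C]_4.
Local Notation hx z := (affine_lift ord0 z).
Implicit Types (z : pt) (u : 'rV[C]_(6 + 6)).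

Lemma Q_fibreP z (v : vec R 'I_5) : fibre (Q R) (chart ord0 z) v <-> hdot v (hx z) = 0.
Proof. by split=> [[_ /orth_lineP]|h] //; split=> //; apply/orth_lineP. Qed.

Lemma qfr_fibre z (c : C) k : fibre (Q R) (chart ord0 z) (c *: qfr z k).
Proof. by apply/Q_fibreP; rewrite hdotZl qproj_orth mulr0. Qed.

Lemma qbivecE2 z (c : nat -> C) : qbivec z c =
  \sum_(m < 6) wedge (ext_vec (c m *: qfr z (p1 m))) (ext_vec (qfr z (p2 m))).
Proof.
by rewrite qbivecE; apply: eq_bigr => m _; rewrite ext_vecZ wedge_scalel.
Qed.

Lemma qbivec_fibre z (c : nat -> C) : fibre (ext2b (Q R)) (chart ord0 z) (qbivec z c).
Proof.
exists 6, (fun m : 'I_6 => c m *: qfr z (p1 m)), (fun m : 'I_6 => qfr z (p2 m)).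
split; last exact: qbivecE2.
by move=> m; split; [exact: qfr_fibre|rewrite -[qfr _ _]scale1r; exact: qfr_fibre].
Qed.

(** Any two vectors of the fibre are combinations of the frame, so their product
    is a bivector in it. *)
Lemma wedge_fibre z (u v : vec R 'I_5) : fibre (Q R) (chart ord0 z) u ->
  fibre (Q R) (chart ord0 z) v -> exists c : nat -> C,
  wedge (ext_vec u) (ext_vec v) = qbivec z c.
Proof.
move=> /Q_fibreP /orth_qfr uE /Q_fibreP /orth_qfr vE.
have W (w : vec R 'I_5) (a : 'I_4 -> C) : w = \sum_k a k *: qfr z k -> ext_vec w =
    a k1 *: fe z k1 + (a k2 *: fe z k2
   + (a k3 *: fe z k3 +
      a k4 *: fe z k4)).
  move=> ->; rewrite -(sum_ord4 (fun k => a k *: fe z k)) ext_vec_sum; apply: eq_bigr => k _.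
  exact: ext_vecZ.
eexists; rewrite (W _ _ uE) (W _ _ vE).
exact: (wedge_vectors (fe_sqr z _) (fe_sqr z _) (fe_sqr z _) (fe_sqr z _) (fe_anti z _ _)
  (fe_anti z _ _) (fe_anti z _ _) (fe_anti z _ _) (fe_anti z _ _) (fe_anti z _ _)).
Qed.

Lemma ext2Q_fibreP z w : fibre (ext2b (Q R)) (chart ord0 z) w -> exists c : nat -> C,
  w = qbivec z c.
Proof.
move=> [m [u [v [uv ->]]]].
have /choice [c cE] (a : 'I_m) : exists c : nat -> C,
    wedge (ext_vec (u a)) (ext_vec (v a)) = qbivec z c.
  by have [ua va] := uv a; exact: wedge_fibre.
exists (fun k => \sum_a c a k); rewrite qbivecE.
under [RHS]eq_bigr => k _ do rewrite scaler_suml.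
by rewrite exchange_big; apply: eq_bigr => a _; rewrite cE qbivecE.
Qed.

Lemma emb_surj z w : fibre (ext2Q2 R) (chart ord0 z) w -> exists u, w = emb z u.
Proof.
move=> [/ext2Q_fibreP [c cE] /ext2Q_fibreP [d dE]].
pose u : 'rV[C]_(6 + 6) := \row_(k < 6 + 6) (if (k < 6)%N then c k else d (k - 6)%N).
have rcu k : (k < 12)%N -> rc u k = if (k < 6)%N then c k else d (k - 6)%N.
  by move=> k12; rewrite -[k]/(val (@Ordinal 12 k k12)) (@rcE R 12) mxE.
exists u; rewrite [w]pairv_eta cE dE; apply: (f_equal2 (@pairv R _ _));
  apply: qbivec_ext => k k6.
  by rewrite rcu ?k6 // (ltn_trans k6).
have k12 : (6 + k < 12)%N by rewrite -[12%N]/(6 + 6)%N ltn_add2l.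
by rewrite (rcu _ k12) ltnNge leq_addr /= addKn.
Qed.

Lemma emb_fibre z u : fibre (ext2Q2 R) (chart ord0 z) (emb z u).
Proof.
split; first by rewrite (fstv_pair (qbivec z (rc u))); exact: qbivec_fibre.
by rewrite (sndv_pair (qbivec z (rc u))); exact: qbivec_fibre.
Qed.

Lemma bmap_eq0 z u : (forall v, bmap (chart ord0 z) (emb z u) v = 0) <->
  (forall i : 'I_5, bform (rc u) (nth 0 (coordA z i)) = 0).
Proof.
split=> E.
  move=> i; have := E (unitv R i); rewrite bmapE (bigD1 i) //= unitvE eqxx mul1r big1 ?addr0.
    by move/eqP; rewrite scaler_eq0 (negPf (qvol_neq0 z)) orbF => /eqP.
  by move=> k ki; rewrite unitvE (negPf ki) mul0r.
by move=> v; rewrite bmapE big1 ?scale0r // => i _; rewrite E mulr0.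
Qed.

Lemma im_aP z w : im_a (chart ord0 z) w <-> exists v : 'rV[C]_5, w = emb z (v *m Amx z).
Proof.
split=> [[v _ <-]|[v ->]]; first by exists (\row_i v i); rewrite amapE.
exists [ffun i => v 0 i]; first by [].
have E : \row_i [ffun i => v 0 i] i = v by apply/rowP => i; rewrite mxE ffunE.
by apply: etrans (amapE _ _) _; rewrite E.
Qed.

Lemma bform_ext (c c' e : nat -> C) : (forall k, (k < 12)%N -> c k = c' k) ->
  bform c e = bform c' e.
Proof. by move=> E; rewrite /bform /bipair !E. Qed.

Lemma bform_comb_rows z (al : 'rV[C]_5) (be : 'rV[C]_2) (i : 'I_5) :
  bform (rc (al *m Amx z + be *m Tmx z)) (nth 0 (coordA z i)) = 0.
Proof.
pose A j := nth 0 (coordA z j); pose T j := nth 0 (coordT z j).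
have [a0 [a1 [a2 [a3 [a4 alE]]]]] : exists a0 a1 a2 a3 a4 : C,
    al = \row_i nth 0 [:: a0; a1; a2; a3; a4] i.
  exists (rc al 0), (rc al 1), (rc al 2), (rc al 3), (rc al 4).
  by apply/rowP => k; rewrite mxE -rcE; case: k => [[|[|[|[|[|k]]]]] h].
have [b0 [b1 beE]] : exists b0 b1 : C, be = \row_i nth 0 [:: b0; b1] i.
  by exists (rc be 0), (rc be 1); apply/rowP => k; rewrite mxE -rcE; case: k => [[|[|k]] h].
rewrite (@bform_ext _ (fun k => a0 * A 0%N k + a1 * A 1%N k + a2 * A 2%N k + a3 * A 3%N k +
  a4 * A 4%N k + b0 * T 0%N k + b1 * T 1%N k)); last first.
  by move=> k k12; rewrite -[k in LHS]/(val (@Ordinal 12 k k12)) (@rcE R 12) (combE _ _ alE beE).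
transitivity (a0 * bform (A 0%N) (A i) + a1 * bform (A 1%N) (A i) + a2 * bform (A 2%N) (A i) +
  a3 * bform (A 3%N) (A i) + a4 * bform (A 4%N) (A i) + b0 * bform (T 0%N) (A i) +
  b1 * bform (T 1%N) (A i)); first by rewrite -/(A i) /bform /bipair; ring.
rewrite (bform_A z (@Ordinal 5 0 isT) i) (bform_A z (@Ordinal 5 1 isT) i)
  (bform_A z (@Ordinal 5 2 isT) i) (bform_A z (@Ordinal 5 3 isT) i)
  (bform_A z (@Ordinal 5 4 isT) i) (bform_T z (@Ordinal 2 0 isT) i)
  (bform_T z (@Ordinal 2 1 isT) i).
by rewrite !mulr0 !addr0.
Qed.

(** An element of ker b is a combination of the rows of A and T, hence of A and S.
    If it is orthogonal to the rows of A, then so is its A-part, which must be 0. *)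
Lemma E_fibreP z w : disc z != 0 ->
  fibre (E_m2 R) (chart ord0 z) w <-> exists be : 'rV[C]_2, w = emb z (be *m Smx z).
Proof.
move=> d0; split.
  move=> [[/= eq2 bw] ow]; have [u uE] := emb_surj eq2.
  have /(kernel_span d0) [al [be E]] : forall i : 'I_5, bform (rc u) (nth 0 (coordA z i)) = 0.
    by apply/bmap_eq0 => v; rewrite -uE; exact: bw.
  exists be; apply/eqP; rewrite -subr_eq0; apply/eqP/hdot_eq0.
  have EA : w - emb z (be *m Smx z) = emb z ((al + be *m Cmx z) *m Amx z).
    rewrite uE -linearB; congr emb.
    by rewrite E /Smx mulmxBr mulmxA mulmxDl opprB addrA addrAC addrK addrC.
  rewrite {2}EA hdotBl.
  rewrite (ow _ (proj2 (im_aP _ _) (ex_intro _ _ erefl))) sub0r hdot_emb.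
  have := herm_mulr z (al + be *m Cmx z) (be *m Smx z) (Amx z).
  rewrite [herm z _ (Amx z)]herm_mull Smx_orth // mulmx0 mul0mx /herm => ->.
  by rewrite mxE oppr0.
move=> [be ->]; split; first split.
- exact: emb_fibre.
- apply/bmap_eq0 => i.
  have -> : be *m Smx z = - (be *m Cmx z) *m Amx z + be *m Tmx z.
    by rewrite /Smx mulmxBr mulNmx mulmxA addrC.
  exact: bform_comb_rows.
move=> _ /im_aP [v ->]; rewrite hdot_emb.
have := herm_mulr z v (be *m Smx z) (Amx z).
rewrite [herm z _ (Amx z)]herm_mull Smx_orth // mulmx0 mul0mx /herm => ->.
by rewrite mxE.
Qed.

End MonadFibres.

(** * Holomorphic sections *)

Section Holomorphic.
Variable R : realType.
Local Notation C := (CC R).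
Local Notation pt := 'rV[C]_4.
Implicit Types (f g : pt -> C) (U V : set pt).

Definition hol U f := forall z, U z -> differentiable f z.

Lemma differentiable_near0 f z : (\forall y \near z, f y = 0) -> differentiable f z.
Proof.
move=> fz0; have f0 : f z = 0 by exact: nbhs_singleton fz0.
pose df : {linear pt -> C} := [the {linear pt -> C} of \0].
have dfc : continuous df by move=> y; exact: cst_continuous.
have fz1 : \forall h \near (0 : pt), f (h + z) = 0.
  move: fz0; rewrite (near_shift 0 z); apply: filterS => h /=.
  by rewrite /shift /= subr0.
have E : f \o shift z = cst (f z) + df +o_ (0 : pt) id.
  apply/eqaddoP => _/posnumP[e]; near=> h.
  rewrite !fctE /= f0 addr0 subr0.
  have -> : f (h + z) = 0 by near: h.
  by rewrite normr0 mulr_ge0.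
by apply/diff_locallyP; rewrite (diff_unique dfc E).
Unshelve. all: by end_near. Qed.

(** The difference of two functions that agree near z has derivative zero there. *)
Lemma differentiable_near f g z : (\forall y \near z, f y = g y) ->
  differentiable f z -> differentiable g z.
Proof.
move=> fg df; have -> : g = f + (g - f) by apply/esym; rewrite addrC; exact: subrK.
apply: (differentiableD df); apply: differentiable_near0.
by apply: filterS fg => y fgy; rewrite !fctE fgy subrr.
Qed.

Lemma hol_on U f g : open U -> (forall y, U y -> f y = g y) -> hol U f -> hol U g.
Proof.
move=> oU fg hf z Uz; apply: (@differentiable_near f); last exact: hf.
have := open_nbhs_nbhs (conj oU Uz); exact: filterS.
Qed.

Lemma hol_cst U (c : C) : hol U (fun=> c).
Proof. by move=> z _; exact: differentiable_cst. Qed.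

Lemma hol_coord U k : hol U (fun y => y 0 k).
Proof. by move=> z _; exact: differentiable_coord. Qed.

Lemma hol_add U f g : hol U f -> hol U g -> hol U (fun y => f y + g y).
Proof. by move=> hf hg z Uz; apply: differentiableD; [exact: hf|exact: hg]. Qed.

Lemma hol_mul U f g : hol U f -> hol U g -> hol U (fun y => f y * g y).
Proof. by move=> hf hg z Uz; apply: differentiableM; [exact: hf|exact: hg]. Qed.

Lemma hol_opp U f : hol U f -> hol U (fun y => - f y).
Proof. by move=> hf z Uz; apply: differentiableN; exact: hf. Qed.

Lemma open_neq0 (f : pt -> C) : hol setT f -> open [set z | f z != 0]%classic.
Proof.
move=> hf; apply: (@open_comp _ _ f [set x : C | x != 0]%classic).
  by move=> z _; apply: differentiable_continuous; exact: hf.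
have -> : [set x : C | x != 0]%classic = (~` [set 0])%classic.
  by apply/seteqP; split=> x /= /eqP.
by apply: closed_openC; exact: accessible_closed_set1 (hausdorff_accessible (@norm_hausdorff _ C)) _.
Qed.

End Holomorphic.

Lemma tensv_suml (R : realType) (I J : finType) n (c : 'I_n -> CC R) (u : 'I_n -> vec R I)
    (w : vec R J) : tensv (\sum_i c i *: u i) w = \sum_i c i *: tensv (u i) w.
Proof.
apply/ffunP => k; rewrite ffunE sum_ffunE mulr_suml sum_ffunE.
by apply: eq_bigr => i _; rewrite vec_scaleE [RHS]vec_scaleE ffunE mulrA.
Qed.

Lemma tensvZZ (R : realType) (I J : finType) (c d : CC R) (u : vec R I) (w : vec R J) :
  tensv (c *: u) (d *: w) = (c * d) *: tensv u w.
Proof.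
by apply/ffunP => k; rewrite ffunE [RHS]vec_scaleE !vec_scaleE ffunE mulrACA.
Qed.

Ltac hol_poly := lazymatch goal with
  | |- hol _ (fun z => @?f z + @?g z) => refine (@hol_add _ _ f g _ _); hol_poly
  | |- hol _ (fun z => @?f z * @?g z) => refine (@hol_mul _ _ f g _ _); hol_poly
  | |- hol _ (fun z => - @?f z) => refine (@hol_opp _ _ f _); hol_poly
  | |- hol _ (fun z => fun_of_matrix z _ _) => exact: hol_coord
  | |- hol _ (fun z => ?c) => exact: (@hol_cst _ _ c)
  end.

Section Frame.
Variable R : realType.
Local Notation C := (CC R).
Local Notation pt := 'rV[C]_4.
Local Notation hx z := (affine_lift ord0 z).
Implicit Types (z : pt) (V : set pt).

(** The constant section e_k of the trivial bundle represents the class. *)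
Lemma holsec_qfr V (c : pt -> C) k : open V -> hol V c ->
  holsec (Q R) ord0 V (fun z => c z *: qfr z k).
Proof.
move=> oV hc; split; first by move=> z _; exact: qfr_fibre.
move=> z Vz; exists V; split=> //.
exists (fun z => c z *: unitv R (lift ord0 k)); split.
  move=> y Vy i; apply: (@hol_on _ V (fun y => c y * unitv R (lift ord0 k) i)) => //.
    by move=> x _; rewrite vec_scaleE.
  exact: hol_mul hc (hol_cst _).
move=> y Vy; apply/lineP; eexists.
rewrite -scalerBr /qfr /qproj opprB addrC subrK; exact: scalerA.
Qed.

Lemma holsec_qbivec V (c : nat -> pt -> C) (s : pt -> ext R 5) : open V ->
  (forall k, (k < 6)%N -> hol V (c k)) -> (forall z, s z = qbivec z (fun k => c k z)) ->
  holsec (ext2b (Q R)) ord0 V s.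
Proof.
move=> oV hc sE z Vz; exists V; split=> //.
exists 6, (fun (m : 'I_6) z => c m z *: qfr z (p1 m)), (fun (m : 'I_6) z => 1 *: qfr z (p2 m)).
split.
  move=> m; split; first exact: holsec_qfr (hc m (ltn_ord m)).
  exact: (holsec_qfr _ oV (hol_cst 1)).
move=> y Vy; rewrite sE; apply: etrans (qbivecE2 _ _) _.
apply: eq_bigr => m _; by rewrite scale1r.
Qed.

Lemma holsec_emb V (u : pt -> 'rV[C]_(6 + 6)) : open V ->
  (forall k, hol V (fun z => u z 0 k)) -> holsec (ext2Q2 R) ord0 V (fun z => emb z (u z)).
Proof.
move=> oV hu.
have hr k : hol V (fun z => rc (u z) k).
  rewrite /rc; case: insub => [i|]; [exact: hu|exact: hol_cst].
split.
  apply: (holsec_qbivec (c := fun k z => rc (u z) k)) => // z; exact: fstv_pair.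
apply: (holsec_qbivec (c := fun k z => rc (u z) (6 + k))) => // z; exact: sndv_pair.
Qed.

Lemma hol_T V l k : hol V (fun z => Tmx z l k).
Proof.
have -> : (fun z => Tmx z l k) = (fun z : pt => nth 0 (coordT z l) k : C).
  by apply/funext => z; rewrite mxE.
case: l => [[|[|l]] hl]; last by [].
all: rewrite /coordT /disc /nat_of_ord.
all: case: k => [[|[|[|[|[|[|[|[|[|[|[|[|k]]]]]]]]]]]] hk]; last by [].
all: cbn [nth]; hol_poly.
Qed.

Definition frame_domain : set pt := [set z | disc z != 0]%classic.

Lemma frame_domain_open : open frame_domain.
Proof.
apply: open_neq0; rewrite /disc.
hol_poly.
Qed.

(** The rows of T are holomorphic sections of ker b and differ from those of S by
    elements of im a. *)
Lemma holsec_E l : holsec (E_m2 R) ord0 frame_domain (fun z => emb z (row l (Smx z))).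
Proof.
split.
  move=> z Uz; apply/(E_fibreP _ Uz); exists (delta_mx 0 l); by rewrite -rowE.
move=> z Uz; exists frame_domain; split=> //; first exact: frame_domain_open.
exists (fun z => emb z (row l (Tmx z))); split.
  split.
    apply: holsec_emb; first exact: frame_domain_open.
    move=> k; have -> : (fun z => row l (Tmx z) 0 k) = (fun z => Tmx z l k).
      by apply/funext => y; rewrite mxE.
    exact: hol_T.
  move=> y Uy; apply/bmap_eq0 => i.
  have := bform_comb_rows y 0 (delta_mx 0 l) i.
  by rewrite mul0mx add0r -rowE.
move=> y Uy; apply/im_aP; exists (row l (Cmx y)).
rewrite -linearB /=; congr emb; rewrite -row_mul -raddfB /=.
by congr row; rewrite /Smx opprB addrC subrK.
Qed.

End Frame.

(** * The holomorphic frame of E *)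

Section Twist.
Variable R : realType.
Local Notation C := (CC R).
Local Notation pt := 'rV[C]_4.
Local Notation hx z := (affine_lift ord0 z).
Implicit Types (z : pt) (V : set pt).

(** The linear form on the tautological line that is 1 on (1, z_1, ..., z_4),
    stored as the conjugate of its Riesz vector. *)
Definition dual_frame z : vec R 'I_5 := [ffun i => (((nrm z)^-1 *: hx z) i)^*].
Definition twist_frame z : vec R ('I_5 * 'I_5)%type := tensv (dual_frame z) (dual_frame z).

Lemma hdot_dual_frame z : hdot (dual_frame z) (dual_frame z) = (nrm z)^-1.
Proof.
rewrite /dual_frame hdot_conj hdotZl hdotZr nrmE fmorphV /= nrm_real.
by field; exact: nrm_neq0.
Qed.

Lemma hdot_twist_frame z : hdot (twist_frame z) (twist_frame z) = ((nrm z)^-1) ^+ 2.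
Proof. by rewrite hdot_tensv hdot_dual_frame expr2. Qed.

Lemma taut_fibre z (c : C) : fibre (O_m1 R) (chart ord0 z) (c *: hx z).
Proof. by split=> //; apply/lineP; exists c. Qed.

Lemma dual_frame_fibre z : fibre (O_1 R) (chart ord0 z) (dual_frame z).
Proof. by exists ((nrm z)^-1 *: hx z); first exact: taut_fibre. Qed.

Lemma O1_fibreP z f : fibre (O_1 R) (chart ord0 z) f -> exists c : C, f = c *: dual_frame z.
Proof.
move=> [v [_ /lineP [c ->]] ->]; exists (c * nrm z)^*.
apply/ffunP => i; rewrite [LHS]ffunE [RHS]vec_scaleE [dual_frame z i]ffunE -rmorphM; congr (_ ^*).
by rewrite !vec_scaleE mulrA mulfK ?nrm_neq0.
Qed.

Lemma O2_fibreP z f : fibre (O_2 R) (chart ord0 z) f -> exists c : C, f = c *: twist_frame z.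
Proof.
move=> [m [u [v [uv ->]]]].
have /choice [c cE] (a : 'I_m) : exists c : C, tensv (u a) (v a) = c *: twist_frame z.
  have [/O1_fibreP [p ->] /O1_fibreP [q ->]] := uv a.
  by exists (p * q); exact: tensvZZ.
exists (\sum_a c a); rewrite scaler_suml; apply: eq_bigr => a _; exact: cE.
Qed.

Lemma twist_frame_fibre z : fibre (O_2 R) (chart ord0 z) (twist_frame z).
Proof.
exists 1%N, (fun=> dual_frame z), (fun=> dual_frame z); split; last by rewrite big_ord1.
by move=> _; split; exact: dual_frame_fibre.
Qed.

Lemma dual_frame_eval z (c : C) : \sum_i dual_frame z i * (c *: hx z) i = c.
Proof.
transitivity (c * hdot (hx z) ((nrm z)^-1 *: hx z)); last first.
  by rewrite hdotZr nrmE fmorphV /= nrm_real mulVf ?nrm_neq0 ?mulr1.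
rewrite /hdot mulr_sumr; apply: eq_bigr => i _.
by rewrite [dual_frame z i]ffunE [X in _ * X = _]vec_scaleE mulrC mulrA.
Qed.

(** On a section t of the tautological bundle the form takes the value of the
    coordinate t_0, which is holomorphic. *)
Lemma holsec_dual_frame V : holsec (O_1 R) ord0 V dual_frame.
Proof.
split; first by move=> z _; exists ((nrm z)^-1 *: hx z); first exact: taut_fibre.
move=> V' t oV' _ [ht tl] z Vz.
apply: (@hol_on _ V' (fun y => t y ord0)) => //; last by move=> y Vy; exact: ht.
move=> y Vy; have /lineP [c E] := tl y Vy.
by rewrite E dual_frame_eval vec_scaleE affine_lift0 mulr1.
Qed.

Lemma holsec_twist_frame V : open V -> holsec (O_2 R) ord0 V twist_frame.
Proof.
move=> oV z Vz; exists V; split=> //.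
exists 1%N, (fun=> dual_frame), (fun=> dual_frame); split; last by move=> y _; rewrite big_ord1.
by move=> _; split; exact: holsec_dual_frame.
Qed.

Definition hm_frame (l : 'I_2) z := tensv (emb z (row l (Smx z))) (twist_frame z).
(** The Gram matrix of the frame of E. *)
Definition Hmx z : 'M[C]_2 := ((nrm z)^-1 ^+ 2) *: herm z (Smx z) (Smx z).

Lemma h1_hm_frame z l m : h1 (chart ord0 z) (hm_frame l z) (hm_frame m z) = Hmx z l m.
Proof.
by apply: etrans (hdot_tensv _ _ _ _) _; rewrite hdot_twist_frame mxE herm_row mulrC.
Qed.

Lemma Hmx_herm z l m : Hmx z l m = (Hmx z m l)^*.
Proof. by rewrite -!h1_hm_frame; exact: hdotC. Qed.

Lemma Hmx_unit z : frame_domain z -> Hmx z \in unitmx.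
Proof.
move=> Uz; rewrite unitmxZ ?Smx_gram_unit // unitfE expf_neq0 // invr_eq0.
exact: nrm_neq0.
Qed.

Lemma hm_frame_comb z (be : 'rV[C]_2) :
  \sum_i be 0 i *: hm_frame i z = tensv (emb z (be *m Smx z)) (twist_frame z).
Proof.
rewrite -tensv_suml mulmx_sum_row linear_sum; congr tensv.
by apply: eq_bigr => i _; exact/esym/linearZ.
Qed.

Lemma hm_frame_free z (be : 'rV[C]_2) : frame_domain z -> \sum_i be 0 i *: hm_frame i z = 0 -> be = 0.
Proof.
move=> Uz E; suff E0 : be *m herm z (Smx z) (Smx z) = 0.
  by rewrite -[be](mulmxK (Smx_gram_unit Uz)) E0 mul0mx.
suff vS : be *m Smx z = 0 by rewrite -herm_mull vS /herm !mul0mx.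
apply: (@herm_def _ z); apply/matrixP => i j; rewrite !ord1 [RHS]mxE herm_row !row_id.
have t0 : hdot (twist_frame z) (twist_frame z) != 0 by rewrite hdot_twist_frame expf_neq0 // invr_eq0 nrm_neq0.
apply: (mulIf t0); rewrite mul0r -hdot_tensv -hm_frame_comb E.
by rewrite /hdot big1 // => k _; rewrite ffunE mul0r.
Qed.

Lemma hm_hol_frame : hol_frame (horrocks_mumford R) ord0 (@frame_domain R) hm_frame.
Proof.
split=> [l|z Uz].
  move=> z Uz; exists (@frame_domain R); split=> //; first exact: frame_domain_open.
  exists 1%N, (fun=> fun z => emb z (row l (Smx z))), (fun=> twist_frame).
  split; last by move=> y _; rewrite big_ord1.
  by move=> _; split; [exact: holsec_E|exact/holsec_twist_frame/frame_domain_open].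
split=> [l|v].
  exists 1%N, (fun=> emb z (row l (Smx z))), (fun=> twist_frame z).
  split; last by rewrite big_ord1.
  move=> _; split; last exact: twist_frame_fibre.
  by apply/(E_fibreP _ Uz); exists (delta_mx 0 l); rewrite -rowE.
move=> [m [u [w [uw ->]]]].
have /choice [b bE] (a : 'I_m) : exists b : 'rV[C]_2,
    tensv (u a) (w a) = \sum_i b 0 i *: hm_frame i z.
  have [/(E_fibreP _ Uz) [p ->] /O2_fibreP [c ->]] := uw a.
  exists (c *: p); rewrite hm_frame_comb -scalemxAl linearZ.
  transitivity (c *: tensv (emb z (p *m Smx z)) (twist_frame z)).
    by rewrite -[emb z (p *m _)]scale1r tensvZZ mul1r scale1r.
  by rewrite -[twist_frame z in RHS]scale1r tensvZZ mulr1.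
exists [ffun i => \sum_a b a 0 i]; split=> [|c cE].
  under eq_bigr => a _ do rewrite bE.
  by rewrite exchange_big; apply: eq_bigr => i _; rewrite ffunE scaler_suml.
have /rowP E : \row_i (\sum_a b a 0 i - c i) = 0.
  apply: (@hm_frame_free z _ Uz).
  transitivity (\sum_a tensv (u a) (w a) - \sum_i c i *: hm_frame i z); last by rewrite cE subrr.
  rewrite -sumrN; under [X in _ = X + _]eq_bigr => a _ do rewrite bE.
  rewrite exchange_big -big_split; apply: eq_bigr => i _.
  by rewrite mxE scalerBl scaler_suml.
apply/ffunP => i; rewrite ffunE; apply/eqP; rewrite -subr_eq0.
by have := E i; rewrite !mxE => ->.
Qed.

End Twist.

(** * Jets of polynomials at an integer point *)

(** Syntactic polynomials in z and conj z with integer coefficients, so that their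
    jets at an integer point can be computed. *)
Inductive pexp :=
  | Cst of int | Var of 'I_4 | Bar of 'I_4
  | Add of pexp & pexp | Mul of pexp & pexp.

Fixpoint conjp e := match e with
  | Cst c => Cst c | Var k => Bar k | Bar k => Var k
  | Add e f => Add (conjp e) (conjp f) | Mul e f => Mul (conjp e) (conjp f)
  end.

Definition Sum n (F : nat -> pexp) := foldr Add (Cst 0) (map F (iota 0 n)).

(** The jet at (2, 0, 0, 0) in the direction a. *)
Fixpoint pjet (a : 'I_4) e : jet int := match e with
  | Cst c => jcst c
  | Var k => Jet (if k == ord0 then 2 else 0) (k == a)%:Z 0 0
  | Bar k => Jet (if k == ord0 then 2 else 0) 0 (k == a)%:Z 0
  | Add e f => jadd (pjet a e) (pjet a f)
  | Mul e f => jmul (pjet a e) (pjet a f)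
  end.

Section PolyJets.
Variable R : realType.
Local Notation C := (CC R).
Local Notation pt := 'rV[C]_4.
Implicit Types (z : pt) (e f : pexp).

Fixpoint peval e z : C := match e with
  | Cst c => c%:~R
  | Var k => z 0 k
  | Bar k => (z 0 k)^*
  | Add e f => peval e z + peval f z
  | Mul e f => peval e z * peval f z
  end.

Lemma peval_conj e z : peval (conjp e) z = (peval e z)^*.
Proof.
elim: e => [c|k|k|e IHe f IHf|e IHe f IHf] //=.
- by rewrite rmorph_int.
- by rewrite conjCK.
- by rewrite IHe IHf rmorphD.
- by rewrite IHe IHf rmorphM.
Qed.

Lemma peval_sum n F z : peval (Sum n F) z = \sum_(i < n) peval (F i) z.
Proof.
rewrite -(big_mkord xpredT (fun i => peval (F i) z)) /index_iota subn0 /Sum.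
by elim: (iota 0 n) => [|i r IH] /=; rewrite ?big_nil // big_cons IH.
Qed.

Definition zpt : pt := \row_k (if k == ord0 then 2 else 0).

Lemma hasjet_pexp (U : set pt) a e : open U -> U zpt ->
  hasjet U zpt a (peval e) (jmap intr (pjet a e)).
Proof.
move=> oU Uz.
elim: e => [c|k|k|e IHe f IHf|e IHe f IHf].
- exact: hasjet_cst.
- apply: hasjet_eq (hasjet_coord a oU Uz k) _.
  by rewrite /jmap /= mxE; case: (k == ord0); case: (k == a).
- apply: hasjet_eq (hasjet_conj oU Uz (hasjet_coord a oU Uz k)) _.
  rewrite /jmap /= mxE rmorph0.
  by case: (k == ord0); case: (k == a); rewrite ?rmorph0 ?rmorph1 ?rmorph_nat.
- apply: hasjet_eq (hasjet_add oU Uz IHe IHf) _.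
  by rewrite /jadd /jmap /= !intrD.
- apply: hasjet_eq (hasjet_mul oU Uz IHe IHf) _.
  by rewrite /jmul /jmap /= !intrD !intrM.
Qed.

End PolyJets.

(** * The Gram matrices as polynomials *)

Definition Opp := Mul (Cst (-1)).
Definition Prod := foldr Mul (Cst 1).
Definition nrmp : pexp := let s k := Mul (Var k) (Bar k) in
  Add (Cst 1) (Add (s k1) (Add (s k2) (Add (s k3) (s k4)))).

(** n times the entries of the Gram matrix of Lambda^2 Q is polynomial: the terms
    with denominator n^2 cancel because conj z_i z_j has rank one. *)
Definition bigramp (m m' : nat) : pexp :=
  let d (i j : 'I_4) : int := (i == j)%:Z in
  let c (i j : 'I_4) := Mul (Bar i) (Var j) in
  let i := p1 m in let j := p2 m in let i' := p1 m' in let j' := p2 m' in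
  Add (Mul (Cst (d i i' * d j j' - d i j' * d j i')) nrmp)
    (Add (Add (Mul (Cst (- d i i')) (c j j')) (Mul (Cst (- d j j')) (c i i')))
         (Add (Mul (Cst (d i j')) (c j i')) (Mul (Cst (d j i')) (c i j')))).

Definition qgramp (f g : nat -> pexp) := Sum 6 (fun m => Sum 6 (fun m' =>
  Mul (Mul (f m) (bigramp m m')) (conjp (g m')))).
Definition hermp (f g : nat -> pexp) :=
  Add (qgramp f g) (qgramp (fun k => f (6 + k)%N) (fun k => g (6 + k)%N)).

Definition Ap (i : nat) : nat -> pexp :=
  let z1 := Var k1 in let z2 := Var k2 in let z3 := Var k3 in let z4 := Var k4 in
  let O := Cst 0 in let I := Cst 1 in
  nth O (nth [::]
  [:: [:: O; O; O; I; O; O;      O; O; I; O; O; O];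
      [:: O; O; O; O; O; I;      z1; O; O; Opp z3; Opp z4; O];
      [:: O; O; z1; O; z2; z3;   O; Opp I; O; O; O; O];
      [:: z2; z3; z4; O; O; O;   O; O; O; O; Opp I; O];
      [:: I; O; O; O; O; O;      O; Opp z1; O; Opp z2; O; z4]] i).

Definition Tp (i : nat) : nat -> pexp :=
  let z1 := Var k1 in let z2 := Var k2 in let z3 := Var k3 in let z4 := Var k4 in
  let O := Cst 0 in
  let d := Add (Cst 1) (Opp (Prod [:: z1; z2; z3; z4])) in
  nth O (nth [::]
  [:: [:: Cst 4; Mul (Cst (-21)) (Add (Mul z2 z2) (Prod [:: z1; z2; z3; z3]));
          Add (Mul (Cst 21) d) (Mul (Cst (-10)) z1); O;
          Add (Mul (Cst (-21)) (Add (Mul z3 z3) (Prod [:: z2; z2; z3; z4])))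
              (Mul (Cst (-10)) z2);
          Mul (Cst (-10)) z3;
          Mul (Cst (-21)) (Add z3 (Prod [:: z2; z2; z4]));
          Add (Cst 10) (Mul (Cst (-4)) z1); O; Mul (Cst (-4)) z2; O;
          Add (Mul (Cst 4) z4) (Mul (Cst (-21)) (Add z2 (Prod [:: z1; z3; z3])))];
      [:: O; Add z4 (Prod [:: z1; z1; z2]); O; O; Add z1 (Prod [:: z3; z4; z4]); O;
          Add (Mul z4 z4) (Prod [:: z1; z1; z2; z4]); O; O; d; O;
          Add (Mul z1 z1) (Prod [:: z1; z3; z4; z4])]] i).

Section GramPolynomials.
Variable R : realType.
Local Notation C := (CC R).
Local Notation pt := 'rV[C]_4.
Implicit Types (z : pt).

Lemma nrmp_val z : peval nrmp z = nrm z.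
Proof. by rewrite /nrm (sum_ord4 (fun k => z 0 k * (z 0 k)^*)). Qed.

Lemma bigramp_val m m' z : peval (bigramp m m') z = nrm z * bigram z m m'.
Proof.
rewrite -nrmp_val /bigram /qdot -nrmp_val /bigramp.
have n0 : peval nrmp z != 0 by rewrite nrmp_val nrm_neq0.
move: (nrmp) n0 (p1 m) (p2 m) (p1 m') (p2 m') => n n0 i j i' j'.
cbn [peval].
rewrite !(intrD, rmorphN, intrM) /=.
move: (peval n z) n0 (z 0 i)^* (z 0 j)^* (z 0 i') (z 0 j').
move: (i == i') (i == j') (j == j') (j == i') => b1 b2 b3 b4 N N0 *.
rewrite -!pmulrn ?natrM.
by move: (b1%:R : C) (b2%:R : C) (b3%:R : C) (b4%:R : C) => *; field.
Qed.

Lemma qgramp_val (f g : nat -> pexp) (c d : nat -> C) z :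
  (forall k, (k < 6)%N -> peval (f k) z = c k) -> (forall k, (k < 6)%N -> peval (g k) z = d k) ->
  peval (qgramp f g) z = nrm z * hdot (qbivec z c) (qbivec z d).
Proof.
move=> fc gd; rewrite hdot_qbivec mulr_sumr peval_sum; apply: eq_bigr => m _.
rewrite mulr_sumr peval_sum; apply: eq_bigr => m' _.
cbn [peval]; rewrite bigramp_val peval_conj fc // gd // mulrCA.
exact/esym/mulrA.
Qed.

Lemma hermp_val m n (X : 'M[C]_(m, 6 + 6)) (Y : 'M[C]_(n, 6 + 6)) i j (f g : nat -> pexp) z :
  (forall k, (k < 12)%N -> peval (f k) z = rc (row i X) k) ->
  (forall k, (k < 12)%N -> peval (g k) z = rc (row j Y) k) ->
  peval (hermp f g) z = nrm z * herm z X Y i j.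
Proof.
move=> fX gY; rewrite herm_row /emb hdot_pairv mulrDr.
have lt6 k : (k < 6 -> 6 + k < 12)%N by rewrite -[12%N]/(6 + 6)%N ltn_add2l.
have lt12 k : (k < 6 -> k < 12)%N by move=> k6; exact: (ltn_trans k6).
have E1 := qgramp_val (fun k k6 => fX k (lt12 k k6)) (fun k k6 => gY k (lt12 k k6)).
have E2 := qgramp_val (fun k k6 => fX _ (lt6 k k6)) (fun k k6 => gY _ (lt6 k k6)).
exact: (f_equal2 +%R E1 E2).
Qed.

Lemma Ap_val i k z : (i < 5)%N -> (k < 12)%N -> peval (Ap i k) z = nth 0 (coordA z i) k.
Proof.
case: i => [|[|[|[|[|i]]]]] // _; rewrite /Ap /coordA.
all: case: k => [|[|[|[|[|[|[|[|[|[|[|[|k]]]]]]]]]]]] //= _.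
all: by rewrite ?mulN1r ?mulr1 ?rmorphN1.
Qed.

Lemma Tp_val i k z : (i < 2)%N -> (k < 12)%N -> peval (Tp i k) z = nth 0 (coordT z i) k.
Proof.
case: i => [|[|i]] // _; rewrite /Tp /coordT /disc.
all: case: k => [|[|[|[|[|[|[|[|[|[|[|[|k]]]]]]]]]]]] //= _.
all: ring.
Qed.

Lemma rc_Tmx z (i : 'I_2) k : (k < 12)%N -> rc (row i (Tmx z)) k = nth 0 (coordT z i) k.
Proof.
by move=> kn; rewrite -[k]/(val (@Ordinal 12 k kn)) (@rcE R 12) !mxE.
Qed.

End GramPolynomials.

(** * The Gram matrix of E near (1:2:0:0:0) *)

Section NumericGram.
Variable R : realType.
Local Notation C := (CC R).
Local Notation pt := 'rV[C]_4.
Local Notation U := (@frame_domain R).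
Local Notation z0 := (zpt R).
Implicit Types (z : pt).

Lemma zpt_frame_domain : frame_domain z0.
Proof.
have E : disc z0 = 1 by rewrite /disc !mxE /= !mulr0 subr0.
by have := oner_neq0 C; rewrite -E.
Qed.

Definition nGram z : 'M[C]_5 := \matrix_(i, j) peval (hermp (Ap i) (Ap j)) z.
(** n^3 times the Gram matrix of E. *)
Definition nSchur (l m : 'I_2) z : C := peval (hermp (Tp l) (Tp m)) z -
  \sum_(i < 5) \sum_(j < 5) peval (hermp (Tp l) (Ap i)) z * invmx (nGram z) i j *
    (peval (hermp (Tp m) (Ap j)) z)^*.

Lemma hermp_TT l m z : peval (hermp (Tp (l : 'I_2)) (Tp (m : 'I_2))) z = nrm z * TTmx z l m.
Proof. by apply: hermp_val => k k12; rewrite rc_Tmx // Tp_val. Qed.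
Lemma hermp_TA l i z : peval (hermp (Tp (l : 'I_2)) (Ap (i : 'I_5))) z = nrm z * Wmx z l i.
Proof. by apply: hermp_val => k k12; rewrite ?rc_Tmx ?rc_Amx // ?Tp_val ?Ap_val. Qed.
Lemma hermp_AA i j z : peval (hermp (Ap (i : 'I_5)) (Ap (j : 'I_5))) z = nrm z * Gmx z i j.
Proof. by apply: hermp_val => k k12; rewrite rc_Amx // Ap_val. Qed.

Lemma nGramE z : nGram z = nrm z *: Gmx z.
Proof. by apply/matrixP => i j; rewrite [LHS]mxE [RHS]mxE hermp_AA. Qed.

Lemma nGram_unit z : frame_domain z -> nGram z \in unitmx.
Proof. by move=> Uz; rewrite nGramE unitmxZ ?Gmx_unit // unitfE nrm_neq0. Qed.

Lemma Hmx_nSchur z l m : frame_domain z -> Hmx z l m = ((nrm z)^-1) ^+ 3 * nSchur l m z.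
Proof.
move=> Uz; have n0 := nrm_neq0 z.
have sub (A B : 'M[C]_2) : (A - B) l m = A l m - B l m by rewrite !mxE.
have tri (A : 'M[C]_(2, 5)) (B : 'M[C]_5) :
    (A *m B *m A ^h) l m = \sum_i \sum_j A l i * B i j * (A m j)^*.
  rewrite mxE exchange_big; apply: eq_bigr => j _.
  by rewrite !mxE mulr_suml.
rewrite mxE Smx_gram // sub tri (exprSr _ 2) -mulrA; congr (_ * _).
apply: (mulfI n0); rewrite mulVKf // /nSchur hermp_TT mulrBr; congr (_ - _).
rewrite mulr_sumr; apply: eq_bigr => i _; rewrite mulr_sumr; apply: eq_bigr => j _.
rewrite nGramE invmxZ; last by rewrite unitmxZ ?Gmx_unit // unitfE.
have -> : ((nrm z)^-1 *: invmx (Gmx z)) i j = (nrm z)^-1 * invmx (Gmx z) i j by rewrite mxE.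
rewrite !hermp_TA rmorphM /= nrm_real.
by field.
Qed.

Lemma sm_pexp e : sm U (peval e).
Proof. by have [] := hasjet_pexp ord0 e (@frame_domain_open R) zpt_frame_domain. Qed.

Lemma sm_inv_nGram i j : sm U (fun z => invmx (nGram z) i j).
Proof.
apply: sm_invmx => [k l|z]; last exact: nGram_unit.
by apply: sm_on (sm_pexp (hermp (Ap k) (Ap l))) => z _; rewrite mxE.
Qed.

Lemma sm_inv_nrm : sm U (fun z => ((nrm z)^-1) ^+ 3).
Proof.
have s : sm U (fun z => (nrm z)^-1).
  apply: sm_inv; first by move=> z _; exact: nrm_neq0.
  by apply: sm_on (sm_pexp nrmp) => z _; exact: nrmp_val.
exact: sm_mul s (sm_mul s s).
Qed.

Lemma sm_nSchur l m : sm U (nSchur l m).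
Proof.
apply: sm_add; first exact: sm_pexp.
apply: sm_opp; apply: sm_sum => i; apply: sm_sum => j.
apply: sm_mul; last exact/sm_conj/sm_pexp.
by apply: sm_mul; [exact: sm_pexp|exact: sm_inv_nGram].
Qed.

Lemma sm_Hmx l m : sm U (fun z => Hmx z l m).
Proof.
apply: sm_on (sm_mul sm_inv_nrm (sm_nSchur l m)) => z Uz; exact/esym/Hmx_nSchur.
Qed.

End NumericGram.

(** Entries of 630 times the inverse Gram matrix of the rows of A. *)
Definition adjG (i j : nat) : int := nth 0 (nth [::]
  [:: [:: 105; 0; 0; 0; 0]; [:: 0; 70; 0; 0; 0]; [:: 0; 0; 150; 0; -60];
      [:: 0; 0; 0; 126; 0]; [:: 0; 0; -60; 0; 150]] i) j.

Lemma big_iota (V : nmodType) n (F : nat -> V) :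
  \sum_(i < n) F i = foldr +%R 0 (map F (iota 0 n)).
Proof.
rewrite -(big_mkord xpredT F) /index_iota subn0.
by elim: (iota 0 n) => [|i r IH] /=; rewrite ?big_nil // big_cons IH.
Qed.

(** The value of n G at (2, 0, 0, 0). *)
Definition G0 (i j : nat) : int := nth 0 (nth [::]
  [:: [:: 6; 0; 0; 0; 0]; [:: 0; 9; 0; 0; 0]; [:: 0; 0; 5; 0; 2];
      [:: 0; 0; 0; 5; 0]; [:: 0; 0; 2; 0; 5]] i) j.

Lemma G0_val i j : (i < 5)%N -> (j < 5)%N -> jv (pjet ord0 (hermp (Ap i) (Ap j))) = G0 i j.
Proof.
case: i => [|[|[|[|[|i]]]]] // _; case: j => [|[|[|[|[|j]]]]] // _; vm_compute; reflexivity.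
Qed.

Lemma adjG_inv i j : (i < 5)%N -> (j < 5)%N ->
  \sum_(k < 5) G0 i k * adjG k j = if i == j then 630 else 0.
Proof.
move=> i5 j5; rewrite (big_iota 5 (fun k => G0 i k * adjG k j)).
by case: i i5 => [|[|[|[|[|i]]]]] // _; case: j j5 => [|[|[|[|[|j]]]]] // _; vm_compute.
Qed.

(** The first derivatives of n W at (2, 0, 0, 0): entry i of Wtab a l holds the
    holomorphic and antiholomorphic derivatives in the direction a.  The values of
    W itself are 0. *)
Definition Wtab (a l : nat) : seq (int * int) := nth [::] (nth [::]
  [:: [:: [:: (0, 0); (0, 0); (-16, 1); (0, 0); (8, -2)];
          [:: (0, 0); (0, 0); (0, 0); (0, 0); (0, 0)]];
      [:: [:: (0, 0); (0, 0); (0, 0); (0, 4); (0, 0)];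
          [:: (0, 0); (0, 0); (0, 4); (0, 0); (0, -1)]];
      [:: [:: (8, 0); (-94, 0); (0, 0); (0, 0); (0, 0)];
          [:: (0, -8); (0, -1); (0, 0); (0, 0); (0, 0)]];
      [:: [:: (0, 0); (0, 0); (0, 0); (0, 1); (0, 0)];
          [:: (0, 0); (0, 0); (0, -8); (0, 0); (0, 8)]]] a) l.

Definition TTtab (a l m : nat) : jet int := nth (jcst 0) (nth [::] (nth [::]
  [:: [:: [:: Jet 21 (-18) (-18) 116; jcst 0]; [:: jcst 0; Jet 105 132 132 178]];
      [:: [:: Jet 21 0 0 2862; Jet 0 (-548) 0 0]; [:: Jet 0 0 (-548) 0; Jet 105 0 0 32]];
      [:: [:: Jet 21 0 0 998; jcst 0]; [:: jcst 0; Jet 105 0 0 4]];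
      [:: [:: Jet 21 0 0 132; Jet 0 112 0 0]; [:: Jet 0 0 112 0; Jet 105 0 0 2]]] a) l) m.

Definition jet1 (K : Type) (w : jet K) := (jv w, (jd w, je w)).

Lemma WtabE (a : 'I_4) l i : (l < 2)%N -> (i < 5)%N -> jet1 (pjet a (hermp (Tp l) (Ap i))) = (0, nth (0, 0) (Wtab a l) i).
Proof.
case: (ord4_cases a) => ->; case: l => [|[|l]] // _; case: i => [|[|[|[|[|i]]]]] // _;
  vm_compute; reflexivity.
Qed.

Lemma TTtabE (a : 'I_4) l m : (l < 2)%N -> (m < 2)%N ->
  pjet a (hermp (Tp l) (Tp m)) = TTtab a l m.
Proof.
case: (ord4_cases a) => ->; case: l => [|[|l]] // _; case: m => [|[|m]] // _;
  vm_compute; reflexivity.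
Qed.

(** The mixed derivative of W_li conj(W_mj): as W vanishes at the point, only
    products of first derivatives contribute, and these are real. *)
Definition Wcorr (a l m i j : nat) : int :=
  let w := nth (0, 0) (Wtab a l) i in let w' := nth (0, 0) (Wtab a m) j in
  w.1 * w'.1 + w.2 * w'.2.

Section NumericJets.
Variable R : realType.
Local Notation C := (CC R).
Local Notation pt := 'rV[C]_4.
Local Notation U := (@frame_domain R).
Local Notation z0 := (zpt R).
Implicit Types (z : pt).

Let oU : open U := @frame_domain_open R.
Let Uz0 : U z0 := zpt_frame_domain R.

Lemma n630 : (630 : C) != 0. Proof. by rewrite pnatr_eq0. Qed.

Lemma inv_nGram (i j : 'I_5) : invmx (nGram z0) i j = (adjG i j)%:~R / 630.
Proof.
pose X : 'M[C]_5 := \matrix_(i, j) ((adjG i j)%:~R / 630).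
suff E : nGram z0 *m X = 1%:M.
  have [u _] := mulmx1_unit E.
  by rewrite -[invmx _]mulmx1 -E mulKmx // mxE.
apply/matrixP => k l; rewrite !mxE.
apply: (mulIf n630); rewrite mulr_suml.
have := congr1 (intr : int -> C) (adjG_inv (ltn_ord k) (ltn_ord l)).
have -> : (if (k : nat) == l then 630 else 0 : int)%:~R = (k == l)%:R * 630 :> C.
  by rewrite -[((k : nat) == l)]/(k == l); case: (k == l); rewrite ?mul1r ?mul0r.
move=> <-; rewrite rmorph_sum; apply: eq_bigr => i' _ /=.
have V (j' : 'I_5) : peval (hermp (Ap k) (Ap j')) z0 = (G0 k j')%:~R.
  rewrite -(G0_val (ltn_ord k) (ltn_ord j')); exact: jet_v (hasjet_pexp ord0 _ oU Uz0).
rewrite !mxE V intrM -mulrA divfK; [by []|exact: n630].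
Qed.

(** Of the middle factor only the value matters, because the outer factors vanish
    at the point. *)
Lemma hasjet_quad a f g k (d e m d' e' m' : C) : sm U k ->
  hasjet U z0 a f (Jet 0 d e m) -> hasjet U z0 a g (Jet 0 d' e' m') ->
  hasjet U z0 a (fun y => f y * k y * g y) (Jet 0 0 0 ((d * e' + e * d') * k z0)).
Proof.
move=> sk fj gj; have [kj hk] := sm_hasjet a oU Uz0 sk.
apply: hasjet_eq (hasjet_mul oU Uz0 (hasjet_mul oU Uz0 fj hk) gj) _.
rewrite (jet_v hk) /jmul /=; congr Jet; ring.
Qed.

Definition nSchur_jet (a : 'I_4) (l m : nat) : jet C :=
  Jet (jv (TTtab a l m))%:~R (jd (TTtab a l m))%:~R (je (TTtab a l m))%:~R
    ((jm (TTtab a l m))%:~R -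
     \sum_(i < 5) \sum_(j < 5) (Wcorr a l m i j)%:~R * ((adjG i j)%:~R / 630)).

Lemma hasjet_nSchur a l m : hasjet U z0 a (nSchur l m) (nSchur_jet a l m).
Proof.
have hT := hasjet_pexp a (hermp (Tp l) (Tp m)) oU Uz0.
rewrite TTtabE // in hT.
have hW (l' : 'I_2) (i : 'I_5) : exists c : C, hasjet U z0 a (peval (hermp (Tp l') (Ap i)))
    (Jet 0 (nth (0, 0) (Wtab a l') i).1%:~R (nth (0, 0) (Wtab a l') i).2%:~R c).
  have := hasjet_pexp a (hermp (Tp l') (Ap i)) oU Uz0.
  have := WtabE a (ltn_ord l') (ltn_ord i).
  move: (pjet a _) (nth _ _ _) => [v d e c] w [-> <-] h; exists c%:~R; exact: h.
have hQ (i j : 'I_5) : hasjet U z0 a (fun y => peval (hermp (Tp l) (Ap i)) y *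
    invmx (nGram y) i j * (peval (hermp (Tp m) (Ap j)) y)^*)
    (Jet 0 0 0 ((Wcorr a l m i j)%:~R * ((adjG i j)%:~R / 630))).
  have [c hl] := hW l i; have [c' hm] := hW m j.
  have hm' : hasjet U z0 a (fun y => (peval (hermp (Tp m) (Ap j)) y)^*)
      (Jet 0 (nth (0, 0) (Wtab a m) j).2%:~R (nth (0, 0) (Wtab a m) j).1%:~R c'^*).
    by apply: hasjet_eq (hasjet_conj oU Uz0 hm) _; rewrite /jmap /= rmorph0 !rmorph_int.
  apply: hasjet_eq (hasjet_quad (sm_inv_nGram R i j) hl hm') _.
  by rewrite inv_nGram /Wcorr intrD !intrM.
have hS (i : 'I_5) := hasjet_sum oU Uz0 (J := fun j => Jet 0 0 0 ((Wcorr a l m i j)%:~R * ((adjG i j)%:~R / 630))) (hQ i).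
have hSS := hasjet_sum oU Uz0 (J := fun i => jsum 5 (fun j => Jet 0 0 0 ((Wcorr a l m i j)%:~R * ((adjG i j)%:~R / 630)))) hS.
apply: hasjet_eq (hasjet_add oU Uz0 hT (hasjet_opp oU Uz0 hSS)) _.
have jsumE (F : nat -> C) : jsum 5 (fun j => Jet 0 0 0 (F j)) = Jet 0 0 0 (\sum_(j < 5) F j).
  rewrite big_iota /jsum; elim: (iota 0 5) => [|i r IH] /=; first by [].
  by rewrite IH /jadd /= !addr0.
have -> : jsum 5 (fun i => jsum 5 (fun j => Jet 0 0 0 ((Wcorr a l m i j)%:~R * ((adjG i j)%:~R / 630)))) =
    Jet 0 0 0 (\sum_(i < 5) \sum_(j < 5) (Wcorr a l m i j)%:~R * ((adjG i j)%:~R / 630)) :> jet C.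
  rewrite -(jsumE (fun i => \sum_(j < 5) (Wcorr a l m i j)%:~R * ((adjG i j)%:~R / 630))).
  by congr (jsum 5 _); apply/funext => i; rewrite jsumE.
by rewrite /nSchur_jet /jadd /jopp /jmap /= !oppr0 !addr0.
Qed.

End NumericJets.

(** * The two diagonal entries of the mean curvature *)

Section Final.
Variable R : realType.
Local Notation C := (CC R).
Local Notation pt := 'rV[C]_4.
Local Notation U := (@frame_domain R).
Local Notation z0 := (zpt R).

Let oU : open U := @frame_domain_open R.
Let Uz0 : U z0 := zpt_frame_domain R.

Lemma zpt_coord k : z0 0 k = if k == ord0 then 2 else 0.
Proof. by rewrite mxE. Qed.

Definition ydiag (a : 'I_4) : C := if a == ord0 then 25^-1 else 5^-1.

Lemma FS_zpt a b : FS_metric z0 a b = if a == b then ydiag a else 0.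
Proof.
rewrite /ydiag /FS_metric; set n := (1 + _).
have -> : n = 5.
  rewrite /n (bigD1 ord0) //= big1 => [|k /negPf k0]; last by rewrite zpt_coord k0 normr0 expr0n.
  by rewrite zpt_coord eqxx normr_nat addr0; ring.
rewrite !zpt_coord; case: (eqVneq a b) => [<-|ab].
  by case: (a == ord0); rewrite ?rmorph0 ?rmorph_nat ?mul0r ?subr0 ?mul1r //; field.
rewrite mul0r; case: (eqVneq a ord0) ab => [->|_] ab; last by rewrite rmorph0 !mul0r subr0.
by rewrite eq_sym in ab; rewrite (negPf ab) mulr0 mul0r subr0.
Qed.

Definition other (l : 'I_2) : 'I_2 := rev_ord l.

(** The l-th diagonal curvature entry, in the direction a, of the metric with
    Gram matrix nSchur. *)
Definition ncurv (a : 'I_4) (l : 'I_2) : C :=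
  let v := (jv (TTtab a l l))%:~R in let v' := (jv (TTtab a (other l) (other l)))%:~R in
  ((jm (TTtab a l l))%:~R -
     \sum_(i < 5) \sum_(j < 5) (Wcorr a l l i j)%:~R * ((adjG i j)%:~R / 630)) / v -
  (jd (TTtab a l l))%:~R * (je (TTtab a l l))%:~R / v ^+ 2 -
  (jd (TTtab a l (other l)))%:~R * (je (TTtab a (other l) l))%:~R / (v * v').

Lemma ord2_cases (l : 'I_2) : l = ord0 \/ l = lift ord0 ord0.
Proof. by case: l => [[|[|l]] h] //; [left|right]; exact: val_inj. Qed.

Lemma TTtab_diag a (l : 'I_2) : ((jv (TTtab (a : 'I_4) l l))%:~R : C) != 0.
Proof.
by case: (ord4_cases a) => ->; case: (ord2_cases l) => ->; rewrite /TTtab /= pnatr_eq0.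
Qed.

Lemma TTtab_off a (l : 'I_2) : jv (TTtab (a : 'I_4) l (other l)) = 0.
Proof.
by case: (ord4_cases a) => ->; case: (ord2_cases l) => ->.
Qed.

Lemma sum_other (F : 'I_2 -> C) l : \sum_i F i = F l + F (other l).
Proof.
have E0 : other ord0 = lift ord0 ord0 by exact: val_inj.
have E1 : other (lift ord0 ord0) = ord0 by exact: val_inj.
rewrite big_ord_recl big_ord1; case: (ord2_cases l) => ->; rewrite ?E0 ?E1 //.
exact: addrC.
Qed.

Lemma otherK l : other (other l) = l. Proof. exact: rev_ordK. Qed.

Lemma neq_other (i m : 'I_2) : i != m -> m = other i.
Proof. by case: (ord2_cases i) => ->; case: (ord2_cases m) => -> // _; exact: val_inj. Qed.

(** A scalar factor of the Gram matrix, here n^-3, adds the mixed derivative of its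
    logarithm to every diagonal entry. *)
Lemma curvature_split : exists c : 'I_4 -> C, forall a l,
  pderivbar (connection_coef (@Hmx R) a l l) z0 a = ncurv a l + c a.
Proof.
pose f (z : pt) : C := ((nrm z)^-1) ^+ 3.
have /choice [J fJ] (a : 'I_4) : exists j, hasjet U z0 a f j.
  exact: (sm_hasjet a oU Uz0 (sm_inv_nrm R)).
exists (fun a => jm (J a) / jv (J a) - jd (J a) * je (J a) / jv (J a) ^+ 2) => a l.
have hH i m := hasjet_on oU Uz0 (fun z Uz => esym (Hmx_nSchur i m Uz))
  (hasjet_mul oU Uz0 (fJ a) (hasjet_nSchur R a i m)).
have f0 : jv (J a) != 0.
  by rewrite -(jet_v (fJ a)) expf_neq0 // invr_eq0 nrm_neq0.
have v0 (i : 'I_2) := TTtab_diag a i.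
have o1 := TTtab_off a l; have o2 := TTtab_off a (other l); rewrite otherK in o2.
have Hv i m : Hmx z0 i m = jv (J a) * (jv (TTtab a i m))%:~R := jet_v (hH i m).
have key (h h' D p q p' q' : C) :
    h = jv (J a) * (jv (TTtab a l l))%:~R ->
    h' = jv (J a) * (jv (TTtab a (other l) (other l)))%:~R ->
    D = jm (jmul (J a) (nSchur_jet R a l l)) ->
    p = jd (jmul (J a) (nSchur_jet R a l l)) -> q = je (jmul (J a) (nSchur_jet R a l l)) ->
    p' = jd (jmul (J a) (nSchur_jet R a l (other l))) -> q' = je (jmul (J a) (nSchur_jet R a (other l) l)) ->
  (D - (p * q / h + p' * q' / h')) / h = ncurv a l +
    (jm (J a) / jv (J a) - jd (J a) * je (J a) / jv (J a) ^+ 2).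
  move=> -> -> -> -> -> -> ->.
  rewrite /ncurv /jmul /nSchur_jet; cbn [jv jd je jm]; rewrite o1 o2.
  move: (v0 l) (v0 (other l)) f0; move: (\sum_(i < 5) _) => S.
  case: (J a) => [r rd re rm]; cbn [jv jd je jm].
  case: (TTtab a l l) => [v d e w]; cbn [jv jd je jm].
  case: (TTtab a (other l) (other l)) => [v' d' e' w']; cbn [jv jd je jm].
  move: (jd _) (je _) => x y.
  move: (intr v) (intr v') (intr d) (intr e) (intr w) (intr x) (intr y).
  by move=> a1 a2 a3 a4 a5 a6 a7 a10 a20 p0; field; rewrite a10 a20 p0.
rewrite (curvature_diag oU (@sm_Hmx R) (@Hmx_unit R) a l Uz0).
- have [_ [_ _ _ E _]] := hH l l.
  rewrite (sum_other (fun i => pderiv (fun y => Hmx y l i) z0 a *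
    pderivbar (fun y => Hmx y i l) z0 a / Hmx z0 i i) l).
  exact: (key _ _ _ _ _ _ _ (Hv l l) (Hv (other l) (other l)) E (jet_d (hH l l)) (jet_e (hH l l))
    (jet_d (hH l (other l))) (jet_e (hH (other l) l))).
- by move=> i m im; rewrite Hv (neq_other im) TTtab_off mulr0.
- by move=> i; rewrite Hv mulf_neq0.
Qed.

End Final.

Section Gap.
Variable R : realType.
Local Notation C := (CC R).

(** The contribution of W G^-1 W^h to the mixed derivatives of the diagonal of
    nSchur, up to sign. *)
Definition corrtab (a l : nat) : C := nth 0 (nth [::]
  [:: [:: 715 / 7; 0]; [:: 16 / 5; 101 / 21]; [:: 8932 / 9; 97 / 9]; [:: 5^-1; 128 / 3]] a) l.

Lemma corrE (a : 'I_4) (l : 'I_2) :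
  \sum_(i < 5) \sum_(j < 5) (Wcorr a l l i j)%:~R * ((adjG i j)%:~R / 630) = corrtab a l.
Proof.
pose t i j : C := (Wcorr a l l i j)%:~R * ((adjG i j)%:~R / 630).
rewrite -/(t _ _) (eq_bigr (fun i : 'I_5 => foldr +%R 0 (map (t i) (iota 0 5)))) => [|i _]; last exact: big_iota.
rewrite (big_iota 5 (fun i => foldr +%R 0 (map (t i) (iota 0 5)))) /= /t.
case: (ord4_cases a) => ->; case: (ord2_cases l) => ->; rewrite /Wcorr /Wtab /adjG /corrtab /=.
all: by field.
Qed.

Lemma ncurv_gap : \sum_a ncurv R a ord0 / ydiag R a - \sum_a ncurv R a (lift ord0 ord0) / ydiag R a =
  248 / 1323.
Proof.
rewrite !sum_ord4 /ncurv !corrE /corrtab /TTtab /ydiag /=.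
by field.
Qed.

End Gap.

Theorem theorem1 (R : realType) :
  ~ hermitian_einstein (horrocks_mumford R) (@h1 R).
Proof.
move=> [K [mcK [lambda Kl]]].
have [c cE] := curvature_split R.
have S := scalar_curvature_matrix (@frame_domain_open R) (@hm_hol_frame R) (@h1_hm_frame R) (@Hmx_herm R)
  (@sm_Hmx R) (@Hmx_unit R) mcK Kl (zpt_frame_domain R) (@FS_zpt R).
have y0 a : ydiag R a != 0.
  by rewrite /ydiag; case: ifP => _; rewrite invr_eq0 pnatr_eq0.
have E l : \sum_a ncurv R a l / ydiag R a = - toC lambda - \sum_a c a / ydiag R a.
  apply/eqP; rewrite eq_sym subr_eq -big_split /=; apply/eqP.
  rewrite -(S y0 l); apply: eq_bigr => a _.
  by rewrite cE mulrDl.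
have := ncurv_gap R; rewrite !E subrr => /esym/eqP.
by rewrite mulf_eq0 invr_eq0 !pnatr_eq0.
Qed.
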